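(* Let $G$ be a positive injective element of $\mathcal N$. The ($[0,\infty]$-valued) norms $\|\cdot\|_\zeta$ and $\|\cdot\|_{HK}$ on $\mathcal N$ are equivalent; that is, there are constants $0<c\le C<\infty$ such that $c\,\|a\|_{HK}\le\|a\|_\zeta\le C\,\|a\|_{HK}$ for all $a\in\mathcal N$.
   Context: $\mathcal N$ is a semifinite von Neumann algebra acting on a separable Hilbert space, with a fixed faithful normal semifinite trace $\tau$. For $a,b\in\mathcal N$, $s\geq 1$, $\lambda>0$ put $\zeta(a,b;s):=\tau(aG^sb)$ and $g(a,b;\lambda):=\frac1\lambda\tau\big(ae^{-\lambda^{-1}G^{-1}}b\big)$, where $G^{-1}$ is the (possibly unbounded) inverse of $G$ and $e^{-\lambda^{-1}G^{-1}}$ is defined by functional calculus. For $f:(0,\infty)\to[0,\infty]$ the multiplicative Cesàro mean is $(Mf)(\lambda):=\frac1{\log\lambda}\int_1^\lambda f(t)\frac{dt}{t}$. Define $$\|a\|_\zeta:=\sup_{1\le s\le2}\sqrt{s-1}\,\zeta(a^*,a;s)^{1/2},\qquad \|a\|_{HK}:=\|Mg(a^*,a;\cdot)\|_\infty^{1/2},$$ with values in $[0,\infty]$ (and $0\cdot\infty=0$ at $s=1$). *)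

(* Defs.v *)
From HB Require Import structures.
From mathcomp Require Import all_boot all_order all_algebra.
From mathcomp Require Import sesquilinear complex.
From mathcomp Require Import all_classical all_reals all_analysis.

Set Implicit Arguments.
Unset Strict Implicit.
Unset Printing Implicit Defensive.
Import Order.TTheory GRing.Theory Num.Theory.
Import numFieldNormedType.Exports.

Local Open Scope classical_set_scope.
Local Open Scope ring_scope.
Local Open Scope complex_scope.

Section Operators.
Variable R : realType.
Variable H : completeNormedModType R[i].
(* The inner product is linear in its first argument. *)
Variable dot : {dot H for @Num.conj R[i]}.

(* Together with completeness of H this makes (H, dot) a Hilbert space. *)
Definition hilbert_norm : Prop := forall xi : H, dot xi xi = `|xi| ^+ 2.

Definition separable_space : Prop := exists2 D : set H, countable D & dense D.

(* B(H). Operators are bare functions: the pointwise sum, the scalings, the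
   zero operator and composition are those of the function type H -> H. *)
Definition bounded_operators : set (H -> H) :=
  [set x | linear x /\ continuous x].

Definition is_adjoint (x y : H -> H) : Prop :=
  forall xi eta, dot (x xi) eta = dot xi (y eta).

(* The default value 0 is never used when x is in B(H). *)
Definition adjoint (x : H -> H) : H -> H :=
  xget (0 : H -> H) [set y | bounded_operators y /\ is_adjoint x y].

(* The order of R[i] makes this say that (x xi | xi) is real and nonnegative. *)
Definition positive_op (x : H -> H) : Prop := forall xi, 0 <= dot (x xi) xi.

Definition le_op (x y : H -> H) : Prop := positive_op (y - x).

Definition commutant (S : set (H -> H)) : set (H -> H) :=
  [set x | bounded_operators x /\ forall y, S y -> x \o y = y \o x].

Definition von_neumann_algebra (N : set (H -> H)) : Prop :=
  [/\ N `<=` bounded_operators,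
      forall x, N x -> N (adjoint x)
    & commutant (commutant N) = N].

Definition pos_part (N : set (H -> H)) : set (H -> H) :=
  [set x | N x /\ positive_op x].

Definition directed (D : set (H -> H)) : Prop :=
  D !=set0 /\
  forall x y, D x -> D y -> exists z, [/\ D z, le_op x z & le_op y z].

Definition is_supremum (P D : set (H -> H)) (x : H -> H) : Prop :=
  [/\ P x, forall d, D d -> le_op d x
    & forall z, P z -> (forall d, D d -> le_op d z) -> le_op x z].

(* Only the values of tau on the positive cone of N are meaningful. *)
Record faithful_normal_semifinite_trace (N : set (H -> H))
    (tau : (H -> H) -> \bar R) : Prop := {
  trace_ge0 : forall x, pos_part N x -> (0 <= tau x)%E ;
  trace_add : forall x y, pos_part N x -> pos_part N y ->
    tau (x + y) = (tau x + tau y)%E ;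
  trace_scale : forall (c : R) x, 0 <= c -> pos_part N x ->
    tau (c%:C *: x) = (c%:E * tau x)%E ;
  trace_tracial : forall x, N x -> tau (adjoint x \o x) = tau (x \o adjoint x) ;
  trace_faithful : forall x, pos_part N x -> tau x = 0%E -> x = 0 ;
  trace_normal : forall D x, D `<=` pos_part N -> directed D ->
    is_supremum (pos_part N) D x -> tau x = ereal_sup (tau @` D) ;
  trace_semifinite : forall x, pos_part N x -> x <> 0 ->
    exists y, [/\ pos_part N y, y <> 0, le_op y x & (tau y < +oo)%E]
}.

(* Possibly unbounded operators are given by their graphs. *)
Definition graph (x : H -> H) : set (H * H) := [set p | p.2 = x p.1].

Definition inverse_graph (A : set (H * H)) : set (H * H) :=
  [set p | A (p.2, p.1)].

(* E is a projection-valued measure on the Borel sets of R, and mu xi is the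
   scalar measure B |-> (E(B) xi | xi); countable additivity of E is expressed
   by mu xi being a measure. *)
Definition projection_valued_measure (E : set R -> H -> H)
    (mu : H -> {measure set (measurableTypeR R) -> \bar R}) : Prop :=
  [/\ forall B : set (measurableTypeR R), measurable B ->
        [/\ bounded_operators (E B), is_adjoint (E B) (E B)
          & E B \o E B = E B],
      E setT = id,
      forall A B : set (measurableTypeR R), measurable A -> measurable B ->
        E (A `&` B) = E A \o E B
    & forall xi (B : set (measurableTypeR R)), measurable B ->
        mu xi B = (complex.Re (dot (E B xi) xi))%:E].

(* A is the operator \int f dE, whose domain is
   {xi | \int |f|^2 d(E xi | xi) < oo}, for a real Borel function f. *)
Definition spectral_integral
    (mu : H -> {measure set (measurableTypeR R) -> \bar R})
    (f : R -> R) (A : set (H * H)) : Prop :=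
  (forall xi, (exists eta, A (xi, eta)) <->
     (\int[mu xi]_t ((f t) ^+ 2)%:E < +oo)%E) /\
  (forall xi eta, A (xi, eta) -> dot eta xi = (\int[mu xi]_t f t)%:C).

(* Borel functional calculus: f(A) = \int f dE for the spectral measure E of
   the self-adjoint operator A = \int t dE(t). The default value 0 is used only
   when A is not self-adjoint or f(A) is not a bounded operator. *)
Definition functional_calculus (A : set (H * H)) (f : R -> R) : H -> H :=
  xget (0 : H -> H) [set x | bounded_operators x /\ exists E mu,
    [/\ projection_valued_measure E mu, spectral_integral mu id A
      & spectral_integral mu f (graph x)]].

Definition op_power (G : H -> H) (s : R) : H -> H :=
  functional_calculus (graph G) (fun t => t `^ s).

(* exp(- lambda^-1 G^-1) *)
Definition heat_op (G : H -> H) (lambda : R) : H -> H :=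
  functional_calculus (inverse_graph (graph G))
    (fun t => expR (- (lambda^-1 * t))).

(* tau (a G^s b) and lambda^-1 tau (a exp(- lambda^-1 G^-1) b), used only at (adjoint a, a), where the argument of tau
   is a positive operator. *)
Definition zeta (tau : (H -> H) -> \bar R) (G a b : H -> H) (s : R) : \bar R :=
  tau (a \o op_power G s \o b).

Definition heat_trace (tau : (H -> H) -> \bar R) (G a b : H -> H)
    (lambda : R) : \bar R :=
  ((lambda^-1)%:E * tau (a \o heat_op G lambda \o b))%E.

End Operators.

Section Means.
Variable R : realType.
Local Open Scope ereal_scope.

Notation leb := (@lebesgue_measure R).

(* For 0 < lambda < 1 the integral from 1 to lambda is oriented, so that
   Mf >= 0 on (0, oo) minus {1}. *)
Definition cesaro_mean (f : R -> \bar R) (lambda : R) : \bar R :=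
  ((ln lambda)^-1)%:E *
  (if (1 <= lambda)%R then \int[leb]_(t in `[1%R, lambda]) (f t * (t^-1)%:E)
   else - \int[leb]_(t in `[lambda, 1%R]) (f t * (t^-1)%:E)).

(* The norm of L^oo((0, oo), dt). *)
Definition sup_norm (f : R -> \bar R) : \bar R :=
  Lnorm (mrestr leb (measurable_itv `]0%R, +oo[)) +oo f.

Variable H : completeNormedModType R[i].
Variable dot : {dot H for @Num.conj R[i]}.

Definition zeta_norm (tau : (H -> H) -> \bar R) (G a : H -> H) : \bar R :=
  ereal_sup [set (Num.sqrt (s - 1))%:E *
                 poweR (zeta dot tau G (adjoint dot a) a s) 2^-1
            | s in `[1%R, 2%R]].

Definition HK_norm (tau : (H -> H) -> \bar R) (G a : H -> H) : \bar R :=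
  poweR (sup_norm (cesaro_mean (heat_trace dot tau G (adjoint dot a) a))) 2^-1.

End Means.

(* Main.v *)
Require Import Defs.
From HB Require Import structures.
From mathcomp Require Import all_boot all_order all_algebra.
From mathcomp Require Import sesquilinear complex.
From mathcomp Require Import all_classical all_reals all_analysis.
From mathcomp Require Import measurable_realfun ess_sup_inf ring lra.
Import Order.TTheory GRing.Theory Num.Theory.
Import numFieldNormedType.Exports.
Local Open Scope classical_set_scope.
Local Open Scope ring_scope.
Local Open Scope complex_scope.

Set Implicit Arguments.
Unset Strict Implicit.
Unset Printing Implicit Defensive.

(** Put W(f) = tau (a^* f(G) a) for a function f on ]0, |G|], and let
    h_u(t) = exp (- u / t). Both norms only depend on W:
    zeta (a^*, a; s) = W(t^s) and g (a^*, a; l) = W(h_(1/l)) / l. Three properties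
    of W are used: it is additive, it is monotone (tau is positive), and
    W(f) is the supremum of the W((f - 1/n)^+) (tau is normal and the operators
    ((f - 1/n)^+)(G) increase to f(G)). With them, the equivalence is a
    statement about functions of t. As h_u decreases in u, the integral of
    g(t) dt / t from 1 to e^n is, up to constants, the sum over j < n of
    e^(-j) W(h_(e^(-j))).

    Bounding the Cesaro means by zeta. Let s - 1 be of the order of 1 / log l. For
    j <= log l the numbers e^(-j) and e^(-js) are comparable, and the sum over
    j of e^(-js) h_(e^(-j-1))(t) is at most a constant times t^s: its terms are
    bounded by t^s times the steps of a bounded increasing function of e^(-j) / t
    ([sum_heat_fun_le]). Hence the integral up to l is at most a constant times
    zeta(s), which is log l times (s - 1) zeta(s) ([cesaro_le]).

    Bounding zeta by the Cesaro means. Conversely t^s is at most a constant times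
    the sum over j of e^(-js) h_(e^(-j))(t), because of the term with e^(-j)
    close to t. For t >= 1/n finitely many terms suffice, which is why the
    truncations (t^s - 1/n)^+ and the normality of tau enter ([cut_pow_le]). If
    the Cesaro means are bounded by S, the partial sums of e^(-j) W(h_(e^(-j)))
    up to n are at most a constant times S (n + 1), and summation by parts against
    e^(-j(s - 1)) gives zeta(s) <= C S / (s - 1) ([zeta_le_fin]).

    The operators. For a Lipschitz function f, the polynomials approximating f
    give operators converging in norm to f(G). So f(G) lies in N, which is its
    own bicommutant, and does not depend on a spectral measure
    ([calc_exists], [N_calc]). Any spectral measure of G represents this f(G) as an
    integral ([calc_form]), so G^s is f(G) for f(t) = t^s ([op_powerE]). The
    operator exp (- l^(-1) G^(-1)) is defined by a spectral measure of G^(-1).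
    Taking images under t |-> 1/t exchanges the spectral measures of G and of
    G^(-1) ([spectral_of_graph], [spectral_of_inverse]), so this operator is f(G)
    for f = h_(1/l) ([heat_opE]). The same exchange shows that when G has no
    spectral measure, neither has its inverse: then both families of operators
    take the value 0, and so do both norms. *)

(** * The real inner product and bounded operators *)

Section Hilbert.
Variables (R : realType) (H : completeNormedModType R[i]).
Variable dot : {dot H for @Num.conj R[i]}.
Hypothesis hilbertH : hilbert_norm dot.

Definition re_dot (x y : H) : R := complex.Re (dot x y).
Definition nrm (x : H) : R := complex.Re `|x|.

Lemma ReD (x y : R[i]) : complex.Re (x + y) = complex.Re x + complex.Re y.
Proof. by case: x y => [a b] [c d]. Qed.
Lemma ReN (x : R[i]) : complex.Re (- x) = - complex.Re x.
Proof. by case: x. Qed.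
Lemma ReZ (c : R) (x : R[i]) : complex.Re (c%:C * x) = c * complex.Re x.
Proof. by case: x => a b /=; rewrite mul0r subr0. Qed.
Lemma Re_conj (x : R[i]) : complex.Re (Num.conj x) = complex.Re x.
Proof. by case: x. Qed.
Lemma normE (x : H) : `|x| = (nrm x)%:C.
Proof. by rewrite /nrm RRe_real// ger0_real. Qed.

Lemma rdotC x y : re_dot x y = re_dot y x.
Proof. by rewrite /re_dot hermC/= expr0 mul1r Re_conj. Qed.
Lemma rdotDl x y z : re_dot (x + y) z = re_dot x z + re_dot y z.
Proof. by rewrite /re_dot linearDl/= ReD. Qed.
Lemma rdotDr x y z : re_dot z (x + y) = re_dot z x + re_dot z y.
Proof. by rewrite rdotC rdotDl !(rdotC z). Qed.
Lemma rdotNl x y : re_dot (- x) y = - re_dot x y.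
Proof. by rewrite /re_dot linearNl/= ReN. Qed.
Lemma rdotNr x y : re_dot x (- y) = - re_dot x y.
Proof. by rewrite rdotC rdotNl rdotC. Qed.
Lemma rdotBl x y z : re_dot (x - y) z = re_dot x z - re_dot y z.
Proof. by rewrite rdotDl rdotNl. Qed.
Lemma rdotBr x y z : re_dot z (x - y) = re_dot z x - re_dot z y.
Proof. by rewrite rdotDr rdotNr. Qed.
Lemma rdotZl c x y : re_dot (c%:C *: x) y = c * re_dot x y.
Proof. by rewrite /re_dot linearZl/= ReZ. Qed.
Lemma rdotZr c x y : re_dot x (c%:C *: y) = c * re_dot x y.
Proof. by rewrite rdotC rdotZl rdotC. Qed.
Lemma rdot0l x : re_dot 0 x = 0.
Proof. by rewrite /re_dot linear0l. Qed.
Lemma rdot0r x : re_dot x 0 = 0.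
Proof. by rewrite rdotC rdot0l. Qed.

Lemma nrm_ge0 x : 0 <= nrm x.
Proof. by have := normr_ge0 x; rewrite normE lecR. Qed.
Lemma nrm2 x : re_dot x x = nrm x ^+ 2.
Proof. by rewrite /re_dot hilbertH normE -rmorphXn. Qed.
Lemma nrm0 : nrm 0 = 0.
Proof. by rewrite /nrm normr0. Qed.
Lemma nrm_eq0 x : nrm x = 0 -> x = 0.
Proof. by move=> x0; apply/normr0_eq0; rewrite normE x0. Qed.
Lemma nrmD x y : nrm (x + y) <= nrm x + nrm y.
Proof. by have := ler_normD x y; rewrite !normE -rmorphD/= lecR. Qed.
Lemma nrmN x : nrm (- x) = nrm x.
Proof. by rewrite /nrm normrN. Qed.
Lemma nrmB x y : nrm (x - y) <= nrm x + nrm y.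
Proof. by rewrite -(nrmN y) nrmD. Qed.
Lemma nrmZ c x : nrm (c%:C *: x) = `|c| * nrm x.
Proof.
have -> : nrm (c%:C *: x) = complex.Re (`|c|%:C * `|x|); last by rewrite ReZ.
by rewrite /nrm normrZ normc_def/= expr0n addr0 sqrtr_sqr.
Qed.
Lemma cauchy_schwarz x y : `|re_dot x y| <= nrm x * nrm y.
Proof.
have H0 c d : 0 <= c ^+ 2 * nrm x ^+ 2 + 2 * (c * d) * re_dot x y + d ^+ 2 * nrm y ^+ 2.
  have := sqr_ge0 (nrm (c%:C *: x + d%:C *: y)).
  rewrite -[X in 0 <= X -> _]nrm2 rdotDl !rdotDr !rdotZl !rdotZr (rdotC y x) !nrm2; lra.
have [x0|xn0] := eqVneq (nrm x) 0.
  by rewrite (nrm_eq0 x0) rdot0l normr0 nrm0 mul0r.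
have [y0|yn0] := eqVneq (nrm y) 0.
  by rewrite (nrm_eq0 y0) rdot0r normr0 nrm0 mulr0.
have xy : 0 < nrm x * nrm y by rewrite mulr_gt0// lt0r ?xn0 ?yn0 nrm_ge0.
have := H0 (nrm y) (nrm x); have := H0 (nrm y) (- nrm x).
rewrite ler_norml => h1 h2.
apply/andP; split; rewrite -(ler_pM2l xy); nra.
Qed.

Lemma nrm_dist_le x y z : nrm (x - z) <= nrm (x - y) + nrm (y - z).
Proof. by rewrite (le_trans _ (nrmD _ _))// addrA subrK. Qed.

Lemma rdot_eq0 x : (forall y, re_dot x y = 0) -> x = 0.
Proof.
by move=> /(_ x); rewrite nrm2 => /eqP; rewrite sqrf_eq0 => /eqP/nrm_eq0.
Qed.

Definition bdd (x : H -> H) := exists2 K, 0 <= K & forall v, nrm (x v) <= K * nrm v.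

Section linear_fun.
Variable x : H -> H.
Hypothesis lx : linear x.
Lemma linD u v : x (u + v) = x u + x v.
Proof. by have := lx 1 u v; rewrite !scale1r. Qed.
Lemma lin0 : x 0 = 0.
Proof. by have := linD 0 0; rewrite addr0 => /eqP; rewrite -subr_eq0 opprD addNKr oppr_eq0 => /eqP. Qed.
Lemma linZ c u : x (c *: u) = c *: x u.
Proof. by have := lx c u 0; rewrite lin0 !addr0. Qed.
Lemma linN u : x (- u) = - x u.
Proof. by rewrite -scaleN1r linZ scaleN1r. Qed.
Lemma linB u v : x (u - v) = x u - x v.
Proof. by rewrite linD linN. Qed.
Lemma lin_sum (I : Type) (r : seq I) (P : pred I) (F : I -> H) :
  x (\sum_(i <- r | P i) F i) = \sum_(i <- r | P i) x (F i).
Proof. by apply: big_morph; [exact: linD|exact: lin0]. Qed.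
End linear_fun.

(** For linear maps, continuity is a bound by a real constant; all later estimates
    are made with such constants and the real-valued norm [nrm]. *)
Lemma bounded_operatorsP x : bounded_operators x <-> linear x /\ bdd x.
Proof.
split=> [[lx cx]|[lx [K K0 xK]]]; split=> //.
- pose X := GRing.isLinear.Build _ _ _ _ x lx.
  pose f : {linear H -> H} := HB.pack x X.
  have /linear_boundedP : bounded_near f (nbhs 0).
    by apply/linear_bounded_continuous.
  move=> /pinfty_ex_gt0[M M0 MH].
  have MR : M = (complex.Re M)%:C.
    by rewrite RRe_real// gtr0_real.
  exists (complex.Re M).
    by move: M0; rewrite MR ltcR => /ltW.
  move=> v; have := MH v.
  by rewrite /f/= !normE MR -rmorphM/= lecR.
- pose X := GRing.isLinear.Build _ _ _ _ x lx.
  pose f : {linear H -> H} := HB.pack x X.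
  suff : continuous f by [].
  apply/linear_bounded_continuous/linear_boundedP.
  near=> M => v.
  rewrite normE; apply: (@le_trans _ _ (K%:C * `|v|)).
    by rewrite normE -rmorphM/= lecR.
  by apply: ler_wpM2r => //; near: M; apply: nbhs_pinfty_ge; by rewrite ger0_real// lecR.
Unshelve. all: by end_near. Qed.

(** Symmetry for the real part of the inner product, which lets all quadratic
    forms below be real. For a complex-linear map it amounts to self-adjointness:
    see [rsym_real] and [real_rsym]. *)
Definition rsym (x : H -> H) := forall u v, re_dot (x u) v = re_dot u (x v).

Lemma rdot_i x y : re_dot ('i *: x) y = - complex.Im (dot x y).
Proof. by rewrite /re_dot linearZl/=; case: (dot x y) => a b /=; rewrite mul0r mul1r sub0r. Qed.
Lemma rdot_ir x y : re_dot x ('i *: y) = complex.Im (dot x y).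
Proof. by rewrite rdotC rdot_i hermC/= expr0 mul1r; case: (dot x y) => a b /=; rewrite opprK. Qed.

Lemma rsym_real x : linear x -> rsym x -> forall v, dot (x v) v = (re_dot (x v) v)%:C.
Proof.
move=> lx sx v; have := sx ('i *: v) v.
rewrite linZ// rdot_i rdot_i (hermC _ v)/= expr0 mul1r.
rewrite /re_dot; case: (dot (x v) v) => a b /= /eqP; rewrite opprK => ab.
by congr (_ +i* _)%C; lra.
Qed.

(** Polarisation along u + i v, which needs complex scalars: a real-linear map
    such as a rotation can have a vanishing form without being symmetric. *)
Lemma real_rsym x : linear x -> (forall v, complex.Im (dot (x v) v) = 0) -> rsym x.
Proof.
move=> lx rx u v.
have rx' w : re_dot (x w) ('i *: w) = 0 by rewrite rdot_ir rx.
have := rx' (u + 'i *: v); rewrite !(linD lx, linZ lx).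
have ii w : 'i *: ('i *: w) = - w :> H.
  by rewrite scalerA -expr2 sqr_i scaleN1r.
rewrite scalerDr ii !(rdotDl, rdotDr) !rdotNr rx' (_ : re_dot ('i *: x v) ('i *: u) = re_dot (x v) u).
  have := rx' ('i *: v); rewrite linZ// ii rdotNr => /eqP.
  by rewrite oppr_eq0 (rdotC u) => /eqP ->; lra.
by rewrite /re_dot linearZl/= [X in _ * X]linearZr/= mulrA; case: (dot _ _) => a b /=; lra.
Qed.
End Hilbert.

Arguments rdotC {R H dot} x y.

(** * Integrals of essentially bounded functions *)

Section EssBounded.
Variable R : realType.
Notation T := (measurableTypeR R).
Implicit Types (m : {measure set T -> \bar R}) (f g : R -> R) (B : set T).

(** A finite measure integrates every essentially bounded function, so that the
    rules of integration below have no integrability side conditions. *)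
Definition ebd m f := measurable_fun setT (f : T -> R) /\
  exists B K, [/\ measurable B, m (~` B) = 0%E & forall t, B t -> `|f t| <= K].

Lemma ebdI m f B K : measurable_fun setT (f : T -> R) -> measurable B ->
  m (~` B) = 0%E -> (forall t, B t -> `|f t| <= K) -> ebd m f.
Proof. by move=> mf mB m0 fK; split=> //; exists B, K. Qed.

Lemma conull_setT m B : measurable B -> m (~` B) = 0%E -> m setT = m B.
Proof.
move=> mB m0; rewrite -(setUv B) measureU//; first by rewrite [X in (_ + X)%E]m0 adde0.
- exact: measurableC.
- exact: setICr.
Qed.

Lemma ebd_integrable m f : (m setT < +oo)%E -> ebd m f ->
  m.-integrable setT (EFin \o f).
Proof.
move=> fm [mf [B [K [mB m0 fK]]]].
apply/(negligible_integrable (measurableC mB) measurableT _ m0).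
  exact/measurable_EFinP.
rewrite setTD setCK; apply: measurable_bounded_integrable => //.
- by rewrite -(conull_setT mB).
- exact: measurable_funTS.
- exists K; split; first exact: num_real.
  by move=> x Kx t Bt; exact: le_trans (fK t Bt) (ltW Kx).
Qed.

Lemma Rint_conull m f B : (m setT < +oo)%E -> ebd m f -> measurable B ->
  m (~` B) = 0%E -> \int[m]_t f t = \int[m]_(t in B) f t.
Proof.
move=> fm ef mB m0; rewrite /Rintegral (negligible_integral (measurableC mB))//.
  by rewrite setTD setCK.
exact: ebd_integrable.
Qed.

Lemma ebd_cst m c : ebd m (fun=> c).
Proof.
by apply: (ebdI (B := setT) (K := `|c|)); rewrite ?setCT.
Qed.

Lemma Rint_bounds m f B a b : (m setT < +oo)%E ->
  measurable_fun setT (f : T -> R) -> measurable B -> m (~` B) = 0%E ->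
  (forall t, B t -> a <= f t <= b) ->
  a * fine (m setT) <= \int[m]_t f t <= b * fine (m setT).
Proof.
move=> fm mf mB m0 fab.
have ef : ebd m f.
  apply: (ebdI mf mB m0 (K := Num.max `|a| `|b|)) => t /fab /andP[a1 b1].
  rewrite le_max; have [f0|f0] := leP 0 (f t).
    by apply/orP; right; rewrite !ger0_norm// (le_trans f0).
  by apply/orP; left; rewrite !ltr0_norm ?lerN2//; lra.
have ic c : m.-integrable B (EFin \o (fun=> c)).
  by apply: (integrableS measurableT mB) => //; exact: (ebd_integrable fm (ebd_cst m c)).
have iB : m.-integrable B (EFin \o f).
  by apply: (integrableS measurableT mB) => //; exact: ebd_integrable.
rewrite (Rint_conull fm ef mB m0) (conull_setT mB m0) -!Rintegral_cst//.
by apply/andP; split; apply: le_Rintegral => //; try exact: ic; move=> t /fab /andP[].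
Qed.

Lemma ebdD m f g : ebd m f -> ebd m g -> ebd m (fun t => f t + g t).
Proof.
move=> [mf [A [K [mA A0 fK]]]] [mg [B [L [mB B0 gL]]]].
apply: (ebdI (B := A `&` B) (K := K + L)).
- exact: measurable_funD.
- exact: measurableI.
- by rewrite setCI measureU0//; exact: measurableC.
- by move=> t [/fK ? /gL ?]; rewrite (le_trans (ler_normD _ _))// lerD.
Qed.

Lemma ebdM m f g : ebd m f -> ebd m g -> ebd m (fun t => f t * g t).
Proof.
move=> [mf [A [K [mA A0 fK]]]] [mg [B [L [mB B0 gL]]]].
apply: (ebdI (B := A `&` B) (K := K * L)).
- exact: measurable_funM.
- exact: measurableI.
- by rewrite setCI measureU0//; exact: measurableC.
- by move=> t [/fK ? /gL ?]; rewrite normrM ler_pM.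
Qed.

Lemma ebdZ m c f : ebd m f -> ebd m (fun t => c * f t).
Proof. by move=> ef; apply: ebdM => //; exact: ebd_cst. Qed.

Lemma ebdN m f : ebd m f -> ebd m (fun t => - f t).
Proof.
move=> ef; rewrite (_ : (fun t => _) = (fun t => (-1) * f t)); first exact: ebdZ.
by apply/funext => t; rewrite mulN1r.
Qed.

Lemma ebdB m f g : ebd m f -> ebd m g -> ebd m (fun t => f t - g t).
Proof. by move=> ef eg; apply: ebdD => //; exact: ebdN. Qed.

Lemma ebd_exp m f n : ebd m f -> ebd m (fun t => f t ^+ n).
Proof.
move=> ef; elim: n => [|n IH].
  by rewrite (_ : (fun t => _) = (fun=> 1)); [exact: ebd_cst|apply/funext => t].
rewrite (_ : (fun t => _) = (fun t => f t * f t ^+ n)); first exact: ebdM.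
by apply/funext => t; rewrite exprS.
Qed.

Lemma ebd_sum m (F : nat -> R -> R) n : (forall i, ebd m (F i)) ->
  ebd m (fun t => \sum_(i < n) F i t).
Proof.
move=> eF; elim: n => [|n IH].
  by rewrite (_ : (fun t => _) = (fun=> 0)); [exact: ebd_cst|apply/funext => t; rewrite big_ord0].
rewrite (_ : (fun t => _) = (fun t => \sum_(i < n) F i t + F n t)); first exact: ebdD.
by apply/funext => t; rewrite big_ord_recr.
Qed.

Lemma RintD m f g : (m setT < +oo)%E -> ebd m f -> ebd m g ->
  \int[m]_t (f t + g t) = \int[m]_t f t + \int[m]_t g t.
Proof. by move=> fm ef eg; rewrite RintegralD//; exact: ebd_integrable. Qed.

Lemma RintB m f g : (m setT < +oo)%E -> ebd m f -> ebd m g ->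
  \int[m]_t (f t - g t) = \int[m]_t f t - \int[m]_t g t.
Proof. by move=> fm ef eg; rewrite RintegralB//; exact: ebd_integrable. Qed.

Lemma RintZ m c f : (m setT < +oo)%E -> ebd m f ->
  \int[m]_t (c * f t) = c * \int[m]_t f t.
Proof. by move=> fm ef; rewrite RintegralZl//; exact: ebd_integrable. Qed.

Lemma Rint_sum m (F : nat -> R -> R) n : (m setT < +oo)%E ->
  (forall i, ebd m (F i)) ->
  \int[m]_t (\sum_(i < n) F i t) = \sum_(i < n) \int[m]_t F i t.
Proof.
move=> fm eF; elim: n => [|n IH].
  rewrite big_ord0 (_ : (fun t => _) = (fun=> 0)); last by apply/funext => t; rewrite big_ord0.
  by rewrite Rintegral_cst// mul0r.
rewrite big_ord_recr/= -IH -RintD//; last exact: ebd_sum.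
by congr Rintegral; apply/funext => t; rewrite big_ord_recr.
Qed.

Lemma Rint_ae_eq m f g B : (m setT < +oo)%E -> ebd m f -> ebd m g ->
  measurable B -> m (~` B) = 0%E -> (forall t, B t -> f t = g t) ->
  \int[m]_t f t = \int[m]_t g t.
Proof.
move=> fm ef eg mB m0 fg; rewrite (Rint_conull fm ef mB m0) (Rint_conull fm eg mB m0).
by apply: eq_Rintegral => t /[!inE]; exact: fg.
Qed.

Lemma le_Rint m f g B : (m setT < +oo)%E -> ebd m f -> ebd m g ->
  measurable B -> m (~` B) = 0%E -> (forall t, B t -> f t <= g t) ->
  \int[m]_t f t <= \int[m]_t g t.
Proof.
move=> fm ef eg mB m0 fg; rewrite (Rint_conull fm ef mB m0) (Rint_conull fm eg mB m0).
by apply: le_Rintegral => //; apply: (integrableS measurableT mB) => //; exact: ebd_integrable.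
Qed.

Lemma Rint_measure_add m1 m2 m3 f :
  (m1 setT < +oo)%E -> (m2 setT < +oo)%E -> ebd m1 f -> ebd m2 f ->
  (forall A, measurable A -> m3 A = (m1 A + m2 A)%E) ->
  \int[m3]_t f t = \int[m1]_t f t + \int[m2]_t f t.
Proof.
move=> f1 f2 e1 e2 m12; rewrite /Rintegral -fineD; last 2 first.
- exact: integrable_fin_num (ebd_integrable f1 e1).
- exact: integrable_fin_num (ebd_integrable f2 e2).
rewrite -integral_measure_add//.
- congr fine; apply: eq_measure_integral => A mA _.
  by rewrite (m12 A mA); exact/esym/measure_addE.
- exact: (ebd_integrable f1 e1).
- exact: (ebd_integrable f2 e2).
Qed.

Lemma Rint_dist m f g B eps : (m setT < +oo)%E -> ebd m f -> ebd m g ->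
  measurable B -> m (~` B) = 0%E -> (forall t, B t -> `|f t - g t| <= eps) ->
  `|\int[m]_t f t - \int[m]_t g t| <= eps * fine (m setT).
Proof.
move=> fm ef eg mB m0 fg; rewrite -RintB//.
have [mfg _] := ebdB ef eg.
have /andP[h1 h2] := @Rint_bounds m (fun t => f t - g t) B (- eps) eps fm mfg mB m0
   (fun t Bt => ltac:(by rewrite -ler_norml; exact: fg)).
by rewrite ler_norml -mulNr h1.
Qed.

End EssBounded.

(** * Symmetric operators and projection-valued measures *)

Section MoreHilbert.
Variables (R : realType) (H : completeNormedModType R[i]).
Variable dot : {dot H for @Num.conj R[i]}.
Hypothesis hilbertH : hilbert_norm dot.
Local Notation rdot := (re_dot dot).

Lemma sqr_ge0_le (a b : R) : 0 <= b -> a ^+ 2 <= b ^+ 2 -> a <= b.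
Proof.
move=> b0 h; have [a0|a0] := leP 0 a; first by rewrite -(ler_pXn2r (n := 2)).
by rewrite (le_trans (ltW a0)).
Qed.

Lemma nrm2D x y : rdot x y = 0 -> nrm (x + y) ^+ 2 = nrm x ^+ 2 + nrm y ^+ 2.
Proof. by move=> xy; rewrite -!(nrm2 hilbertH) rdotDl !rdotDr (rdotC y) xy; lra. Qed.

(** The positivity of the form at the vector l u - x u reads
    l^2 (x u | u) - 2 l |x u|^2 + (x (x u) | x u) >= 0; bounding the outer terms by
    l^3 |u|^2 and l |x u|^2 gives |x u| <= l |u|. The set S, invariant under x,
    localises the bound to a spectral subspace. *)
Lemma sym_form_bound (S : H -> Prop) (x : H -> H) (l : R) : linear x -> rsym dot x ->
  0 < l ->
  (forall c u v, S u -> S v -> S (c%:C *: u - v)) -> (forall u, S u -> S (x u)) ->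
  (forall u, S u -> 0 <= rdot (x u) u <= l * nrm u ^+ 2) ->
  forall u, S u -> nrm (x u) <= l * nrm u.
Proof.
move=> lx sx l0 Slin Sx form u Su.
have /andP[h _] := form _ (Slin l _ _ Su (Sx _ Su)).
have /andP[_ h1] := form _ Su; have /andP[_ h2] := form _ (Sx _ Su).
apply: sqr_ge0_le; first by rewrite mulr_ge0 ?nrm_ge0// ltW.
move: h; rewrite (linB lx) (linZ lx) rdotBl !rdotBr !rdotZl !rdotZr (sx (x u) u) (nrm2 hilbertH) => h.
have : 0 <= l * (l ^+ 2 * nrm u ^+ 2 - nrm (x u) ^+ 2) by nra.
by rewrite pmulr_rge0// subr_ge0 exprMn.
Qed.

Lemma rsym_form0 x : linear x -> rsym dot x -> (forall v, rdot (x v) v = 0) -> x = 0.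
Proof.
move=> lx sx x0; apply/funext => u.
have h v : rdot (x u) v = 0.
  have := x0 (u + v); rewrite (linD lx) rdotDl !rdotDr !x0 (sx v u) (rdotC v); lra.
by apply: (rdot_eq0 hilbertH).
Qed.

(** An explicit rate of convergence is kept, because limits of operators are taken
    pointwise and their error must be proportional to the norm of the vector. *)
Lemma complete_seq (u : nat -> H) K : 0 <= K ->
  (forall n m, nrm (u n - u m) <= K * (n.+1%:R^-1 + m.+1%:R^-1)) ->
  exists l, forall n, nrm (u n - l) <= K * n.+1%:R^-1.
Proof.
move=> K0 uC.
have inv_small (e : R) : 0 < e -> \forall n \near \oo, K * n.+1%:R^-1 < e.
  move=> e0; near=> n; rewrite -ltr_pdivlMr ?invr_gt0// invrK.
  rewrite mulrC -ltr_pdivrMr// (@lt_le_trans _ _ n%:R) ?ler_nat//.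
  by near: n; exact: nbhs_infty_gtr.
have /cauchy_cvg/cvg_ex[l ul] : cauchy (u @ \oo).
  apply: cauchy_exP => e e0.
  have eR : e = (complex.Re e)%:C by rewrite RRe_real// gtr0_real.
  have e0' : 0 < complex.Re e by rewrite -ltcR -eR.
  near \oo => n; exists (u n).
  suff : \forall m \near \oo, ball (u n) e (u m) by [].
  near=> m; rewrite -ball_normE/= normE eR ltcR.
  apply: (le_lt_trans (uC _ _)).
  have : K * n.+1%:R^-1 < complex.Re e / 2.
    by near: n; apply: (inv_small (complex.Re e / 2)); lra.
  have : K * m.+1%:R^-1 < complex.Re e / 2.
    by near: m; apply: (inv_small (complex.Re e / 2)); lra.
  rewrite mulrDr => h1 h2; rewrite (splitr (complex.Re e)); exact: ltrD.
exists l => n; apply/ler_addgt0Pr => e e0.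
have /cvgrPdist_lt/(_ ((e / 2)%:C)) : u @ \oo --> l by [].
rewrite ltcR divr_gt0// => /(_ isT) H1.
near \oo => m.
apply: le_trans (nrm_dist_le _ (u m) _) _.
have : nrm (u m - l) < e / 2.
  by rewrite -nrmN opprB -ltcR -normE; near: m.
have : K * m.+1%:R^-1 < e / 2 by near: m; apply: (inv_small (e / 2)); lra.
have := uC n m; rewrite mulrDr.
move: (K * n.+1%:R^-1) (K * m.+1%:R^-1) => a b h1 h2 h3; lra.
Unshelve. all: by end_near. Qed.

End MoreHilbert.

Section PVM.
Variables (R : realType) (H : completeNormedModType R[i]).
Variable dot : {dot H for @Num.conj R[i]}.
Hypothesis hilbertH : hilbert_norm dot.
Local Notation rdot := (re_dot dot).
Local Notation T := (measurableTypeR R).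
Variables (E : set R -> H -> H) (mu : H -> {measure set T -> \bar R}).
Hypothesis pvm : projection_valued_measure dot E mu.
Implicit Types A B C : set T.

Lemma pvm_lin B : measurable B -> linear (E B).
Proof. by case: pvm => h _ _ _ /h[[]]. Qed.
Lemma pvm_sym B : measurable B -> rsym dot (E B).
Proof. by move=> mB u v; case: pvm => h _ _ _; have [_ h1 _] := h _ mB; rewrite /re_dot h1. Qed.
Lemma pvm_idem B v : measurable B -> E B (E B v) = E B v.
Proof. by move=> mB; case: pvm => h _ _ _; have [_ _ EE] := h _ mB; rewrite -[in RHS]EE. Qed.
Lemma pvm_setT v : E setT v = v.
Proof. by case: pvm => _ ET _ _; rewrite ET. Qed.
Lemma pvm_setI A B v : measurable A -> measurable B -> E (A `&` B) v = E A (E B v).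
Proof. by case: pvm => _ _ h _ mA mB; rewrite h. Qed.
Lemma muE v B : measurable B -> mu v B = (nrm (E B v) ^+ 2)%:E.
Proof.
move=> mB; case: (pvm) => _ _ _ ->//; congr EFin.
by rewrite -/(re_dot dot (E B v) v) -(nrm2 hilbertH) [RHS]pvm_sym// pvm_idem// rdotC.
Qed.
Lemma mu_T v : mu v setT = (nrm v ^+ 2)%:E.
Proof. by rewrite muE// pvm_setT. Qed.
Lemma mu_fin v : (mu v setT < +oo)%E.
Proof. by rewrite mu_T ltry. Qed.
Lemma fine_mu_T v : fine (mu v setT) = nrm v ^+ 2.
Proof. by rewrite mu_T. Qed.
Lemma pvm_set0 v : E set0 v = 0.
Proof.
have /eqP := muE v (@measurable0 _ T); rewrite measure0 eq_sym eqe sqrf_eq0 => /eqP.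
exact: nrm_eq0.
Qed.
Lemma pvm_orth A B u v : measurable A -> measurable B -> A `&` B = set0 ->
  rdot (E A u) (E B v) = 0.
Proof.
by move=> mA mB AB; rewrite pvm_sym// -pvm_setI// AB pvm_set0 rdot0r.
Qed.
(** Only the measures mu are assumed to be additive. The vectors are: with
    y = E(A u B) v, the square of |y - E(A) v - E(B) v| expands to
    mu v (A u B) - mu v A - mu v B. *)
Lemma pvm_setU A B v : measurable A -> measurable B -> A `&` B = set0 ->
  E (A `|` B) v = E A v + E B v.
Proof.
move=> mA mB AB; have mAB : measurable (A `|` B) by exact: measurableU.
set y := E (A `|` B) v.
have EA : E A y = E A v by rewrite -pvm_setI// setIC setIUl setIid (setIC B) AB setU0.
have EB : E B y = E B v by rewrite -pvm_setI// setIC setIUl setIid AB set0U.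
have : mu v (A `|` B) = (mu v A + mu v B)%E by rewrite measureU.
rewrite !muE// -/y -EFinD => -[yAB].
clearbody y.
apply/eqP; rewrite -subr_eq0; apply/eqP/nrm_eq0/eqP.
rewrite -sqrf_eq0 -(nrm2 hilbertH) !(rdotBl, rdotBr, rdotDl, rdotDr).
have yE C : measurable C -> rdot y (E C v) = rdot (E C y) (E C v).
  by move=> mC; rewrite (pvm_sym mC) pvm_idem.
have ABv : rdot (E A v) (E B v) = 0 by exact: pvm_orth.
rewrite (rdotC (E A v) y) (rdotC (E B v) y) !yE// EA EB (rdotC (E B v) (E A v)) ABv !(nrm2 hilbertH).
by apply/eqP; lra.
Qed.
Lemma pvm_setC B v : measurable B -> E B v + E (~` B) v = v.
Proof.
by move=> mB; rewrite -pvm_setU ?setICr ?setUv ?pvm_setT//; exact: measurableC.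
Qed.
Lemma pvm_fixC B v : measurable B -> E B v = v <-> E (~` B) v = 0.
Proof.
move=> mB; have EC := pvm_setC v mB; split=> h.
  by move: EC; rewrite h => /eqP; rewrite addrC -subr_eq0 addrK => /eqP.
by move: EC; rewrite h addr0.
Qed.
Lemma mu_fix B v : measurable B -> E B v = v <-> mu v (~` B) = 0%E.
Proof.
move=> mB; rewrite pvm_fixC// muE; last exact: measurableC.
split=> [->|/eqP]; first by rewrite nrm0 expr0n.
by rewrite eqe sqrf_eq0 => /eqP/nrm_eq0.
Qed.
Lemma pvm_fixS A B v : measurable A -> measurable B -> A `<=` B -> E A v = v -> E B v = v.
Proof.
move=> mA mB AB Av; rewrite -[in LHS]Av -pvm_setI//.
have -> : B `&` A = A by apply/setIidPr.
exact: Av.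
Qed.
Lemma pvm_fix_lin B c u v : measurable B -> E B u = u -> E B v = v ->
  E B (c%:C *: u - v) = c%:C *: u - v.
Proof. by move=> mB Eu Ev; rewrite (linB (pvm_lin mB)) (linZ (pvm_lin mB)) Eu Ev. Qed.
(** The cross terms of |E(C) u + E(C) v|^2 vanish, as E(C) u and E(C) v lie in
    orthogonal spectral subspaces. *)
Lemma mu_add A B u v C : measurable A -> measurable B -> A `&` B = set0 ->
  E A u = u -> E B v = v -> measurable C -> mu (u + v) C = (mu u C + mu v C)%E.
Proof.
move=> mA mB AB Au Bv mC; rewrite !muE// -EFinD (linD (pvm_lin mC)) (nrm2D hilbertH)//.
by rewrite -Au -Bv -!pvm_setI// setIC (setIC C) !pvm_setI// pvm_orth.
Qed.
Lemma Rint_add A B u v f : measurable A -> measurable B -> A `&` B = set0 ->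
  E A u = u -> E B v = v -> ebd (mu u) f -> ebd (mu v) f ->
  \int[mu (u + v)]_t f t = \int[mu u]_t f t + \int[mu v]_t f t.
Proof.
move=> mA mB AB Au Bv eu ev; apply: Rint_measure_add => //; try exact: mu_fin.
by move=> C mC; exact: (mu_add mA mB).
Qed.
Lemma mu_bigcup0 (F : nat -> set T) v : (forall n, measurable (F n)) ->
  (forall n, mu v (F n) = 0%E) -> mu v (\bigcup_n F n) = 0%E.
Proof.
move=> mF F0; apply/negligibleP; first exact: bigcupT_measurable.
apply: negligible_bigcup => n; apply/negligibleP; [exact: mF|exact: F0].
Qed.

(** The vector E(A) v is itself fixed by E(A). *)
Lemma mu0_fix A : measurable A -> (forall u, E A u = u -> u = 0) -> forall v, mu v A = 0%E.
Proof. by move=> mA h v; rewrite muE// (h (E A v)) ?nrm0 ?expr0n//; exact: pvm_idem. Qed.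

Section push.
Variable (h : R -> R).
Hypothesis mh : measurable_fun setT (h : T -> T).

(** The pushforward is given with its structure of measure, as the definition
    of a projection-valued measure requires. *)
Definition push_measure v : {measure set T -> \bar R} :=
  measure_function_pushforward__canonical__measure_function_Measure (mu v) mh.

Lemma push_measureE v B : push_measure v B = mu v (h @^-1` B).
Proof. by []. Qed.

Lemma measurable_preim (B : set T) : measurable B -> measurable (h @^-1` B : set T).
Proof. by move=> mB; rewrite -[X in measurable X]setTI; exact: mh. Qed.

Lemma pvm_push :
  projection_valued_measure dot (fun B => E (h @^-1` B)) push_measure.
Proof.
case: (pvm) => p1 p2 p3 p4; split.
- by move=> B mB; apply: p1; exact: measurable_preim.
- by rewrite preimage_setT.
- by move=> A B mA mB; rewrite preimage_setI p3//; exact: measurable_preim.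
- by move=> v B mB; rewrite push_measureE p4//; exact: measurable_preim.
Qed.

Lemma ge0_Int_push v (f : R -> \bar R) : measurable_fun setT (f : T -> _) ->
  (forall t, 0 <= f t)%E ->
  (\int[push_measure v]_t f t = \int[mu v]_t f (h t))%E.
Proof. by move=> mf f0; rewrite ge0_integral_pushforward. Qed.

Lemma Rint_push v f : measurable_fun setT (f : T -> R) ->
  ebd (mu v) (fun t => f (h t)) ->
  \int[push_measure v]_t f t = \int[mu v]_t f (h t).
Proof.
move=> mf ef; rewrite /Rintegral integral_pushforward//.
- exact/measurable_EFinP.
- by apply: ebd_integrable ef; exact: mu_fin.
Qed.
End push.
End PVM.

(** * Polynomials in a bounded operator and their norm limits *)

(** Equalities of vectors and of numbers obtained as limits are all proved through
    this criterion, applied to the norm of a difference. *)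
Lemma le0_small (R : realType) (a K : R) : (forall e : R, 0 < e -> a <= e * K) -> a <= 0.
Proof.
move=> h; rewrite leNgt; apply/negP => a0.
have K0 : 0 < `|K| + 1 by rewrite ltr_wpDl.
have := h (a / (2 * (`|K| + 1))) _; rewrite divr_gt0// ?mulr_gt0// => /(_ isT).
apply/negP; rewrite -ltNge.
have -> : a / (2 * (`|K| + 1)) * K = a / 2 * (K / (`|K| + 1)) by field; rewrite gt_eqF.
have : K / (`|K| + 1) <= 1.
  by rewrite ler_pdivrMr// mul1r (le_trans (ler_norm K))// lerDl.
by move: (K / _) => k k1; nra.
Qed.

Section PolyCalculus.
Variables (R : realType) (H : completeNormedModType R[i]).
Variable dot : {dot H for @Num.conj R[i]}.
Hypothesis hilbertH : hilbert_norm dot.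
Local Notation rdot := (re_dot dot).
Variables (A : H -> H) (M : R).
Hypotheses (lA : linear A) (M0 : 0 < M) (bA : forall v, nrm (A v) <= M * nrm v).
Hypothesis sA : rsym dot A.

Lemma nrmZc (c : R[i]) (v : H) : nrm (c *: v) = complex.Re `|c| * nrm v.
Proof.
by rewrite /nrm normrZ -[`|c|](RRe_real (ger0_real (normr_ge0 c))) ReZ.
Qed.

Lemma iter_lin i : linear (iter i A).
Proof. by elim: i => // i IH c u v /=; rewrite IH lA. Qed.
Lemma iter_bound i v : nrm (iter i A v) <= M ^+ i * nrm v.
Proof.
elim: i => [|i IH]; first by rewrite expr0 mul1r.
by rewrite exprS -mulrA (le_trans (bA _))// ler_pM2l.
Qed.
Lemma iter_rsym i : rsym dot (iter i A).
Proof. by elim: i => // i IH u v; rewrite iterS iterSr sA IH. Qed.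

Definition poly_op (p : {poly R}) (v : H) : H :=
  \sum_(i < size p) (p`_i)%:C *: iter i A v.

Lemma poly_op_widen n (p : {poly R}) v : (size p <= n)%N -> poly_op p v = \sum_(i < n) (p`_i)%:C *: iter i A v.
Proof.
move=> pn; rewrite /poly_op (big_ord_widen _ (fun i => (p`_i)%:C *: iter i A v) pn).
rewrite big_mkcond/=; apply: eq_bigr => i _.
by case: ltnP => // /(nth_default 0) ->; rewrite scale0r.
Qed.
Lemma poly_op_lin p : linear (poly_op p).
Proof.
move=> c u v; rewrite /poly_op scaler_sumr -big_split/=; apply: eq_bigr => i _.
by rewrite iter_lin scalerDr !scalerA mulrC.
Qed.
Lemma poly_opB p q v : poly_op (p - q) v = poly_op p v - poly_op q v.
Proof.
pose n := maxn (size (p - q)) (maxn (size p) (size q)).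
rewrite !(@poly_op_widen n) ?leq_max ?leqnn ?orbT// -sumrB; apply: eq_bigr => i _.
by rewrite coefB rmorphB/= scalerBl.
Qed.
Lemma poly_op_comm p v : poly_op p (A v) = A (poly_op p v).
Proof.
rewrite /poly_op (lin_sum lA); apply: eq_bigr => i _.
by rewrite (linZ lA) -iterS iterSr.
Qed.
Lemma poly_op_X p v : poly_op ('X * p) v = A (poly_op p v).
Proof.
rewrite (@poly_op_widen (size p).+1); last first.
  by rewrite (leq_trans (size_polyMleq _ _))// size_polyX.
rewrite big_ord_recl coefXM/= scale0r add0r /poly_op (lin_sum lA); apply: eq_bigr => i _.
by rewrite coefXM/= (linZ lA).
Qed.
Lemma poly_op_1 v : poly_op 1 v = v.
Proof. by rewrite /poly_op size_poly1 big_ord1 coef1 scale1r. Qed.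
Lemma poly_op_bdd p : bdd (poly_op p).
Proof.
exists (\sum_(i < size p) `|p`_i| * M ^+ i).
  by apply: sumr_ge0 => i _; rewrite mulr_ge0// exprn_ge0// ltW.
move=> v; rewrite /poly_op mulr_suml.
elim/big_ind2 : _ => [|x1 x2 y1 y2 h1 h2|i _]; first by rewrite nrm0.
  by rewrite (le_trans (nrmD _ _))// lerD.
by rewrite nrmZ -mulrA ler_wpM2l// iter_bound.
Qed.
Lemma rdot_suml (I : Type) (r : seq I) (P : pred I) (F : I -> H) v :
  rdot (\sum_(i <- r | P i) F i) v = \sum_(i <- r | P i) rdot (F i) v.
Proof. by apply: (big_morph (fun x => rdot x v)) => [x y|]; rewrite ?rdotDl ?rdot0l. Qed.
Lemma rdot_sumr (I : Type) (r : seq I) (P : pred I) (F : I -> H) v :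
  rdot v (\sum_(i <- r | P i) F i) = \sum_(i <- r | P i) rdot v (F i).
Proof. by apply: (big_morph (fun x => rdot v x)) => [x y|]; rewrite ?rdotDr ?rdot0r. Qed.
Lemma poly_op_rsym p : rsym dot (poly_op p).
Proof.
move=> u v; rewrite /poly_op rdot_suml rdot_sumr; apply: eq_bigr => i _.
by rewrite rdotZl rdotZr iter_rsym.
Qed.

(** This says that x is f(A), where f is continuous on [0, M]: the same polynomials
    approximate f uniformly on [0, M] and x in operator norm. No spectral
    measure is mentioned. *)
Definition is_calc (f : R -> R) (x : H -> H) := forall e : R, 0 < e -> exists p : {poly R},
  (forall t : R, 0 <= t <= M -> `|p.[t] - f t| <= e) /\
  (forall v, nrm (poly_op p v - x v) <= e * nrm v).

Lemma is_calc_lin f x : is_calc f x -> linear x.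
Proof.
move=> fx c u v; apply/eqP; rewrite -subr_eq0; apply/eqP/nrm_eq0/eqP.
rewrite eq_le nrm_ge0 andbT.
apply: (@le0_small _ _ (nrm (c *: u + v) + complex.Re `|c| * nrm u + nrm v)) => e e0.
have [p [_ px]] := fx e e0.
have -> : x (c *: u + v) - (c *: x u + x v) =
  - (poly_op p (c *: u + v) - x (c *: u + v)) + c *: (poly_op p u - x u) + (poly_op p v - x v).
  rewrite poly_op_lin scalerBr opprB; apply/esym.
  by rewrite -addrA [X in _ + X]addrACA -opprD addrA subrK.
rewrite !mulrDr.
apply: (le_trans (nrmD _ _)); apply: lerD; last exact: px.
apply: (le_trans (nrmD _ _)); apply: lerD; first by rewrite nrmN px.
rewrite nrmZc mulrCA ler_wpM2l//.
  by have := normr_ge0 c; rewrite -[`|c|](RRe_real (ger0_real (normr_ge0 c))) lecR.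
Qed.

Lemma is_calc_bdd f x : is_calc f x -> bdd x.
Proof.
move=> /(_ 1 ltr01)[p [_ px]]; have [K K0 pK] := poly_op_bdd p.
exists (K + 1); first by rewrite addr_ge0.
move=> v; rewrite -[x v](subKr (poly_op p v)) mulrDl.
by apply: (le_trans (nrmB _ _)); apply: lerD.
Qed.

Lemma is_calc_rsym f x : is_calc f x -> rsym dot x.
Proof.
move=> fx u v; apply/eqP; rewrite -subr_eq0 -normr_eq0 eq_le normr_ge0 andbT.
apply: (@le0_small _ _ (2 * (nrm u * nrm v))) => e e0.
have [p [_ px]] := fx e e0.
have -> : rdot (x u) v - rdot u (x v) =
   rdot u (poly_op p v - x v) - rdot (poly_op p u - x u) v.
  by rewrite rdotBl rdotBr poly_op_rsym; lra.
apply: (le_trans (ler_normB _ _)).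
apply: (le_trans (lerD (cauchy_schwarz hilbertH _ _) (cauchy_schwarz hilbertH _ _))).
have h1 : nrm u * nrm (poly_op p v - x v) <= e * (nrm u * nrm v).
  by rewrite mulrCA ler_wpM2l ?nrm_ge0.
have h2 : nrm (poly_op p u - x u) * nrm v <= e * (nrm u * nrm v).
  by rewrite mulrA ler_wpM2r ?nrm_ge0.
by rewrite mulrCA mulr_natl mulr2n lerD.
Qed.

Lemma is_calc_1 : is_calc (fun=> 1) id.
Proof.
move=> e e0; exists 1; split=> [t _|v].
  by rewrite hornerC subrr normr0 ltW.
by rewrite poly_op_1 subrr nrm0 mulr_ge0 ?nrm_ge0// ltW.
Qed.

Lemma is_calcB f g x y : is_calc f x -> is_calc g y ->
  is_calc (fun t => f t - g t) (fun v => x v - y v).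
Proof.
move=> fx gy e e0; have e2 : 0 < e / 2 by rewrite divr_gt0.
have [p [pf px]] := fx _ e2; have [q [qg qy]] := gy _ e2.
exists (p - q); split=> [t tM|v].
  rewrite hornerD hornerN (_ : _ - _ = (p.[t] - f t) - (q.[t] - g t)); last by lra.
  by rewrite (le_trans (ler_normB _ _))// [leRHS](splitr e) lerD// ?pf ?qg.
rewrite poly_opB (_ : _ - _ = (poly_op p v - x v) - (poly_op q v - y v)); last first.
  by rewrite !opprB addrACA [RHS]addrACA; congr (_ + _); rewrite addrC.
by rewrite (le_trans (nrmB _ _))// (splitr e) mulrDl lerD.
Qed.

(** The polynomial approximating f is multiplied by X; the error grows at most by
    the factor M, both for numbers in [0, M] and for operators. *)
Lemma is_calcA f x : is_calc f x -> is_calc (fun t => t * f t) (fun v => A (x v)).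
Proof.
move=> fx e e0; have [p [pf px]] := fx (e / M) (divr_gt0 e0 M0).
exists ('X * p); split=> [t /andP[t0 tM]|v].
  rewrite hornerM hornerX -mulrBr normrM ger0_norm//.
  apply: (@le_trans _ _ (M * (e / M))); last by rewrite mulrC divfK// gt_eqF.
  by rewrite ler_pM// pf ?t0.
rewrite poly_op_X -(linB lA); apply: (le_trans (bA _)).
by rewrite -ler_pdivlMl// mulrA (mulrC _ e); exact: px.
Qed.

Lemma is_calc_comm f x : is_calc f x -> forall v, x (A v) = A (x v).
Proof.
move=> fx v; apply/eqP; rewrite -subr_eq0; apply/eqP/nrm_eq0/eqP.
rewrite eq_le nrm_ge0 andbT; apply: (@le0_small _ _ (2 * M * nrm v)) => e e0.
have [p [_ px]] := fx e e0.
have -> : x (A v) - A (x v) = A (poly_op p v - x v) - (poly_op p (A v) - x (A v)).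
  by rewrite (linB lA) poly_op_comm opprB [RHS]addrC addrA subrK.
apply: (le_trans (nrmB _ _)).
have h1 : nrm (A (poly_op p v - x v)) <= e * (M * nrm v).
  by rewrite (le_trans (bA _))// mulrCA ler_pM2l.
have h2 : nrm (poly_op p (A v) - x (A v)) <= e * (M * nrm v).
  by rewrite (le_trans (px _))// ler_pM2l.
by lra.
Qed.
End PolyCalculus.

(** * Spectral calculus of a bounded positive operator *)

Section SpectralCalculus.
Variables (R : realType) (H : completeNormedModType R[i]).
Variable dot : {dot H for @Num.conj R[i]}.
Hypothesis hilbertH : hilbert_norm dot.
Local Notation rdot := (re_dot dot).
Local Notation T := (measurableTypeR R).
Variables (A : H -> H) (M : R).
Hypotheses (lA : linear A) (M0 : 0 < M) (bA : forall v, nrm (A v) <= M * nrm v).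
Hypothesis sA : rsym dot A.
Variables (E : set R -> H -> H) (mu : H -> {measure set T -> \bar R}).
Hypothesis pvm : projection_valued_measure dot E mu.
Hypothesis supp : forall v, mu v (~` `[0, M]%classic) = 0%E.
Hypothesis formA : forall v, rdot (A v) v = \int[mu v]_t t.

Let mM : measurable (`[0, M]%classic : set T).
Proof. exact: measurable_itv. Qed.
Let fin v : (mu v setT < +oo)%E := mu_fin hilbertH pvm v.

Lemma ebd_on (f : R -> R) K v : measurable_fun setT (f : T -> R) ->
  (forall t : R, 0 <= t <= M -> `|f t| <= K) -> ebd (mu v) f.
Proof.
move=> mf fK; apply: (ebdI mf mM (supp v) (K := K)) => t /=.
by rewrite in_itv/=; exact: fK.
Qed.

Lemma ebd_id v : ebd (mu v) id.
Proof.
apply: (@ebd_on _ M); first exact: measurable_id.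
by move=> t /andP[t0 tM]; rewrite ger0_norm.
Qed.

Lemma ebd_horner (p : {poly R}) v : ebd (mu v) (fun t => p.[t]).
Proof.
rewrite (_ : (fun t => _) = (fun t => \sum_(i < size p) p`_i * t ^+ i)).
  by apply: (@ebd_sum _ _ (fun i t => p`_i * t ^+ i)) => i; apply: ebdZ; apply: ebd_exp; exact: ebd_id.
by apply/funext => t; rewrite horner_coef.
Qed.

(** The form of A is additive on orthogonal spectral subspaces, since the
    measures mu are. Hence (A y | w) = 0 for y in the range of E(C) and w in that of
    its complement, and A preserves both ranges. *)
Lemma pvm_commute B v : measurable B -> E B (A v) = A (E B v).
Proof.
move=> mB.
have key C u : measurable C -> E (~` C) (A (E C u)) = 0.
  move=> mC; have mC' := measurableC mC.
  set y := E C u.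
  have yC : E C y = y by exact: (pvm_idem pvm).
  have orth w : E (~` C) w = w -> rdot (A y) w = 0.
    move=> wC; have := formA (y + w).
    rewrite (Rint_add hilbertH pvm mC mC' (setICr C) yC wC (ebd_id _) (ebd_id _)).
    rewrite -!formA (linD lA) rdotDl !rdotDr (sA w y) (rdotC w); lra.
  apply/nrm_eq0/eqP; rewrite -sqrf_eq0 -(nrm2 hilbertH) (pvm_sym pvm mC').
  by rewrite orth// !(pvm_idem pvm).
have /(pvm_fixC hilbertH pvm _ mB) h1 := key B v mB.
have h2 : E B (A (E (~` B) v)) = 0.
  by have := key (~` B) v (measurableC mB); rewrite setCK.
by rewrite -[in LHS](pvm_setC hilbertH pvm v mB) (linD lA) (linD (pvm_lin pvm mB)) h2 addr0.
Qed.

Lemma pvm_commute_iter B i v : measurable B -> E B (iter i A v) = iter i A (E B v).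
Proof. by move=> mB; elim: i => // i IH; rewrite /= pvm_commute// IH. Qed.

Notation I a b := (`[a, b[%classic : set T).

(** On the range of E([a, b[), the form of A - a is the integral of t - a, between
    0 and (b - a) |u|^2. *)
Lemma near_scalar (a b : R) v : 0 <= a -> a < b -> E (I a b) v = v ->
  nrm (A v - a%:C *: v) <= (b - a) * nrm v.
Proof.
move=> a0 ab Iv; have mI : measurable (I a b) by exact: measurable_itv.
apply: (@sym_form_bound _ _ _ hilbertH (fun u => E (I a b) u = u)
  (fun u => A u - a%:C *: u)) => //.
- move=> c x y; rewrite lA scalerBr scalerDr !scalerA opprD addrACA.
  by rewrite (mulrC _ c).
- by move=> x y; rewrite rdotBl rdotBr rdotZl rdotZr sA.
- by rewrite subr_gt0.
- by move=> c x y Ix Iy; exact: (pvm_fix_lin pvm).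
- move=> x Ix; rewrite (linB (pvm_lin pvm mI)) (linZ (pvm_lin pvm mI)) pvm_commute//.
  by rewrite Ix.
- move=> x Ix; rewrite rdotBl rdotZl formA (nrm2 hilbertH).
  have x0 : mu x (~` I a b) = 0%E by apply/(mu_fix hilbertH pvm).
  have /andP[h1 h2] := @Rint_bounds _ _ id _ a b (fin x) (@measurable_id _ _ _) mI x0
    (fun t => ltac:(by rewrite /= in_itv/= => /andP[-> /ltW ->])).
  by rewrite (fine_mu_T hilbertH pvm) in h1 h2; apply/andP; split; lra.
Qed.

(** A Lipschitz constant of t^m on [0, L], defined by the recursion that the
    operators of [near_scalar_iter] satisfy. *)
Fixpoint pow_lip_cst (L : R) m := if m is k.+1 then L * pow_lip_cst L k + L ^+ k else 0.

Lemma pow_lip_cst_ge0 L m : 0 <= L -> 0 <= pow_lip_cst L m.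
Proof. by move=> L0; elim: m => //= m IH; rewrite addr_ge0// ?mulr_ge0// exprn_ge0. Qed.

Lemma pow_diff_le (L a b : R) m : 0 <= a -> a <= b -> b <= L ->
  b ^+ m - a ^+ m <= pow_lip_cst L m * (b - a).
Proof.
move=> a0 ab bL; elim: m => [|m IH]; first by rewrite subrr mul0r.
have -> : b ^+ m.+1 - a ^+ m.+1 = b ^+ m * (b - a) + a * (b ^+ m - a ^+ m).
  by rewrite !exprS; ring.
rewrite /= mulrDl addrC lerD//; last first.
  by rewrite ler_wpM2r ?subr_ge0// lerXn2r// ?nnegrE; lra.
rewrite -mulrA; apply: ler_pM => //; last by lra.
by rewrite subr_ge0 lerXn2r// ?nnegrE; lra.
Qed.

Lemma near_scalar_iter (a b : R) m v : 0 <= a -> a < b -> b <= M + 1 -> E (I a b) v = v ->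
  nrm (iter m A v - (a ^+ m)%:C *: v) <= pow_lip_cst (M + 1) m * (b - a) * nrm v.
Proof.
move=> a0 ab bM Iv; have L0 : 0 <= M + 1 by lra.
elim: m => [|m IH]; first by rewrite /= scale1r subrr nrm0 !mul0r.
have -> : iter m.+1 A v - (a ^+ m.+1)%:C *: v =
    A (iter m A v - (a ^+ m)%:C *: v) + (a ^+ m)%:C *: (A v - a%:C *: v).
  rewrite (linB lA) (linZ lA) scalerBr addrA subrK scalerA -rmorphM/=.
  by rewrite exprSr.
have ML : M <= M + 1 by lra.
rewrite /=; move: (M + 1) L0 ML bM IH => L L0 ML bL IH.
apply: (le_trans (nrmD _ _)); rewrite [in leRHS]mulrDl [in leRHS]mulrDl lerD//.
  apply: (le_trans (bA _)); rewrite -!mulrA; apply: ler_pM; rewrite ?nrm_ge0 ?(ltW M0)//.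
  by rewrite mulrA.
rewrite nrmZ -mulrA ler_pM ?nrm_ge0// ?near_scalar//.
by rewrite ger0_norm ?exprn_ge0// lerXn2r// ?nnegrE; lra.
Qed.

(** A functional Q that is additive over disjoint spectral pieces, and of order
    (b - a) |v|^2 on the range of E([a, b[), vanishes. Cutting [0, M + 1[ into
    2^n equal pieces bounds |Q v| by K (M + 1) / 2^n |v|^2, as the squared norms
    of the pieces of v add up to |v|^2. *)
Section bisection.
Variables (Q : H -> R) (K : R).
Hypothesis K0 : 0 <= K.
Hypothesis Qadd : forall B C v, measurable B -> measurable C -> B `&` C = set0 ->
  Q (E B v + E C v) = Q (E B v) + Q (E C v).
Hypothesis Qsmall : forall (a b : R) v, 0 <= a -> a < b -> b <= M + 1 ->
  E (I a b) v = v -> `|Q v| <= K * (b - a) * nrm v ^+ 2.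

Lemma itv_split (a b c : R) : a <= b -> b <= c -> I a c = I a b `|` I b c.
Proof. by move=> ab bc; rewrite -itv_bndbnd_setU// bnd_simp. Qed.
Lemma itv_disj a b c : I a b `&` I b c = set0.
Proof.
apply/seteqP; split=> // t [] /=; rewrite !in_itv/= => /andP[_ tb] /andP[bt _].
by move: (lt_le_trans tb bt); rewrite ltxx.
Qed.

Lemma bisection_le n (a b : R) v : 0 <= a -> a < b -> b <= M + 1 ->
  `|Q (E (I a b) v)| <= K * ((b - a) / 2 ^+ n) * nrm (E (I a b) v) ^+ 2.
Proof.
elim: n a b => [|n IH] a b a0 ab bM.
  rewrite expr0 divr1; by apply: Qsmall => //; apply: (pvm_idem pvm); exact: measurable_itv.
set c := (a + b) / 2.
have ac : a < c by rewrite /c; lra.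
have cb : c < b by rewrite /c; lra.
have m1 : measurable (I a c) by exact: measurable_itv.
have m2 : measurable (I c b) by exact: measurable_itv.
rewrite (itv_split (ltW ac) (ltW cb)) (pvm_setU hilbertH pvm)//; last exact: itv_disj.
rewrite Qadd//; last exact: itv_disj.
rewrite (nrm2D hilbertH); last by apply: (pvm_orth hilbertH pvm) => //; exact: itv_disj.
have e1 : (b - a) / 2 ^+ n.+1 = (c - a) / 2 ^+ n.
  by rewrite exprS invfM mulrA; congr (_ / _); rewrite /c; lra.
have e2 : (b - a) / 2 ^+ n.+1 = (b - c) / 2 ^+ n.
  by rewrite exprS invfM mulrA; congr (_ / _); rewrite /c; lra.
rewrite mulrDr (le_trans (ler_normD _ _))// lerD//.
  by rewrite e1; apply: IH => //; lra.
by rewrite e2; apply: IH => //; lra.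
Qed.

Lemma bisection_eq0 v : Q v = 0.
Proof.
have mI : measurable (I 0 (M + 1)) by exact: measurable_itv.
have Iv : E (I 0 (M + 1)) v = v.
  apply: (pvm_fixS pvm mM mI); last exact/(mu_fix hilbertH pvm).
  by move=> t /=; rewrite !in_itv/= => /andP[-> tM]/=; lra.
apply/eqP; rewrite -normr_eq0 eq_le normr_ge0 andbT.
apply: (@le0_small _ _ (K * nrm v ^+ 2)) => e e0.
have [n Mn] : exists n, (M + 1) / 2 ^+ n <= e.
  exists (Num.truncn ((M + 1) / e)).+1.
  rewrite ler_pdivrMr ?exprn_gt0// mulrC -ler_pdivrMr//.
  apply: (le_trans (ltW (truncnS_gt _))).
  by rewrite -natrX ler_nat ltnW// ltn_expl.
have M10 : 0 < M + 1 by rewrite addr_gt0.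
have := @bisection_le n 0 (M + 1) v (lexx _) M10 (lexx _).
rewrite Iv subr0 => /le_trans; apply.
rewrite mulrAC mulrC ler_wpM2r// mulr_ge0// sqr_ge0//.
Qed.
End bisection.

(** Apply the bisection to the difference of the two sides: on the range of
    E([a, b[) both are a^m |v|^2 up to an error of order (b - a) |v|^2. *)
Lemma moment_form m v : rdot (iter m A v) v = \int[mu v]_t (t ^+ m).
Proof.
apply/eqP; rewrite -subr_eq0; apply/eqP.
pose Q w := rdot (iter m A w) w - \int[mu w]_t (t ^+ m).
have L0 : 0 <= M + 1 by rewrite addr_ge0// ltW.
have et w : ebd (mu w) (fun t => t ^+ m) by apply: ebd_exp; exact: ebd_id.
apply: (@bisection_eq0 Q (2 * pow_lip_cst (M + 1) m)).
- by rewrite mulr_ge0// pow_lip_cst_ge0.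
- move=> B C w mB mC BC; rewrite /Q.
  have Bi u D : measurable D -> E D (E D u) = E D u by move=> ?; exact: (pvm_idem pvm).
  rewrite (Rint_add hilbertH pvm mB mC BC (Bi _ _ mB) (Bi _ _ mC) (et _) (et _)).
  rewrite (linD (iter_lin lA m)) rdotDl !rdotDr -!pvm_commute_iter//.
  have o1 u u' : rdot (E B u) (E C u') = 0 by exact: (pvm_orth hilbertH pvm).
  have o2 u u' : rdot (E C u) (E B u') = 0 by rewrite rdotC.
  by rewrite o1 o2; lra.
- move=> a b w a0 ab bM Iw; have := near_scalar_iter m a0 ab bM Iw => h1.
  have h2 : `|rdot (iter m A w) w - a ^+ m * nrm w ^+ 2| <=
      pow_lip_cst (M + 1) m * (b - a) * nrm w ^+ 2.
    rewrite -(nrm2 hilbertH) -rdotZl -rdotBl.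
    apply: (le_trans (cauchy_schwarz hilbertH _ _)).
    by rewrite (nrm2 hilbertH) expr2 mulrA ler_wpM2r ?nrm_ge0.
  have mI : measurable (I a b) by exact: measurable_itv.
  have w0 : mu w (~` I a b) = 0%E by apply/(mu_fix hilbertH pvm).
  have [mt _] := et w.
  have /andP := @Rint_bounds _ _ (fun t => t ^+ m) _ (a ^+ m) (b ^+ m) (fin w) mt mI w0
    (fun t => ltac:(rewrite /= in_itv/= => /andP[at_ tb]; apply/andP; split;
       apply: lerXn2r; rewrite ?nnegrE; lra)).
  rewrite (fine_mu_T hilbertH pvm) => -[h3 h4].
  have h5 := pow_diff_le m a0 (ltW ab) bM.
  have h6 : (b ^+ m - a ^+ m) * nrm w ^+ 2 <= pow_lip_cst (M + 1) m * (b - a) * nrm w ^+ 2.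
    by rewrite ler_wpM2r// sqr_ge0.
  rewrite /Q; move: h2; rewrite !ler_norml => /andP[h7 h8]; apply/andP; split; lra.
Qed.

Lemma poly_op_form p v : rdot (poly_op A p v) v = \int[mu v]_t p.[t].
Proof.
have -> : (fun t => p.[t]) = (fun t => \sum_(i < size p) p`_i * t ^+ i).
  by apply/funext => t; rewrite horner_coef.
have et w i : ebd (mu w) (fun t => t ^+ i) by apply: ebd_exp; exact: ebd_id.
rewrite (@Rint_sum _ _ (fun i t => p`_i * t ^+ i)) //; last by move=> i; apply: ebdZ.
rewrite /poly_op rdot_suml; apply: eq_bigr => i _.
by rewrite rdotZl moment_form RintZ.
Qed.

(** By symmetry (A^i v | A^j v) = (A^(i + j) v | v), so the squared norm is again a
    combination of moments. *)
Lemma poly_op_nrm p v : nrm (poly_op A p v) ^+ 2 = \int[mu v]_t p.[t] ^+ 2.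
Proof.
have -> : (fun t => p.[t] ^+ 2) =
    (fun t => \sum_(i < size p) \sum_(j < size p) (p`_i * p`_j) * t ^+ (i + j)).
  apply/funext => t; rewrite horner_coef expr2 mulr_suml; apply: eq_bigr => i _.
  by rewrite mulr_sumr; apply: eq_bigr => j _; rewrite exprD; ring.
have et w i : ebd (mu w) (fun t => t ^+ i) by apply: ebd_exp; exact: ebd_id.
rewrite (@Rint_sum _ _ (fun i t => \sum_(j < size p) (p`_i * p`_j) * t ^+ (i + j))) //; last first.
  by move=> i; apply: (@ebd_sum _ _ (fun j t => (p`_i * p`_j) * t ^+ (i + j))) => j; apply: ebdZ.
rewrite -(nrm2 hilbertH) /poly_op rdot_suml; apply: eq_bigr => i _.
rewrite (@Rint_sum _ _ (fun j t => (p`_i * p`_j) * t ^+ (i + j))) //; last by move=> j; apply: ebdZ.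
rewrite rdot_sumr; apply: eq_bigr => j _.
rewrite rdotZl rdotZr RintZ// -moment_form addnC iterD mulrA.
by rewrite [in RHS](iter_rsym sA).
Qed.

Lemma calc_form f x v : is_calc A M f x -> ebd (mu v) f ->
  rdot (x v) v = \int[mu v]_t f t.
Proof.
move=> fx ef; apply/eqP; rewrite -subr_eq0 -normr_eq0 eq_le normr_ge0 andbT.
apply: (@le0_small _ _ (2 * nrm v ^+ 2)) => e e0.
have [p [pf px]] := fx e e0.
have h1 : `|rdot (poly_op A p v - x v) v| <= e * nrm v ^+ 2.
  apply: (le_trans (cauchy_schwarz hilbertH _ _)).
  by rewrite expr2 mulrA ler_wpM2r ?nrm_ge0.
have := Rint_dist (fin v) (ebd_horner p v) ef mM (supp v)
  (fun t => ltac:(rewrite /= in_itv/=; exact: pf)).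
rewrite (fine_mu_T hilbertH pvm) -poly_op_form.
move: h1; rewrite rdotBl !ler_norml => /andP[h1 h2] /andP[h3 h4].
by apply/andP; split; lra.
Qed.

Lemma poly_op_dist_le p q v (e : R) : 0 <= e -> (forall t : R, 0 <= t <= M -> `|p.[t] - q.[t]| <= e) ->
  nrm (poly_op A p v - poly_op A q v) <= e * nrm v.
Proof.
move=> e0 pq; rewrite -poly_opB; apply: sqr_ge0_le; first by rewrite mulr_ge0 ?nrm_ge0.
rewrite poly_op_nrm exprMn -(fine_mu_T hilbertH pvm v).
have [ms _] := ebd_exp 2 (ebd_horner (p - q) v).
have /andP[] := @Rint_bounds _ _ (fun t => (p - q).[t] ^+ 2) _ 0 (e ^+ 2) (fin v) ms mM (supp v)
    (fun t => ltac:(rewrite /= in_itv/= => tM; rewrite sqr_ge0/= -real_normK ?num_real//;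
       rewrite lerXn2r ?nnegrE// hornerD hornerN; exact: pq)).
by [].
Qed.

(** Both sides are continuous in f for the uniform norm, and equal for
    polynomials. *)
Lemma calc_nrm f x v : is_calc A M f x -> ebd (mu v) f ->
  nrm (x v) ^+ 2 = \int[mu v]_t f t ^+ 2.
Proof.
move=> fx ef; apply/eqP; rewrite -subr_eq0 -normr_eq0 eq_le normr_ge0 andbT.
have [mf [B [K0 [mB B0 fK0]]]] := ef.
set K := `|K0|; have {fK0} fK t : B t -> `|f t| <= K.
  by move=> Bt; rewrite (le_trans (fK0 t Bt)) ?ler_norm.
have Kge0 : 0 <= K by exact: normr_ge0.
set n := nrm v; set a := nrm (x v).
have n0 : 0 <= n by exact: nrm_ge0.
have a0 : 0 <= a by exact: nrm_ge0.
apply: (@le0_small _ _ (2 * n * a + n ^+ 2 + (2 * K + 1) * n ^+ 2)) => e' e'0.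
set e := Num.min e' 1.
have e0 : 0 < e by rewrite lt_min e'0 ltr01.
have e1 : e <= 1 by rewrite ge_min lexx orbT.
have ee : e <= e' by rewrite ge_min lexx.
have [p [pf px]] := fx e e0.
set b := nrm (poly_op A p v).
have b0 : 0 <= b by exact: nrm_ge0.
have h1 : a <= b + e * n.
  have := nrm_dist_le (x v) (poly_op A p v) 0; rewrite !subr0 -/a -/b addrC.
  by move=> /le_trans; apply; rewrite lerD2l -nrmN opprB px.
have h2 : b <= a + e * n.
  have := nrm_dist_le (poly_op A p v) (x v) 0; rewrite !subr0 -/a -/b addrC.
  by move=> /le_trans; apply; rewrite lerD2l px.
have h3 : `|a ^+ 2 - b ^+ 2| <= e * (2 * n * a + n ^+ 2).
  have en : 0 <= e * n by rewrite mulr_ge0// ltW.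
  have enn : e * n * (e * n) <= e * n ^+ 2.
    by rewrite expr2 [leRHS]mulrA ler_wpM2l// ler_piMl.
  by rewrite ler_norml; apply/andP; split; nra.
have mBM : measurable (B `&` `[0, M]%classic : set T) by exact: measurableI.
have BM0 : mu v (~` (B `&` `[0, M]%classic)) = 0%E.
  rewrite setCI measureU0//; exact: measurableC.
have h4 : `|\int[mu v]_t p.[t] ^+ 2 - \int[mu v]_t f t ^+ 2| <= e * (2 * K + 1) * n ^+ 2.
  rewrite -(fine_mu_T hilbertH pvm v).
  apply: (Rint_dist (fin v) (ebd_exp 2 (ebd_horner p v)) (ebd_exp 2 ef) mBM BM0).
  move=> t [/fK ft]; rewrite /= in_itv/= => /pf pt.
  rewrite subr_sqr normrM ler_pM//.
  rewrite (_ : p.[t] + f t = (p.[t] - f t) + 2 * f t); last by lra.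
  rewrite (le_trans (ler_normD _ _))// normrM (ger0_norm (ler0n _ 2)).
  by rewrite addrC lerD// ?ler_pM2l// (le_trans pt).
rewrite (_ : a ^+ 2 - _ = (a ^+ 2 - b ^+ 2) + (\int[mu v]_t p.[t] ^+ 2 - \int[mu v]_t f t ^+ 2)); last first.
  by rewrite -poly_op_nrm addrA subrK.
apply: (le_trans (ler_normD _ _)); apply: (le_trans (lerD h3 h4)).
rewrite [leLHS](_ : _ = e * (2 * n * a + n ^+ 2 + (2 * K + 1) * n ^+ 2)); last by ring.
apply: ler_wpM2r => //.
rewrite addr_ge0// ?mulr_ge0// ?addr_ge0// ?mulr_ge0// ?sqr_ge0//.
Qed.


Definition poly_approx (f : R -> R) := forall e : R, 0 < e -> exists p : {poly R},
  forall t : R, 0 <= t <= M -> `|p.[t] - f t| <= e.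

(** By [poly_op_dist_le], polynomials that converge uniformly on [0, M] give
    operators converging in norm. *)
Lemma calc_exists f : poly_approx f -> exists x, is_calc A M f x.
Proof.
move=> af.
have /choice[p pf] : forall n, exists p : {poly R}, forall t, 0 <= t <= M ->
    `|p.[t] - f t| <= n.+1%:R^-1 by move=> n; apply: af; rewrite invr_gt0.
have dp n m v : nrm (poly_op A (p n) v - poly_op A (p m) v) <= nrm v * (n.+1%:R^-1 + m.+1%:R^-1).
  rewrite mulrC; apply: poly_op_dist_le; first by rewrite addr_ge0// invr_ge0.
  move=> t tM; have := pf n t tM; have := pf m t tM.
  by move: (_^-1) (_^-1) => ? ?; rewrite !ler_norml => /andP[? ?] /andP[? ?]; apply/andP; split; lra.
have /choice[x xp] : forall v, exists l, forall n,
    nrm (poly_op A (p n) v - l) <= nrm v * n.+1%:R^-1.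
  by move=> v; apply: complete_seq; [exact: nrm_ge0|move=> n m; exact: dp].
exists x => e e0.
have [n ne] : exists n, (n.+1%:R : R)^-1 <= e.
  exists (Num.truncn e^-1); rewrite -[leRHS]invrK lef_pV2 ?posrE ?invr_gt0//.
  exact: ltW (truncnS_gt _).
exists (p n); split=> [t tM|v]; first exact: le_trans (pf n t tM) ne.
by apply: (le_trans (xp v n)); rewrite mulrC ler_wpM2r ?nrm_ge0.
Qed.
End SpectralCalculus.

(** * Bernstein approximation of Lipschitz functions *)

Section Bernstein.
Variable R : realType.
Implicit Types (x : R) (n : nat).

Definition bern n k : {poly R} := ('C(n, k)%:R)%:P * 'X ^+ k * (1 - 'X) ^+ (n - k).

Lemma bernE n k x : (bern n k).[x] = 'C(n, k)%:R * x ^+ k * (1 - x) ^+ (n - k).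
Proof. by rewrite /bern !hornerM hornerC !horner_exp hornerX hornerD hornerN hornerX hornerC. Qed.

Lemma bern_ge0 n k x : 0 <= x <= 1 -> 0 <= (bern n k).[x].
Proof.
move=> /andP[x0 x1]; rewrite bernE !mulr_ge0// exprn_ge0// subr_ge0//.
Qed.

Lemma sum_bern n x : \sum_(k < n.+1) (bern n k).[x] = 1.
Proof.
transitivity ((x + (1 - x)) ^+ n); last by rewrite addrC subrK expr1n.
rewrite addrC exprDn; apply: eq_bigr => k _.
by rewrite bernE -mulr_natl; ring.
Qed.

Lemma bern_diag n k x : k.+1%:R * (bern n.+1 k.+1).[x] = n.+1%:R * x * (bern n k).[x].
Proof.
rewrite !bernE subSS exprS !mulrA -natrM -mul_bin_diag natrM; ring.
Qed.

Lemma sum_bern1 n x : \sum_(k < n.+1) k%:R * (bern n k).[x] = n%:R * x.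
Proof.
case: n => [|n]; first by rewrite big_ord1 !mul0r.
rewrite big_ord_recl mul0r add0r.
transitivity (\sum_(k < n.+1) n.+1%:R * x * (bern n k).[x]).
  by apply: eq_bigr => k _; rewrite -bern_diag.
by rewrite -mulr_sumr sum_bern mulr1.
Qed.

Lemma sum_bern2 n x :
  \sum_(k < n.+1) k%:R ^+ 2 * (bern n k).[x] = n%:R * x * (1 - x) + (n%:R * x) ^+ 2.
Proof.
case: n => [|n]; first by rewrite big_ord1 !mul0r expr0n/= !mul0r addr0.
rewrite big_ord_recl/= expr0n/= mul0r add0r.
transitivity (\sum_(k < n.+1) n.+1%:R * x * (k%:R * (bern n k).[x] + (bern n k).[x])).
  apply: eq_bigr => k _; rewrite expr2 -mulrA bern_diag /bump/= -natr1; ring.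
by rewrite -mulr_sumr big_split/= sum_bern sum_bern1 -natr1; ring.
Qed.

(** The variance of the binomial law of parameters n and x. *)
Lemma bern_var n x : \sum_(k < n.+1) (k%:R - n%:R * x) ^+ 2 * (bern n k).[x] = n%:R * x * (1 - x).
Proof.
transitivity (\sum_(k < n.+1) (k%:R ^+ 2 * (bern n k).[x]
   + (- 2 * (n%:R * x)) * (k%:R * (bern n k).[x]) + (n%:R * x) ^+ 2 * (bern n k).[x])).
  by apply: eq_bigr => k _; ring.
by rewrite !big_split/= -!mulr_sumr sum_bern2 sum_bern1 sum_bern; ring.
Qed.

Definition lip (M : R) (f : R -> R) := exists L : R, forall x y : R, 0 <= x <= M -> 0 <= y <= M ->
  `|f x - f y| <= L * `|x - y|.

(** The Bernstein polynomial at x is the mean of f(k/n) under the binomial law, and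
    |k/n - x| has mean square x (1 - x) / n. The inequality
    2 d z <= d^2 + z^2 bounds the mean of |k/n - x| through this mean square. *)
Lemma bernstein01 f : lip 1 f -> forall e : R, 0 < e -> exists p : {poly R},
  forall t : R, 0 <= t <= 1 -> `|p.[t] - f t| <= e.
Proof.
move=> [L0 fL0] e e0; pose L : R := `|L0| + 1.
have L1 : 0 < L by rewrite ltr_wpDl.
have fL (x y : R) : 0 <= x <= 1 -> 0 <= y <= 1 -> `|f x - f y| <= L * `|x - y|.
  move=> hx hy; apply: (le_trans (fL0 _ _ hx hy)); rewrite ler_wpM2r//.
  by rewrite (le_trans (ler_norm L0))// lerDl.
pose d : R := e / L; have d0 : 0 < d by rewrite divr_gt0.
have Lde : L * d = e by rewrite /d mulrC divfK// gt_eqF.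
clearbody d L.
(* With n >= 1/d^2 and L d = e, both halves of the AM-GM bound are at most e/2. *)
pose n := (Num.truncn (d ^- 2)).+1.
have nR : d ^- 2 <= n%:R by exact: ltW (truncnS_gt _).
have n0 : 0 < n%:R :> R by rewrite ltr0n.
exists (\sum_(k < n.+1) (f (k%:R / n%:R))%:P * bern n k) => x x01.
rewrite horner_sum.
have -> : \sum_(k < n.+1) ((f (k%:R / n%:R))%:P * bern n k).[x] - f x =
   \sum_(k < n.+1) (f (k%:R / n%:R) - f x) * (bern n k).[x].
  have fE : f x = \sum_(k < n.+1) f x * (bern n k).[x].
    by rewrite -mulr_sumr sum_bern mulr1.
  rewrite {1}fE -sumrB; apply: eq_bigr => k _.
  by rewrite hornerM hornerC mulrBl.
apply: (le_trans (ler_norm_sum _ _ _)).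
apply: (@le_trans _ _ (\sum_(k < n.+1) (L * d / 2 * (bern n k).[x] +
   L / (2 * d) / n%:R ^+ 2 * ((k%:R - n%:R * x) ^+ 2 * (bern n k).[x])))).
  apply: ler_sum => k _; rewrite normrM (ger0_norm (bern_ge0 _ _ x01)).
  rewrite [leRHS](_ : _ = (L * d / 2 + L / (2 * d) / n%:R ^+ 2 *
    ((k : nat)%:R - n%:R * x) ^+ 2) * (bern n k).[x]); last by ring.
  rewrite ler_wpM2r ?bern_ge0//.
  have k01 : 0 <= ((k : nat)%:R / n%:R : R) <= 1.
    by rewrite divr_ge0//= ler_pdivrMr// mul1r ler_nat -ltnS.
  apply: (le_trans (fL _ _ k01 x01)).
  set z := `|_ - x|.
  have -> : L / (2 * d) / n%:R ^+ 2 * ((k : nat)%:R - n%:R * x) ^+ 2 = L / (2 * d) * z ^+ 2.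
    rewrite /z real_normK ?num_real//; field.
    by rewrite !gt_eqF.
  have -> : L * d / 2 + L / (2 * d) * z ^+ 2 = L * ((d ^+ 2 + z ^+ 2) / (2 * d)).
    by field; rewrite gt_eqF.
  rewrite ler_pM2l// ler_pdivlMr ?mulr_gt0//.
  by have := sqr_ge0 (z - d); nra.
rewrite big_split/= -!mulr_sumr sum_bern bern_var mulr1.
have x1 : x * (1 - x) <= 1 by move: x01 => /andP[? ?]; nra.
have h : L / (2 * d) / n%:R ^+ 2 * (n%:R * x * (1 - x)) <= L * d / 2.
  have -> : L / (2 * d) / n%:R ^+ 2 * (n%:R * x * (1 - x)) = (L * d / 2) * ((d ^- 2 / n%:R) * (x * (1 - x))).
    by field; rewrite !gt_eqF.
  rewrite ler_piMr//; first by rewrite divr_ge0// mulr_ge0// ltW.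
  have h1 : d ^- 2 / n%:R <= 1 by rewrite ler_pdivrMr// mul1r.
  have h2 : 0 <= d ^- 2 / n%:R by rewrite divr_ge0// invr_ge0 sqr_ge0.
  have h3 : 0 <= x * (1 - x) by move: x01 => /andP[? ?]; rewrite mulr_ge0// subr_ge0.
  by rewrite -[leRHS]mulr1 ler_pM.
by move: h; rewrite Lde; lra.
Qed.

Lemma bernstein (M : R) f : 0 < M -> lip M f -> poly_approx M f.
Proof.
move=> M0 [L fL] e e0.
have : lip 1 (fun t => f (M * t)).
  exists (L * M) => x y /andP[x0 x1] /andP[y0 y1].
  have := fL (M * x) (M * y); rewrite -mulrBr normrM (ger0_norm (ltW M0)) mulrA; apply.
    by apply/andP; split; [rewrite mulr_ge0// ltW|rewrite ler_piMr// ltW].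
  by apply/andP; split; [rewrite mulr_ge0// ltW|rewrite ler_piMr// ltW].
move=> /bernstein01/(_ e e0)[p pf].
exists (p \Po (M^-1 *: 'X)) => t /andP[t0 tM].
rewrite horner_comp hornerZ hornerX.
have := pf (M^-1 * t); rewrite mulrA mulfV ?gt_eqF// mul1r; apply.
by apply/andP; split; [rewrite mulr_ge0// invr_ge0 ltW|rewrite ler_pdivrMl// mulr1].
Qed.
End Bernstein.

(** * Recovering G from a spectral measure of its inverse *)

Lemma below_exhaust (R : realType) (a t : R) : t < a ->
  exists n : nat, - n%:R <= t <= a - n.+1%:R^-1.
Proof.
move=> ta; have d0 : 0 < a - t by rewrite subr_gt0.
pose n := maxn (Num.truncn (a - t)^-1) (Num.truncn `|t|).+1; exists n.
have h1 : `|t| <= n%:R.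
  by rewrite (le_trans (ltW (truncnS_gt _)))// ler_nat leq_maxr.
have h2 : (n.+1%:R : R)^-1 <= a - t.
  rewrite -[leRHS]invrK lef_pV2 ?posrE ?invr_gt0//.
  by rewrite (le_trans (ltW (truncnS_gt _)))// ler_nat ltnS leq_maxl.
move: h1 h2; rewrite ler_norml; move: (n.+1%:R^-1) => r /andP[h1 h2] h3.
by apply/andP; split; lra.
Qed.

Lemma above_exhaust (R : realType) (a t : R) : a < t ->
  exists n : nat, a + n.+1%:R^-1 <= t <= n%:R.
Proof.
rewrite -ltrN2 => /below_exhaust[n /andP[h1 h2]]; exists n; move: h1 h2.
by move: (n.+1%:R^-1) (n%:R) => r s h1 h2; apply/andP; split; lra.
Qed.

(** The formula t (t^2)^(-1) reduces the claim to a power function on nonnegative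
    numbers, and gives the value 0 at 0. *)
Lemma measurable_funV (R : realType) :
  measurable_fun setT ((fun t => t^-1) : measurableTypeR R -> measurableTypeR R).
Proof.
rewrite (_ : (fun t => t^-1) = (fun t : R => t * ((t ^+ 2) `^ (-1)))); last first.
  apply/funext => t; rewrite powR_inv1 ?sqr_ge0//.
  have [->|t0] := eqVneq t 0; first by rewrite invr0 mul0r.
  by field.
apply: measurable_funM; first exact: measurable_id.
apply: (@measurableT_comp _ _ _ _ _ _ (fun x : R => x `^ (-1))) => //.
Qed.

Section CutInverse.
Variable R : realType.
Implicit Types c t : R.

(** A Lipschitz function that agrees with 1/t for t >= c. *)
Definition cutinv c t := (Num.max t c)^-1.

Lemma cutinv_gt0 c t : 0 < c -> 0 < cutinv c t.
Proof. by move=> c0; rewrite invr_gt0 lt_max c0 orbT. Qed.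

Lemma cutinv_bound c t : 0 < c -> 0 <= cutinv c t <= c^-1.
Proof.
move=> c0; rewrite ltW ?cutinv_gt0// lef_pV2 ?posrE ?lt_max ?c0 ?orbT//.
by rewrite le_max lexx orbT.
Qed.

Lemma cutinvE c t : c <= t -> cutinv c t = t^-1.
Proof. by move=> ct; rewrite /cutinv max_l. Qed.

Lemma cutinv_lip M c : 0 < c -> lip M (cutinv c).
Proof.
move=> c0; exists (c^-1 ^+ 2) => x y _ _.
have max_gt0 t : 0 < Num.max t c by rewrite lt_max c0 orbT.
have -> : cutinv c x - cutinv c y =
   cutinv c x * cutinv c y * (Num.max y c - Num.max x c).
  by rewrite /cutinv; field; rewrite !gt_eqF.
have /andP[fx0 fx] := cutinv_bound x c0; have /andP[fy0 fy] := cutinv_bound y c0.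
rewrite normrM; apply: ler_pM => //.
  by rewrite ger0_norm ?mulr_ge0// expr2 ler_pM.
rewrite distrC; have [xm|xm] := leP x c; have [ym|ym] := leP y c; rewrite ?subrr ?normr0//.
  by rewrite !ltr0_norm ?subr_lt0//; lra.
by rewrite !gtr0_norm ?subr_gt0//; lra.
Qed.

Lemma measurable_cutinv c :
  measurable_fun setT (cutinv c : measurableTypeR R -> measurableTypeR R).
Proof.
apply: (measurableT_comp (@measurable_funV R)).
by apply: measurable_maxr => //; exact: measurable_id.
Qed.
End CutInverse.

Section Inversion.
Variables (R : realType) (H : completeNormedModType R[i]).
Variable dot : {dot H for @Num.conj R[i]}.
Hypothesis hilbertH : hilbert_norm dot.
Local Notation rdot := (re_dot dot).
Local Notation T := (measurableTypeR R).
Variables (G : H -> H) (M : R).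
Hypotheses (lG : linear G) (M0 : 0 < M) (bG : forall v, nrm (G v) <= M * nrm v).
Hypotheses (sG : rsym dot G) (pG : forall v, 0 <= rdot (G v) v) (iG : injective G).

Lemma rdot_Re (x y : H) (r : R) : dot x y = r%:C -> rdot x y = r.
Proof. by rewrite /re_dot => ->. Qed.

Lemma nrm2_ge0_eq0 (c : R) (u : H) : 0 < c -> c * nrm u ^+ 2 <= 0 -> u = 0.
Proof.
move=> c0; rewrite pmulr_rle0// => h; apply/nrm_eq0/eqP; rewrite -sqrf_eq0.
by rewrite eq_le h sqr_ge0.
Qed.

(** Positivity of the form at M v - G v, as in [sym_form_bound], but keeping
    (G v | v) instead of bounding it by M |v|^2. *)
Lemma pos_op_ineq v : nrm (G v) ^+ 2 <= M * rdot (G v) v.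
Proof.
have := pG (M%:C *: v - G v).
rewrite (linB lG) (linZ lG) rdotBl !rdotBr !rdotZl !rdotZr (sG (G v) v) (nrm2 hilbertH).
have := cauchy_schwarz hilbertH (G (G v)) (G v).
have h2 := bG (G v).
have h3 := nrm_ge0 (G v).
move=> /(le_trans (ler_norm _)) h1 h4.
have h5 : nrm (G (G v)) * nrm (G v) <= M * nrm (G v) ^+ 2.
  by rewrite expr2 mulrA ler_wpM2r.
have : 0 <= M * (M * rdot (G v) v - nrm (G v) ^+ 2) by nra.
by rewrite pmulr_rge0// subr_ge0.
Qed.

Section Esetup.
Variables (E : set R -> H -> H) (mu : H -> {measure set T -> \bar R}).
Hypothesis pvm : projection_valued_measure dot E mu.
Let fin v : (mu v setT < +oo)%E := mu_fin hilbertH pvm v.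

Lemma pvm_contr B v : measurable B -> nrm (E B v) <= nrm v.
Proof.
move=> mB; apply: sqr_ge0_le; first exact: nrm_ge0.
rewrite -lee_fin -(muE hilbertH pvm)// -(mu_T hilbertH pvm v).
by rewrite le_measure// inE.
Qed.

Lemma itv_ebd (a b : R) v (f : R -> R) K : measurable_fun setT (f : T -> R) ->
  (forall t, a <= t <= b -> `|f t| <= K) -> E `[a, b]%classic v = v -> ebd (mu v) f.
Proof.
move=> mf fK Ev; have mI : measurable (`[a, b]%classic : set T) by exact: measurable_itv.
apply: (ebdI mf mI (K := K)); first exact/(mu_fix hilbertH pvm).
by move=> t /=; rewrite ?in_itv/=; exact: fK.
Qed.

Lemma itv_ebd_id (a b : R) v : E `[a, b]%classic v = v -> ebd (mu v) id.
Proof.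
move=> Ev; apply: (itv_ebd (K := `|a| + `|b|) _ _ Ev); first exact: measurable_id.
move=> t /andP[at_ tb]; rewrite ler_norml.
have := ler_norm b; have := ler_norm (- a); rewrite normrN.
by have := normr_ge0 a; have := normr_ge0 b => ? ? ? ?; apply/andP; split; lra.
Qed.

Lemma itv_bounds (a b : R) v : E `[a, b]%classic v = v ->
  a * nrm v ^+ 2 <= \int[mu v]_t t <= b * nrm v ^+ 2.
Proof.
move=> Ev; have mI : measurable (`[a, b]%classic : set T) by exact: measurable_itv.
rewrite -(fine_mu_T hilbertH pvm v).
apply: (@Rint_bounds _ _ id `[a, b]%classic) => //; exact/(mu_fix hilbertH pvm).
Qed.

Lemma ebd_Int_fin v (f : R -> R) : ebd (mu v) f -> (\int[mu v]_t (f t)%:E < +oo)%E.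
Proof. by move=> ef; apply: integrable_lty => //; exact: (ebd_integrable (fin v) ef). Qed.

Lemma ebd_IntE v (f : R -> R) : ebd (mu v) f ->
  (\int[mu v]_t (f t)%:E)%E = (\int[mu v]_t f t)%:E.
Proof.
move=> ef; rewrite /Rintegral fineK//; apply: integrable_fin_num => //.
exact: (ebd_integrable (fin v) ef).
Qed.

(** The half-line ]-oo, a[ is a countable union of compact intervals. Each of them is
    null when its spectral subspace is trivial. *)
Lemma null_below (a : R) : (forall b c u, c < a -> E `[b, c]%classic u = u -> u = 0) ->
  forall v, mu v [set t | t < a] = 0%E.
Proof.
move=> h v; pose F n : set T := `[- n%:R, a - n.+1%:R^-1]%classic.
have mF n : measurable (F n) by exact: measurable_itv.
have F0 n : mu v (F n) = 0%E.
  apply: (mu0_fix hilbertH pvm (mF n)) => u; apply: h.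
  by rewrite ltrBlDr ltrDl invr_gt0.
apply: (@subset_measure0 _ _ _ (mu v) _ (\bigcup_n F n)).
- rewrite (_ : [set t | _] = `]-oo, a[%classic); first exact: measurable_itv.
  by apply/seteqP; split=> t /=; rewrite ?in_itv.
- exact: bigcupT_measurable.
- move=> t /= /below_exhaust[n tn]; exists n => //=.
- exact: (mu_bigcup0 mF).
Qed.

Lemma null_above (a : R) : (forall b c u, a < b -> E `[b, c]%classic u = u -> u = 0) ->
  forall v, mu v [set t | a < t] = 0%E.
Proof.
move=> h v; pose F n : set T := `[a + n.+1%:R^-1, n%:R]%classic.
have mF n : measurable (F n) by exact: measurable_itv.
have F0 n : mu v (F n) = 0%E.
  apply: (mu0_fix hilbertH pvm (mF n)) => u; apply: h.
  by rewrite ltrDl invr_gt0.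
apply: (@subset_measure0 _ _ _ (mu v) _ (\bigcup_n F n)).
- rewrite (_ : [set t | _] = `]a, +oo[%classic); first exact: measurable_itv.
  by apply/seteqP; split=> t /=; rewrite ?in_itv/= andbT.
- exact: bigcupT_measurable.
- by move=> t /= /above_exhaust[n tn]; exists n => //=; rewrite ?in_itv.
- exact: (mu_bigcup0 mF).
Qed.

(** By continuity of the measure mu v along the increasing sets I n. *)
Lemma pvm_exhaust (I : nat -> set T) v (e : R) : (forall n, measurable (I n)) ->
  (forall n m, (n <= m)%N -> I n `<=` I m) -> mu v (~` \bigcup_n I n) = 0%E ->
  0 < e -> exists n, nrm (E (~` I n) v) <= e.
Proof.
move=> mI subI I0 e0.
have mU : measurable (\bigcup_n I n) by exact: bigcupT_measurable.
have cv : (mu v (I n) @[n --> \oo] --> mu v (\bigcup_n I n))%E.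
  by apply: nondecreasing_cvg_mu => // n m nm; exact/subsetPset/subI.
move: cv; rewrite -(conull_setT mU I0) (mu_T hilbertH pvm).
rewrite (_ : (fun n => mu v (I n)) = (fun n => (nrm (E (I n) v) ^+ 2)%:E)); last first.
  by apply/funext => n; rewrite (muE hilbertH pvm).
move=> /fine_cvgP[_ /cvgrPdist_le/(_ (e ^+ 2))].
rewrite exprn_gt0// => /(_ isT) cv'.
near \oo => n; exists n; apply: sqr_ge0_le; first exact: ltW.
have mI' := measurableC (mI n).
have orth : rdot (E (I n) v) (E (~` I n) v) = 0.
  by apply: (pvm_orth hilbertH pvm) => //; exact: setICr.
have := nrm2D hilbertH orth; rewrite (pvm_setC hilbertH pvm)// => vv.
have : `|nrm v ^+ 2 - nrm (E (I n) v) ^+ 2| <= e ^+ 2 by near: n.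
by rewrite vv addrAC subrr add0r ger0_norm ?sqr_ge0.
Unshelve. all: by end_near. Qed.

Section graph.
Hypothesis spec : spectral_integral dot mu id (graph G).

Lemma graph_form v : rdot (G v) v = \int[mu v]_t t.
Proof. by apply: rdot_Re; apply: (spec.2). Qed.

(** If the spectral subspace of [b, c] with c < 0, or with b > M, contained a vector
    u, then (G u | u) would be negative, or larger than M |u|^2. *)
Lemma graph_supp v : mu v (~` `[0, M]%classic) = 0%E.
Proof.
rewrite (_ : ~` _ = [set t | t < 0] `|` [set t | M < t] :> set T); last first.
  apply/seteqP; split=> t /=; rewrite ?in_itv/=; last by case; lra.
  by move=> /negP; rewrite negb_and -!ltNge => /orP.
have m1 : measurable ([set t | t < 0] : set T).
  rewrite (_ : [set t | _] = `]-oo, 0%R[%classic); first exact: measurable_itv.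
  by apply/seteqP; split=> t /=; rewrite ?in_itv.
have m2 : measurable ([set t | M < t] : set T).
  rewrite (_ : [set t | _] = `]M, +oo[%classic); first exact: measurable_itv.
  by apply/seteqP; split=> t /=; rewrite ?in_itv/= andbT.
rewrite measureU0//.
- apply: null_below => b c u c0 Eu; apply: (@nrm2_ge0_eq0 (- c)); first by rewrite oppr_gt0.
  have /andP[_ h] := itv_bounds Eu; have := pG u; rewrite graph_form; lra.
- apply: null_above => b c u c0 Eu; apply: (@nrm2_ge0_eq0 (b - M)); first by rewrite subr_gt0.
  have /andP[h _] := itv_bounds Eu.
  have := le_trans (ler_norm _) (cauchy_schwarz hilbertH (G u) u).
  have : nrm (G u) * nrm u <= M * nrm u ^+ 2 by rewrite expr2 mulrA ler_wpM2r// nrm_ge0.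
  rewrite graph_form; lra.
Qed.
End graph.

Section inverse.
Hypothesis spec : spectral_integral dot mu id (inverse_graph (graph G)).

Lemma inv_form v : rdot v (G v) = \int[mu (G v)]_t t.
Proof. by apply: rdot_Re; apply: (spec.2). Qed.

(** The domain of the inverse of G is the range of G, and a vector with bounded
    spectral support has finite moments. *)
Lemma inv_dom a b v : E `[a, b]%classic v = v -> exists u, v = G u.
Proof.
move=> Ev; apply/(spec.1 v).
by apply: ebd_Int_fin; apply: ebd_exp; exact: itv_ebd_id Ev.
Qed.

(** If u = G w has spectral support below 1/M, then (w | G w) = (G^(-1) u | u) is
    less than |G w|^2 / M, against [pos_op_ineq]. *)
Lemma inv_supp v : mu v [set t | t < M^-1] = 0%E.
Proof.
apply: null_below => b c u cM Eu.
have [w uw] := inv_dom Eu.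
apply: (@nrm2_ge0_eq0 (1 - M * c)).
  by rewrite subr_gt0 mulrC -ltr_pdivlMr// mul1r.
have /andP[_] := itv_bounds Eu; rewrite {1}uw -inv_form => h.
have := pos_op_ineq w; rewrite -uw rdotC uw -(ler_pM2l M0) in h *.
rewrite mulrBl mul1r -uw => h1; rewrite uw in h1 *.
by move: h h1; rewrite mulrA; lra.
Qed.

(** The operator S is G^(-1) cut down to the spectral subspace of I = [1/M, b]. It is
    bounded, and the image of E under the truncated identity is a spectral measure
    of it. So the calculus of bounded operators applies to S: it inverts
    S back into G on the range of E(I), and represents G there as the integral of
    1/t. *)
Section truncation.
Variable b : R.
Let I : set T := `[M^-1, b]%classic.
Let mI : measurable I. Proof. exact: measurable_itv. Qed.

Lemma trunc_exists : exists S : H -> H, forall v, G (S v) = E I v.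
Proof.
suff /choice[S GS] : forall v, exists u, G u = E I v by exists S.
move=> v; have [|u ->] := @inv_dom M^-1 b (E I v); last by exists u.
exact: (pvm_idem pvm).
Qed.

Variables (S : H -> H).
Hypothesis GS : forall v, G (S v) = E I v.

Lemma trunc_lin : linear S.
Proof. by move=> c u v; apply: iG; rewrite lG !GS (pvm_lin pvm). Qed.

(** Let w be the component of y = S v in a bounded part of the complement of I. Both
    E(I) v = G y and w = G z are in the range of G, and the additivity of the form
    of G^(-1) on their sum leaves (y | w) + (z | G y) = 0, that is
    2 (y | w) = 0. *)
Lemma trunc_supp v : E I (S v) = S v.
Proof.
apply/(mu_fix hilbertH pvm _ mI).
pose J n : set T := ~` I `&` `[- n%:R, n%:R]%classic.
have mJ n : measurable (J n) by apply: measurableI; [exact: measurableC|exact: measurable_itv].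
apply: (@subset_measure0 _ _ _ (mu (S v)) _ (\bigcup_n J n)).
- exact: measurableC.
- exact: bigcupT_measurable.
- move=> t /= nt; exists (Num.truncn `|t|).+1 => //; split=> //=.
  by rewrite ?in_itv/= -ler_norml; exact: ltW (truncnS_gt _).
apply: (mu_bigcup0 mJ) => n.
rewrite (muE hilbertH pvm)//; congr EFin.
set y := S v; set w := E (J n) y.
have Jw : E (J n) w = w by exact: (pvm_idem pvm).
have Jw' : E `[- n%:R, n%:R]%classic w = w.
  by apply: (pvm_fixS pvm (mJ n) _ _ Jw) => //; exact: subIsetr.
have [z wz] := inv_dom Jw'.
have IJ : I `&` J n = set0 by rewrite setIA setICr set0I.
have Iv : E I (E I v) = E I v by exact: (pvm_idem pvm).
have e1 : ebd (mu (E I v)) id by exact: itv_ebd_id Iv.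
have e2 : ebd (mu w) id by exact: itv_ebd_id Jw'.
have := Rint_add hilbertH pvm mI (mJ n) IJ Iv Jw e1 e2.
rewrite -GS -/y wz -(linD lG) -!inv_form (linD lG) rdotDl !rdotDr -(sG z y) -wz => yz.
have {yz} yw : rdot y w = 0 by move: yz; rewrite (rdotC w y); lra.
apply/eqP; rewrite sqrf_eq0; apply/eqP.
by apply/eqP; rewrite -sqrf_eq0 -(nrm2 hilbertH) {1}/w (pvm_sym pvm (mJ n)) Jw yw.
Qed.

Lemma trunc_rsym : rsym dot S.
Proof.
move=> u v; rewrite -[in LHS](trunc_supp u) (pvm_sym pvm mI) -GS -sG GS (pvm_sym pvm mI).
by rewrite trunc_supp.
Qed.

Lemma trunc_inv_form v : rdot (S v) v = \int[mu (E I v)]_t t.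
Proof. by rewrite -GS -inv_form GS -[in LHS](trunc_supp v) (pvm_sym pvm mI). Qed.

Hypothesis b0 : 0 < b.

Lemma trunc_bound v : nrm (S v) <= b * nrm v.
Proof.
apply: (@sym_form_bound _ _ _ hilbertH (fun=> True) S b) => //.
- exact: trunc_lin.
- exact: trunc_rsym.
- move=> u _; rewrite trunc_inv_form.
  have /andP[h1 h2] := itv_bounds (pvm_idem pvm u mI).
  have c1 := pvm_contr u mI; apply/andP; split.
    by apply: le_trans h1; rewrite mulr_ge0 ?sqr_ge0// invr_ge0 ltW.
  by apply: (le_trans h2); rewrite ler_pM2l// lerXn2r// nnegrE nrm_ge0.
Qed.

Let h : R -> R := id \_ I.

Let mh : measurable_fun setT (h : T -> T).
Proof. by apply/(measurable_restrictT _ mI); exact: measurable_id. Qed.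

Let hI t : I t -> h t = t.
Proof. by move=> It; rewrite /h patchE mem_set. Qed.
Let hN t : (~` I) t -> h t = 0.
Proof. by move=> It; rewrite /h patchE memNset. Qed.

Let h_itv t : 0 <= h t <= b.
Proof.
have [It|It] := pselect (I t).
  rewrite hI//; move: It; rewrite /I/= in_itv/= => /andP[h1 ->]; rewrite andbT.
  by apply: le_trans h1; rewrite invr_ge0 ltW.
by rewrite hN// lexx ltW.
Qed.

Let ebd_h v : ebd (mu v) h.
Proof.
apply: (ebdI mh (B := setT) (K := b)) => //; first by rewrite setCT.
by move=> t _; have /andP[h1 h2] := h_itv t; rewrite ger0_norm.
Qed.

Let nu := push_measure mu mh.
Let F (B : set R) : H -> H := E (h @^-1` B).

Let pvmF : projection_valued_measure dot F nu.
Proof. exact: pvm_push. Qed.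

Let suppF v : nu v (~` `[0, b]%classic) = 0%E.
Proof.
rewrite /nu push_measureE (_ : _ @^-1` _ = set0) ?measure0//.
apply/seteqP; split=> t //=; rewrite ?in_itv/=; by apply; exact: h_itv.
Qed.

Let formF v : rdot (S v) v = \int[nu v]_t t.
Proof.
rewrite trunc_inv_form (Rint_push hilbertH pvm)//.
have mI' := measurableC mI.
have EI : E I (E I v) = E I v by exact: (pvm_idem pvm).
have EI' : E (~` I) (E (~` I) v) = E (~` I) v by exact: (pvm_idem pvm).
rewrite -[in RHS](pvm_setC hilbertH pvm v mI).
rewrite (Rint_add hilbertH pvm mI mI' (setICr I) EI EI' (ebd_h _) (ebd_h _)).
rewrite [X in _ = _ + X](_ : _ = 0); last first.
  have mu0 : mu (E (~` I) v) (~` ~` I) = 0%E by apply/(mu_fix hilbertH pvm).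
  rewrite (@Rint_ae_eq _ _ _ (fun=> 0) (~` I) (fin _) (ebd_h _) (ebd_cst _ _) mI' mu0 hN).
  by rewrite Rintegral_cst// mul0r.
have mu0 : mu (E I v) (~` I) = 0%E by apply/(mu_fix hilbertH pvm).
rewrite addr0; apply/esym.
exact: (Rint_ae_eq (fin _) (ebd_h _) (itv_ebd_id EI) mI mu0).
Qed.

Let f := cutinv M^-1.
Let Mi0 : 0 < M^-1. Proof. by rewrite invr_gt0. Qed.
Let f_bound t : 0 <= f t <= M.
Proof. by have := cutinv_bound t Mi0; rewrite invrK. Qed.
Let f_lip : lip b f := cutinv_lip b Mi0.
Let mf : measurable_fun setT (f : T -> R) := @measurable_cutinv R M^-1.

(** With f = 1/t on [1/M, b] and x = f(S), the operator S x - 1 is (t f - 1)(S),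
    which vanishes on the range of E(I). So v = S (x v) and G v = E(I) (x v). *)
Lemma trunc_form v : E I v = v -> rdot (G v) v = \int[mu v]_t t^-1.
Proof.
move=> Iv; have v0 : mu v (~` I) = 0%E by apply/(mu_fix hilbertH pvm).
have finF w : (nu w setT < +oo)%E by exact: (mu_fin hilbertH pvmF).
have [x fx] := calc_exists hilbertH trunc_lin b0 trunc_bound trunc_rsym pvmF suppF formF
  (bernstein b0 f_lip).
have ef w : ebd (nu w) f.
  apply: (ebd_on suppF (K := M)) => // t _.
  by have /andP[f0 fM] := f_bound t; rewrite ger0_norm.
have eid w : ebd (nu w) id by exact: (ebd_id suppF).
have tf1 := is_calcB (is_calcA trunc_lin b0 trunc_bound fx) (is_calc_1 S b).
have etf1 w : ebd (nu w) (fun t => t * f t - 1).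
  by apply: ebdB; [apply: ebdM|exact: ebd_cst].
have etf1h w : ebd (mu w) (fun t => (h t * f (h t) - 1) ^+ 2).
  have [m1 _] := ebd_exp 2 (etf1 w).
  apply: (ebdI _ (B := setT) (K := (b * M + 1) ^+ 2)) => //.
  - exact: (measurableT_comp m1 mh).
  - by rewrite setCT.
  - move=> t _; rewrite ger0_norm ?sqr_ge0// -real_normK ?num_real//.
    have bM : 0 <= b * M by rewrite mulr_ge0// ltW.
    rewrite lerXn2r// ?nnegrE ?addr_ge0//.
    apply: (le_trans (ler_normB _ _)); rewrite normr1 lerD2r.
    have /andP[h0 hb] := h_itv t; have /andP[f0 fb] := f_bound (h t).
    by rewrite ger0_norm ?mulr_ge0// ler_pM.
have fh t : I t -> h t * f (h t) = 1 /\ f (h t) = t^-1.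
  move=> It; rewrite hI//; move: It; rewrite /I/= in_itv/= => /andP[Mt tb].
  rewrite /f cutinvE//; split=> //; rewrite mulfV// gt_eqF//.
  by apply: lt_le_trans Mt; rewrite invr_gt0.
have Sxv : S (x v) = v.
  apply/eqP; rewrite -subr_eq0; apply/eqP/nrm_eq0/eqP; rewrite -sqrf_eq0; apply/eqP.
  rewrite (calc_nrm hilbertH trunc_lin b0 trunc_bound trunc_rsym pvmF suppF formF tf1)//.
  rewrite (Rint_push hilbertH pvm mh (f := fun t => (t * f t - 1) ^+ 2))//; last first.
    by have [] := ebd_exp 2 (etf1 v).
  rewrite (Rint_ae_eq (fin v) (etf1h v) (ebd_cst _ 0) mI v0) ?Rintegral_cst ?mul0r//.
  by move=> t /fh[-> _]; rewrite subrr expr0n.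
have Gv : G v = E I (x v) by rewrite -[in LHS]Sxv GS.
rewrite Gv (pvm_sym pvm mI) Iv.
rewrite (calc_form hilbertH trunc_lin b0 trunc_bound trunc_rsym pvmF suppF formF fx)//.
have efh w : ebd (mu w) (fun t => f (h t)).
  apply: (ebdI _ (B := setT) (K := M)) => //.
  - exact: (measurableT_comp mf mh).
  - by rewrite setCT.
  - by move=> t _; have /andP[f0 fb] := f_bound (h t); rewrite ger0_norm.
rewrite (Rint_push hilbertH pvm)//.
have eV : ebd (mu v) (fun t => t^-1).
  apply: (ebdI _ mI v0 (K := M)); first exact: measurable_funV.
  by move=> t /fh[_ <-]; have /andP[f0 fb] := f_bound (h t); rewrite ger0_norm.
by apply: (Rint_ae_eq (fin v) (efh v) eV mI v0) => t /fh[].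
Qed.
End truncation.

Lemma inv_ebd v : ebd (mu v) (fun t => t^-1).
Proof.
apply: (ebdI (B := ~` [set t : R | t < M^-1]) (K := M)).
- exact: measurable_funV.
- apply: measurableC; rewrite (_ : [set t | _] = `]-oo, M^-1[%classic); first exact: measurable_itv.
  by apply/seteqP; split=> t /=; rewrite ?in_itv.
- by rewrite setCK inv_supp.
- move=> t /= /negP; rewrite -leNgt => Mt.
  have t0 : 0 < t by apply: lt_le_trans Mt; rewrite invr_gt0.
  by rewrite gtr0_norm ?invr_gt0// -[leRHS]invrK lef_pV2 ?posrE ?invr_gt0.
Qed.

(** The representation on the ranges of E([1/M, n]) passes to the limit: these
    subspaces exhaust H, and both sides are bounded quadratic forms, the function 1/t
    being at most M on [1/M, +oo[. *)
Lemma inverse_form v : rdot (G v) v = \int[mu v]_t t^-1.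
Proof.
pose I n : set T := `[M^-1, n.+1%:R]%classic.
have mI n : measurable (I n) by exact: measurable_itv.
have bigI : mu v (~` \bigcup_n I n) = 0%E.
  apply: subset_measure0 (inv_supp v).
  - by apply: measurableC; exact: bigcupT_measurable.
  - rewrite (_ : [set t | _] = `]-oo, M^-1[%classic); first exact: measurable_itv.
    by apply/seteqP; split=> t /=; rewrite ?in_itv.
  - move=> t nt /=; rewrite ltNge; apply/negP => Mt; apply: nt.
    exists (Num.truncn t) => //=; rewrite /I/= in_itv/= Mt/=.
    exact: ltW (truncnS_gt _).
have subI n m : (n <= m)%N -> I n `<=` I m.
  move=> nm t; rewrite /I/= !in_itv/= => /andP[-> tn]/=.
  by rewrite (le_trans tn)// ler_nat.
apply/eqP; rewrite -subr_eq0 -normr_eq0 eq_le normr_ge0 andbT.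
apply: (@le0_small _ _ (4 * (M * nrm v))) => e e0.
have [n] := pvm_exhaust mI subI bigI e0.
have mI' := measurableC (mI n).
have [h1 h2] := (pvm_idem pvm v (mI n), pvm_idem pvm v mI').
have := pvm_setC hilbertH pvm v (mI n).
have wv := pvm_contr v mI'; have uv := pvm_contr v (mI n).
have := Rint_add hilbertH pvm (mI n) mI' (setICr (I n)) h1 h2 (inv_ebd _) (inv_ebd _).
have [S GS] := trunc_exists n.+1%:R.
rewrite -[X in _ = X + _](trunc_form GS (ltr0Sn _ _) h1).
have : `|\int[mu (E (~` I n) v)]_t t^-1| <= M * nrm (E (~` I n) v) ^+ 2.
  have [mV _] := inv_ebd v.
  rewrite -(fine_mu_T hilbertH pvm); rewrite ler_norml -mulNr.
  apply: (Rint_bounds (B := ~` [set t : R | t < M^-1]) (fin _)) => //.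
  - apply: measurableC; rewrite (_ : [set t | _] = `]-oo, M^-1[%classic); first exact: measurable_itv.
    by apply/seteqP; split=> t /=; rewrite ?in_itv.
  - by rewrite setCK inv_supp.
  - move=> t /= /negP; rewrite -leNgt -ler_norml => Mt.
    have t0 : 0 < t by apply: lt_le_trans Mt; rewrite invr_gt0.
    by rewrite gtr0_norm ?invr_gt0// -[leRHS]invrK lef_pV2 ?posrE ?invr_gt0.
move: {mI' h1 h2} (E (I n) v) (E (~` I n) v) wv uv => u w wv uv Iw Iv uw we.
rewrite uw in Iv; rewrite Iv -{1 2}uw. rewrite (linD lG) rdotDl !rdotDr.
have cs x y : `|rdot (G x) y| <= M * (nrm x * nrm y).
  apply: (le_trans (cauchy_schwarz hilbertH _ _)).
  by rewrite mulrA ler_wpM2r// nrm_ge0.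
have [w0 u0 v0] : [/\ 0 <= nrm w, 0 <= nrm u & 0 <= nrm v] by split; exact: nrm_ge0.
have c1 : M * (nrm u * nrm w) <= e * (M * nrm v).
  by rewrite [leRHS]mulrCA ler_pM2l// mulrC ler_pM.
have c2 : M * (nrm w * nrm w) <= e * (M * nrm v).
  by rewrite [leRHS]mulrCA ler_pM2l// ler_pM.
move: Iw (cs u w) (cs w u) (cs w w); rewrite expr2 (mulrC (nrm w) (nrm u)).
rewrite !ler_norml => /andP[? ?] /andP[? ?] /andP[? ?] /andP[? ?].
by apply/andP; split; lra.
Qed.
End inverse.
End Esetup.
End Inversion.

(** * Exchanging the spectral measures of G and its inverse *)

Section SpectralInversion.
Variables (R : realType) (H : completeNormedModType R[i]).
Variable dot : {dot H for @Num.conj R[i]}.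
Hypothesis hilbertH : hilbert_norm dot.
Local Notation rdot := (re_dot dot).
Local Notation T := (measurableTypeR R).
Variables (G : H -> H) (M : R).
Hypotheses (lG : linear G) (M0 : 0 < M) (bG : forall v, nrm (G v) <= M * nrm v).
Hypotheses (sG : rsym dot G) (pG : forall v, 0 <= rdot (G v) v) (iG : injective G).

Variables (E : set R -> H -> H) (mu : H -> {measure set T -> \bar R}).
Hypothesis pvm : projection_valued_measure dot E mu.
Let fin v : (mu v setT < +oo)%E := mu_fin hilbertH pvm v.

Notation inv_push := (push_measure mu (@measurable_funV R)).

Lemma spectral_of_inverse : spectral_integral dot mu id (inverse_graph (graph G)) ->
  spectral_integral dot inv_push id (graph G).
Proof.
move=> spec; have eV v := inv_ebd hilbertH lG M0 bG sG pG pvm spec v.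
split=> [v|v w].
  split=> [_|_]; last by exists (G v).
  rewrite (ge0_Int_push mu (@measurable_funV R) v (f := fun t => (t ^+ 2)%:E)).
  - by apply: (ebd_Int_fin hilbertH pvm); exact: ebd_exp.
  - by apply/measurable_EFinP; exact: measurable_funX.
  - by move=> t; rewrite lee_fin sqr_ge0.
rewrite /graph/= => ->; rewrite (rsym_real lG sG); congr (_%:C).
rewrite (inverse_form hilbertH lG M0 bG sG pG iG pvm spec).
by rewrite (Rint_push hilbertH pvm)//; exact: measurable_id.
Qed.

Section graph.
Hypothesis spec : spectral_integral dot mu id (graph G).
Let supp := graph_supp hilbertH bG pG pvm spec.
Let form := graph_form spec.

Let P : set T := `]0, M]%classic.
Let mP : measurable P. Proof. exact: measurable_itv. Qed.

(** This is where injectivity enters: a vector u fixed by E({0}) has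
    |G u|^2 <= M (G u | u) = 0. *)
Lemma graph_null0 v : mu v [set 0] = 0%E.
Proof.
apply: (mu0_fix hilbertH pvm) => // u Eu.
apply: iG; rewrite (lin0 lG); apply/nrm_eq0/eqP; rewrite -sqrf_eq0 eq_le sqr_ge0 andbT.
apply: (le_trans (pos_op_ineq hilbertH lG M0 bG sG pG u)).
rewrite form pmulr_rle0//.
have m0 : measurable ([set 0] : set T) by exact: measurable_set1.
have u0 : mu u (~` [set 0]) = 0%E by apply/(mu_fix hilbertH pvm _ m0).
have /andP[_] := @Rint_bounds _ _ id _ 0 0 (fin u) (@measurable_id _ _ _) m0 u0
  (fun t => ltac:(by move=> ->; rewrite lexx)).
by rewrite mul0r.
Qed.

Lemma graph_conull v : mu v (~` P) = 0%E.
Proof.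
have m1 : measurable (~` `[0, M]%classic : set T) by apply: measurableC; exact: measurable_itv.
have m2 : measurable ([set 0] : set T) by exact: measurable_set1.
apply: (@subset_measure0 _ _ _ (mu v) _ ((~` `[0, M]%classic : set T) `|` ([set 0] : set T))).
- exact: measurableC.
- exact: measurableU.
- move=> t /= h; have [->|t0] := eqVneq t 0; first by right.
  by left => /= h2; apply: h; move: h2; rewrite /P/= !in_itv/= !le_eqVlt eq_sym (negbTE t0).
- by have := @measureU0 _ _ _ (mu v) _ _ m1 m2 (graph_null0 v); rewrite (supp v).
Qed.

Let f (n : nat) : R -> R := cutinv n.+1%:R^-1.
Let c0 (n : nat) : 0 < n.+1%:R^-1 :> R. Proof. by rewrite invr_gt0. Qed.

Let ebd_f n v : ebd (mu v) (f n).
Proof.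
apply: (ebd_on supp (K := n.+1%:R)); first exact: measurable_cutinv.
by move=> t _; have /andP[h1 h2] := cutinv_bound t (c0 n); rewrite ger0_norm// -[leRHS]invrK.
Qed.
Let ebd_t v : ebd (mu v) id := ebd_id supp v.

Let tf_bound n t : 0 <= t -> 0 <= t * f n t <= 1.
Proof.
move=> t0; have f0 := cutinv_gt0 t (c0 n); rewrite mulr_ge0 ?(ltW f0)//=.
by rewrite /f /cutinv ler_pdivrMr ?lt_max ?c0 ?orbT// mul1r le_max lexx.
Qed.

Let f_le n m t : (n <= m)%N -> f n t <= f m t.
Proof.
move=> nm; rewrite /f /cutinv lef_pV2 ?posrE ?lt_max ?c0 ?orbT//.
rewrite ge_max le_max lexx/= le_max; apply/orP; right.
by rewrite lef_pV2 ?posrE// ler_nat.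
Qed.

Let x_ex : exists x : nat -> H -> H, forall n, is_calc G M (f n) (x n).
Proof.
suff /choice[x xP] : forall n, exists x, is_calc G M (f n) x by exists x.
move=> n; apply: (calc_exists hilbertH lG M0 bG sG pvm supp form).
by apply: bernstein => //; exact: cutinv_lip.
Qed.

Lemma Int_P v (g : R -> R) : ebd (mu v) g -> (forall t, P t -> 0 <= g t) ->
  (\int[mu v]_(t in P) (g t)%:E)%E = (\int[mu v]_t g t)%:E.
Proof.
move=> eg g0; rewrite -(ebd_IntE hilbertH pvm eg).
rewrite [RHS](negligible_integral (measurableC mP))//; last 2 first.
- exact: (ebd_integrable (fin v) eg).
- exact: graph_conull.
by rewrite setTD setCK.
Qed.

(** Monotone convergence, the functions f n increasing to 1/t on ]0, M]. *)
Lemma cut_cvg v k : ((\int[mu v]_t f n t ^+ k)%:E @[n --> \oo] -->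
  \int[mu v]_(t in P) ((t^-1) ^+ k)%:E)%E.
Proof.
have Pf n t : P t -> 0 <= f n t ^+ k.
  by move=> _; rewrite exprn_ge0// ltW// cutinv_gt0.
rewrite (_ : (fun n => _) = (fun n => \int[mu v]_(t in P) (f n t ^+ k)%:E)%E); last first.
  by apply/funext => n; rewrite Int_P; [by []|exact: ebd_exp|exact: Pf].
rewrite (_ : (\int[mu v]_(t in P) ((t^-1) ^+ k)%:E)%E =
  (\int[mu v]_(t in P) (limn (fun n => (f n t ^+ k)%:E)))%E); last first.
  apply: eq_integral => t /[!inE]; rewrite /P/= in_itv/= => /andP[t0 tM].
  apply/esym/cvg_lim => //; apply: cvg_near_cst; near=> n.
  rewrite /f cutinvE// -[leRHS]invrK lef_pV2 ?posrE ?invr_gt0//.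
  rewrite (@le_trans _ _ n%:R) ?ler_nat//; near: n; exact: nbhs_infty_ger.
apply: cvg_monotone_convergence => //.
- move=> n; apply/measurable_EFinP; apply: measurable_funTS.
  by have [] := ebd_exp k (ebd_f n v).
- move=> t _ n m nm /=; rewrite lee_fin lerXn2r ?nnegrE ?f_le//; exact/ltW/cutinv_gt0.
Unshelve. all: by end_near. Qed.

(** The operators x n = (f n)(G) approximate the inverse of G. If v = G u, then
    |x n v| <= |u|, as t f n(t) <= 1. Conversely, if 1/t is square
    integrable, then |x m v - x n v|^2 is at most the difference of two terms of a
    convergent sequence of integrals. So x n v has a limit u, and
    |G (x n v) - v|^2 <= r / n^2 shows that G u = v. *)
Lemma range_int v : (exists u, v = G u) <-> (\int[mu v]_(t in P) ((t^-1) ^+ 2)%:E < +oo)%E.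
Proof.
have [x xP] := x_ex; split.
  move=> [u ->]; apply: (@le_lt_trans _ _ (nrm u ^+ 2)%:E); last exact: ltry.
  rewrite -(cvg_lim _ (@cut_cvg (G u) 2))//; apply: lime_le.
    by apply/cvg_ex; eexists; exact: cut_cvg.
  near=> n; rewrite lee_fin.
  rewrite -(calc_nrm hilbertH lG M0 bG sG pvm supp form (xP n))//.
  rewrite (is_calc_comm lG M0 bG (xP n)).
  have tf := is_calcA lG M0 bG (xP n).
  have etf : ebd (mu u) (fun t => t * f n t) by apply: ebdM.
  rewrite (calc_nrm hilbertH lG M0 bG sG pvm supp form tf)//.
  have := @Rint_bounds _ _ (fun t => (t * f n t) ^+ 2) _ 0 1 (fin u) _ mP (graph_conull u) _.
  rewrite mul1r (fine_mu_T hilbertH pvm) => h; apply: (andP (h _ _)).2.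
    by have [] := ebd_exp 2 etf.
  move=> t; rewrite /P/= in_itv/= => /andP[/ltW/(tf_bound n)/andP[h1 h2] _].
  by rewrite sqr_ge0/= expr_le1.
move=> Xfin; pose X := (\int[mu v]_(t in P) ((t^-1) ^+ 2)%:E)%E.
have X0 : (0 <= X)%E by apply: integral_ge0 => t _; rewrite lee_fin sqr_ge0.
pose r := fine X; have Xr : X = r%:E by rewrite /r fineK// ge0_fin_numE.
have r0 : 0 <= r by rewrite fine_ge0.
pose c n := \int[mu v]_t f n t ^+ 2.
have ef2 n : ebd (mu v) (fun t => f n t ^+ 2) by exact: ebd_exp.
have f0 n t : 0 <= f n t by exact/ltW/cutinv_gt0.
have nc : nondecreasing_seq c.
  move=> n m nm; apply: (le_Rint (fin v) (ef2 n) (ef2 m) mP (graph_conull v)) => t _.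
  by rewrite lerXn2r ?nnegrE ?f_le.
have cr : c n @[n --> \oo] --> r.
  have := @cut_cvg v 2; rewrite -/X Xr => /fine_cvgP[_].
  by apply: cvg_trans; apply: near_eq_cvg; near=> n.
have c_le n : c n <= r.
  rewrite -(cvg_lim _ cr)//; apply: nondecreasing_cvgn_le => //.
  by apply/cvg_ex; exists r.
have xx n m : nrm (x m v - x n v) ^+ 2 <= `|c m - c n|.
  have d w i j : (i <= j)%N -> nrm (x j w - x i w) ^+ 2 = \int[mu w]_t (f j t - f i t) ^+ 2.
    move=> _; exact: (calc_nrm hilbertH lG M0 bG sG pvm supp form
      (is_calcB (xP j) (xP i)) (ebdB (ebd_f j w) (ebd_f i w))).
  wlog nm : n m / (n <= m)%N.
    move=> h; have [/h//|/ltnW/h] := leqP n m.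
    by rewrite distrC -nrmN opprB.
  rewrite d// ger0_norm; last by rewrite subr_ge0 nc.
  rewrite -RintB//.
  apply: (le_Rint (fin v) _ _ mP (graph_conull v)).
  - by apply: ebd_exp; apply: ebdB.
  - by apply: ebdB.
  - by move=> t _; have := f_le t nm; have := f0 n t; nra.
have xv n : nrm (G (x n v) - v) ^+ 2 <= r * n.+1%:R^-1 ^+ 2.
  have tf := is_calcB (is_calcA lG M0 bG (xP n)) (is_calc_1 G M).
  have etf : ebd (mu v) (fun t => t * f n t - 1) by apply: ebdB; [apply: ebdM|exact: ebd_cst].
  rewrite (calc_nrm hilbertH lG M0 bG sG pvm supp form tf)//.
  rewrite -lee_fin -Int_P; [|exact: ebd_exp|by move=> t _; rewrite sqr_ge0].
  have mV2 : measurable_fun P (fun t => (t^-1 ^+ 2)%:E).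
    apply/measurable_EFinP; apply: measurable_funTS; apply: measurable_funX.
    exact: measurable_funV.
  have V0 t : P t -> (0 <= ((t^-1 : R) ^+ 2)%:E)%E by move=> _; rewrite lee_fin sqr_ge0.
  have k0 : 0 <= n.+1%:R^-1 ^+ 2 :> R by rewrite sqr_ge0.
  rewrite mulrC EFinM -Xr /X -(ge0_integralZl _ mP mV2 V0); last by rewrite lee_fin.
  apply: ge0_le_integral => //.
  - by move=> t _; rewrite lee_fin sqr_ge0.
  - apply/measurable_EFinP; apply: measurable_funTS.
    by have [] := ebd_exp 2 etf.
  - exact: measurable_funeM.
  move=> t; rewrite /P/= in_itv/= => /andP[t0 _]; rewrite -EFinM lee_fin -exprMn.
  have [nt|tn] := leP n.+1%:R^-1 t.
    by rewrite /f cutinvE// mulfV ?gt_eqF// subrr expr0n sqr_ge0.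
  have /andP[h1 h2] := tf_bound n (ltW t0).
  rewrite -[leLHS]real_normK ?num_real// lerXn2r ?nnegrE//.
    by rewrite mulr_ge0// invr_ge0 ltW.
  apply: (@le_trans _ _ 1); first by rewrite ler_norml; apply/andP; split; lra.
  by rewrite ler_pdivlMr// mul1r ltW.
(* A subsequence converging with rate 1/k, as complete_seq asks. *)
have /choice[N NP] : forall k, exists n, (k <= n)%N /\ r - c n <= k.+1%:R^-1 ^+ 2.
  move=> k; have /cvgrPdist_le/(_ (k.+1%:R^-1 ^+ 2)) := cr.
  rewrite exprn_gt0// => /(_ isT) crk.
  near \oo => n; exists n; split; first by near: n; exact: nbhs_infty_ge.
  by rewrite -[leLHS]ger0_norm ?subr_ge0//; near: n.
have [u xu] : exists u, forall k, nrm (x (N k) v - u) <= 1 * k.+1%:R^-1.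
  apply: complete_seq => // n m; rewrite mul1r.
  have i0 k : 0 <= k.+1%:R^-1 :> R by [].
  apply: sqr_ge0_le; first by rewrite addr_ge0.
  apply: (le_trans (xx _ _)).
  have [_ h1] := NP n; have [_ h2] := NP m.
  have := c_le (N n); have := c_le (N m); have := i0 n; have := i0 m.
  move: h1 h2; move: (_^-1) (_^-1) (c _) (c _) => a b p q h1 h2 h3 h4 h5 h6.
  by rewrite ler_norml; apply/andP; split; nra.
exists u; apply/esym/eqP; rewrite -subr_eq0; apply/eqP/nrm_eq0/eqP.
rewrite eq_le nrm_ge0 andbT.
apply: (@le0_small _ _ (M + Num.sqrt r)) => e e0.
have [k ke] : exists k, (k.+1%:R : R)^-1 <= e.
  exists (Num.truncn e^-1); rewrite -[leRHS]invrK lef_pV2 ?posrE ?invr_gt0//.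
  exact: ltW (truncnS_gt _).
have h1 : nrm (G u - G (x (N k) v)) <= M * e.
  rewrite -(linB lG); apply: (le_trans (bG _)); rewrite ler_pM2l//.
  by rewrite -nrmN opprB (le_trans (xu k))// mul1r.
have h2 : nrm (G (x (N k) v) - v) <= Num.sqrt r * e.
  apply: sqr_ge0_le; first by rewrite mulr_ge0 ?sqrtr_ge0// ltW.
  apply: (le_trans (xv _)); rewrite exprMn sqr_sqrtr// ler_wpM2l//.
  have [kN _] := NP k; rewrite lerXn2r ?nnegrE ?(ltW e0)//.
  by apply: le_trans ke; rewrite lef_pV2 ?posrE// ler_nat.
apply: (le_trans (nrm_dist_le _ (G (x (N k) v)) _)).
by rewrite mulrDr (mulrC e) (mulrC e) lerD.
Unshelve. all: by end_near. Qed.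

(** The form of (f n)(G) at G u is that of (t^2 f n)(G) at u, and
    |t - t^2 f n(t)| <= 1/n. *)
Lemma inv_int_form u : (\int[mu (G u)]_(t in P) (t^-1)%:E)%E = (rdot (G u) u)%:E.
Proof.
have [x xP] := x_ex.
have key n : `|rdot (G u) u - \int[mu (G u)]_t f n t| <= nrm u ^+ 2 * n.+1%:R^-1.
  rewrite -(calc_form hilbertH lG M0 bG sG pvm supp form (xP n))//.
  rewrite (is_calc_comm lG M0 bG (xP n)) -(sG (G (x n u))).
  have ettf : ebd (mu u) (fun t => t * (t * f n t)) by do 2![apply: ebdM => //].
  have ttf := is_calcA lG M0 bG (is_calcA lG M0 bG (xP n)).
  rewrite (calc_form hilbertH lG M0 bG sG pvm supp form ttf)// form.
  rewrite mulrC -(fine_mu_T hilbertH pvm).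
  apply: (Rint_dist (fin u) (ebd_t u) ettf mP (graph_conull u)) => t.
  rewrite /P/= in_itv/= => /andP[t0 _].
  have [nt|tn] := leP n.+1%:R^-1 t.
    by rewrite /f cutinvE// mulfV ?gt_eqF// mulr1 subrr normr0.
  have /andP[h1 h2] := tf_bound n (ltW t0).
  rewrite -[X in X - _]mulr1 -mulrBr normrM (gtr0_norm t0) ger0_norm; last by rewrite subr_ge0.
  apply: (le_trans _ (ltW tn)); rewrite ler_piMr ?(ltW t0)//; lra.
have cv : (\int[mu (G u)]_t f n t) @[n --> \oo] --> rdot (G u) u.
  have : (nrm u ^+ 2 * n.+1%:R^-1) @[n --> \oo] --> (nrm u ^+ 2 * 0 : R).
    by apply: cvgM; [exact: cvg_cst|exact: cvg_harmonic].
  rewrite mulr0 => /cvgrPdist_le h; apply/cvgrPdist_le => e e0.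
  near=> n; apply: (le_trans (key n)); rewrite -[leLHS]ger0_norm.
    by rewrite -normrN -[X in `|X|]sub0r; near: n; exact: h.
  by rewrite mulr_ge0 ?sqr_ge0.
have h1 := @cut_cvg (G u) 1.
have h2 : ((\int[mu (G u)]_t f n t ^+ 1)%:E @[n --> \oo] --> (rdot (G u) u)%:E)%E.
  by apply: cvg_EFin; [near=> n|exact: cv].
exact: (cvg_unique (@ereal_hausdorff R) h1 h2).
Unshelve. all: by end_near. Qed.

Lemma spectral_of_graph : spectral_integral dot inv_push id (inverse_graph (graph G)).
Proof.
have mV2 : measurable_fun setT (fun t : T => ((t^-1 : R) ^+ 2)%:E).
  by apply/measurable_EFinP; apply: measurable_funX; exact: measurable_funV.
split=> [v|v w].
  rewrite (ge0_Int_push mu (@measurable_funV R) v (f := fun t => (t ^+ 2)%:E)); first last.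
  - by move=> t; rewrite lee_fin sqr_ge0.
  - by apply/measurable_EFinP; exact: measurable_funX.
  rewrite (ge0_negligible_integral (measurableC mP) _ mV2)//; last 2 first.
  - by move=> t _; rewrite lee_fin sqr_ge0.
  - exact: graph_conull.
  rewrite setTD setCK -range_int; split=> -[u]; exists u => //.
rewrite /inverse_graph/graph/= => ->.
rewrite (hermC dot)/= expr0 mul1r (rsym_real lG sG).
rewrite (_ : Num.conj _ = (rdot (G w) w)%:C); last exact: conjc_real.
congr (_%:C).
have Vint : (\int[mu (G w)]_(t in P) (t^-1)%:E)%E = (rdot (G w) w)%:E := inv_int_form w.
have V0 (t : T) : P t -> (0 <= (t^-1)%:E)%E.
  by rewrite /P/= in_itv/= lee_fin => /andP[t0 _]; rewrite invr_ge0 ltW.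
have VP : (mu (G w)).-integrable P (EFin \o (fun t => t^-1)).
  apply/integrableP; split.
    by apply/measurable_EFinP; apply: measurable_funTS; exact: measurable_funV.
  rewrite (eq_integral (fun t : T => (t^-1)%:E)) ?Vint ?ltry// => t /[!inE] Pt.
  by rewrite /= ger0_norm// -lee_fin V0.
have VT : (mu (G w)).-integrable setT (EFin \o (fun t => t^-1)).
  apply/(negligible_integrable (measurableC mP) measurableT _ (graph_conull (G w))).
    by apply/measurable_EFinP; exact: measurable_funV.
  by rewrite setTD setCK.
have mid : measurable_fun setT (fun t : T => t%:E).
  by apply/measurable_EFinP; exact: measurable_id.
rewrite /Rintegral (integral_pushforward (@measurable_funV R) mid)//.
rewrite [X in fine X](_ : _ = (\int[mu (G w)]_(t in P) (t^-1)%:E)%E) ?Vint//.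
rewrite (negligible_integral (measurableC mP) _ VT (graph_conull (G w)))//.
by rewrite setTD setCK.
Qed.
End graph.
End SpectralInversion.

(** * Powers and heat functions of the spectral parameter *)

Section Kernels.
Variable R : realType.
Local Notation T := (measurableTypeR R).
Implicit Types (s t u M : R).

(** The function exp (- u / t), with the value 0 on the negative side: as
    a function of the spectral parameter of G it is Lipschitz on [0, M]. *)
Definition heat_fun u t : R := if 0 < t then expR (- (u / t)) else 0.

Lemma heat_fun_pos u t : 0 < t -> heat_fun u t = expR (- (u / t)).
Proof. by rewrite /heat_fun => ->. Qed.

Lemma measurable_heat_fun u : measurable_fun setT (heat_fun u : T -> T).
Proof.
rewrite (_ : heat_fun u = (fun t => expR (- (u * t^-1))) \_ (`]0, +oo[%classic : set T)).
  apply/(measurable_restrictT _ (measurable_itv _)); apply: measurable_funTS.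
  apply: measurableT_comp => //; apply: measurableT_comp => //.
  by apply: measurable_funM => //; exact: measurable_funV.
by apply/funext => t; rewrite /heat_fun patchE /= mem_setE in_itv/= andbT.
Qed.

Lemma heat_fun_bound u t : 0 <= u -> 0 <= heat_fun u t <= 1.
Proof.
move=> u0; rewrite /heat_fun; case: ifPn => [t0|_]; last by rewrite lexx ler01.
by rewrite expR_ge0/= -expR0 ler_expR oppr_le0 divr_ge0// ltW.
Qed.

Lemma lip_mono M L (f : R -> R) :
  (forall x y : R, 0 <= x -> x <= y -> y <= M -> 0 <= f y - f x <= L * (y - x)) -> lip M f.
Proof.
move=> h; exists L => x y /andP[x0 xM] /andP[y0 yM].
have [xy|/ltW yx] := leP x y.
  have /andP[h1 h2] := h x y x0 xy yM.
  by rewrite distrC [`|x - y|]distrC (ger0_norm h1) ger0_norm ?subr_ge0.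
have /andP[h1 h2] := h y x y0 yx xM.
by rewrite (ger0_norm h1) ger0_norm ?subr_ge0.
Qed.

Lemma lipD M f g : lip M f -> lip M g -> lip M (fun t => f t + g t).
Proof.
move=> [L fL] [K gK]; exists (L + K) => x y hx hy; rewrite mulrDl.
by rewrite opprD addrACA (le_trans (ler_normD _ _))// lerD ?fL ?gK.
Qed.

Lemma lipZ M c f : lip M f -> lip M (fun t => c * f t).
Proof.
move=> [L fL]; exists (`|c| * L) => x y hx hy.
by rewrite -mulrBr normrM -mulrA ler_wpM2l// fL.
Qed.

Lemma lip_bound M f : 0 <= M -> lip M f -> exists K, forall t : R, 0 <= t <= M -> `|f t| <= K.
Proof.
move=> M0 [L fL]; exists (`|f 0| + `|L| * M) => t /andP[t0 tM].
rewrite -[f t](subrK (f 0)) addrC (le_trans (ler_normD _ _))// lerD2l.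
have : `|f t - f 0| <= L * `|t - 0| by apply: fL; rewrite ?lexx ?t0 ?tM.
move=> /le_trans; apply; rewrite subr0 ger0_norm//.
apply: (@le_trans _ _ (`|L| * t)); first by rewrite ler_wpM2r// ler_norm.
by rewrite ler_wpM2l.
Qed.

(** The function (f - c)^+, which for c > 0 vanishes where f is small and converges
    uniformly to f >= 0 as c tends to 0. *)
Definition soft_cut c f (t : R) : R := Num.max (f t - c) 0.

Lemma lip_cut M c f : lip M f -> lip M (soft_cut c f).
Proof.
move=> [L fL]; exists L => x y hx hy; apply: le_trans (fL x y hx hy).
rewrite /soft_cut; move: (f x) (f y) => a b.
have maxE z : Num.max z 0 = if 0 < z then z else 0 :> R.
  by rewrite maxC; case: (ltP 0 z).
rewrite !maxE ler_norml; have := ler_norm (a - b); have := ler_norm (- (a - b)).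
by rewrite normrN; case: ifPn; case: ifPn; rewrite -?leNgt => ? ? ? ?; apply/andP; split; lra.
Qed.

Lemma expRN_le1 (y : R) : 0 < y -> expR (- y) <= y^-1.
Proof.
move=> y0; rewrite expRN lef_pV2 ?posrE ?expR_gt0//.
by apply: le_trans (expR_ge1Dx y); rewrite lerDr.
Qed.

Lemma expRN_le2 (y : R) : 0 < y -> expR (- y) <= 2 * y ^- 2.
Proof.
move=> y0; rewrite expRN -[leRHS]invrK lef_pV2 ?posrE ?expR_gt0//; last first.
  by rewrite invr_gt0 mulr_gt0// invr_gt0 exprn_gt0.
rewrite invfM invrK mulrC; apply: le_trans (expR_ge1Dxn 1%N (ltW y0)).
by rewrite lerDr.
Qed.

(** For x <= y/2, the bound exp (- u/y) <= y/u suffices, as y <= 2 (y - x). Otherwise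
    exp (- u/y) <= 2 (y/u)^2 absorbs the singularity of the difference u/x - u/y. *)
Lemma heat_fun_lip M u : 0 < u -> lip M (heat_fun u).
Proof.
move=> u0; apply: (@lip_mono _ (4 / u)) => x y x0 xy _.
have [y0|y0] := leP y 0.
  have -> : x = y by lra.
  by rewrite !subrr mulr0 lexx.
have hxy : heat_fun u x <= heat_fun u y.
  rewrite /heat_fun y0; case: ifPn => // x1.
  by rewrite ler_expR lerN2 ler_pM2l// lef_pV2 ?posrE.
rewrite subr_ge0 hxy/=.
have [xy2|xy2] := leP x (y / 2).
  apply: (@le_trans _ _ (heat_fun u y)); first by rewrite gerBl; have /andP[] := heat_fun_bound x (ltW u0).
  rewrite heat_fun_pos//; apply: (le_trans (expRN_le1 _)); first by rewrite divr_gt0.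
  by rewrite invf_div mulrAC ler_pM2r ?invr_gt0//; lra.
have x1 : 0 < x by lra.
rewrite !heat_fun_pos//.
have -> : - (u / x) = - (u / y) + (u / y - u / x) by lra.
rewrite expRD -{1}[expR (- (u / y))]mulr1 -mulrBr.
apply: (@le_trans _ _ (2 * (u / y) ^- 2 * (u / x - u / y))).
  apply: ler_pM; first exact: expR_ge0.
  - by rewrite subr_ge0 -expR0 ler_expR subr_le0 ler_pM2l// lef_pV2 ?posrE.
  - by apply: expRN_le2; rewrite divr_gt0.
  - by have := expR_ge1Dx (u / y - u / x); move: (u / y) (u / x) => ? ?; lra.
have -> : 2 * (u / y) ^- 2 * (u / x - u / y) = (2 * y / x) * ((y - x) / u).
  by field; rewrite !gt_eqF.
rewrite [leRHS](_ : _ = 4 * ((y - x) / u)); last by rewrite mulrAC mulrA.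
rewrite ler_wpM2r ?divr_ge0 ?subr_ge0 ?(ltW u0)//.
by rewrite ler_pdivrMr//; lra.
Qed.

(** t^s is at most t where t <= 1, and at most t^2 elsewhere. *)
Lemma powR_le_lin M s t : 0 <= t -> t <= M -> 1 <= s <= 2 -> t `^ s <= t * (1 + M).
Proof.
rewrite le_eqVlt => /predU1P[<- M0 /andP[s1 _]|t0 tM /andP[s1 s2]].
  by rewrite powR0 ?mul0r// gt_eqF//; lra.
have [t1|t1] := leP t 1.
  apply: (@le_trans _ _ t); first by apply: ge1r_powR => //; rewrite t0.
  by rewrite ler_peMr ?(ltW t0)//; lra.
apply: (@le_trans _ _ (t ^+ 2)).
  by rewrite -powR_mulrn ?(ltW t0)//; apply: ler_powR => //; lra.
by rewrite expr2 ler_pM2l//; lra.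
Qed.

(** As x/y <= 1 and s <= 2, x^s >= y^s (x/y)^2, so that
    y^s - x^s <= y^s (1 - (x/y)^2) is controlled by [powR_le_lin] without
    derivatives. *)
Lemma powR_lip M s : 1 <= s <= 2 -> lip M (fun t => t `^ s).
Proof.
move=> s12; have s0 : 0 < s by move: s12 => /andP[h _]; lra.
apply: (@lip_mono _ (2 * (1 + M))) => x y x0 xy yM.
have [y0|y0] := leP y 0.
  have -> : x = y by lra.
  by rewrite !subrr mulr0 lexx.
rewrite subr_ge0 ge0_ler_powR ?nnegrE ?(ltW s0) ?(ltW y0)//=.
have [xz|xn0] := eqVneq x 0.
  rewrite xz powR0 ?gt_eqF// !subr0 (le_trans (powR_le_lin (ltW y0) yM s12))//.
  by rewrite mulrC ler_wpM2r ?(ltW y0)//; lra.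
have x1 : 0 < x by rewrite lt0r xn0.
have h1 : y `^ s * (x / y) ^+ 2 <= x `^ s.
  have -> : x `^ s = y `^ s * (x / y) `^ s.
    by rewrite -powRM ?(ltW y0) ?divr_ge0 ?(ltW y0)// mulrC divfK// gt_eqF.
  rewrite ler_wpM2l ?powR_ge0// -powR_mulrn ?divr_ge0 ?(ltW y0)//.
  apply: ger_powR; last by case/andP: s12.
  by rewrite divr_gt0//= ler_pdivrMr// mul1r.
have h2 := powR_le_lin (ltW y0) yM s12.
have h3 : y `^ s * (1 - (x / y) ^+ 2) <= y * (1 + M) * (1 - (x / y) ^+ 2).
  rewrite ler_wpM2r// subr_ge0 expr_le1// ?divr_ge0 ?(ltW y0)//.
  by rewrite ler_pdivrMr// mul1r.
have h4 : y * (1 + M) * (1 - (x / y) ^+ 2) = (1 + M) * (y - x) * ((y + x) / y).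
  by field; rewrite gt_eqF.
have h5 : (1 + M) * (y - x) * ((y + x) / y) <= (1 + M) * (y - x) * 2.
  rewrite ler_wpM2l ?mulr_ge0 ?subr_ge0//; first by lra.
  by rewrite ler_pdivrMr//; lra.
by move: h1 h3 h5; rewrite -h4 mulrBr mulr1; move: (_ ^+ 2) => ?; lra.
Qed.

Lemma measurable_cut c f : measurable_fun setT (f : T -> T) ->
  measurable_fun setT (soft_cut c f : T -> T).
Proof.
move=> mf; apply: measurable_maxr => //.
by apply: measurable_funB => //.
Qed.

Definition mlip M (f : R -> R) := measurable_fun setT (f : T -> T) /\ lip M f.

Lemma mlip0 M : mlip M (fun=> 0).
Proof. by split; [exact: measurable_cst|exists 0 => x y _ _; rewrite subrr normr0 mul0r]. Qed.
Lemma mlipD M f g : mlip M f -> mlip M g -> mlip M (fun t => f t + g t).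
Proof. by move=> [mf lf] [mg lg]; split; [exact: measurable_funD|exact: lipD]. Qed.
Lemma mlipZ M c f : mlip M f -> mlip M (fun t => c * f t).
Proof. by move=> [mf lf]; split; [exact: measurable_funM|exact: lipZ]. Qed.
Lemma mlip_sum M (F : nat -> R -> R) n : (forall j, mlip M (F j)) ->
  mlip M (fun t => \sum_(j < n) F j t).
Proof.
move=> LF; elim: n => [|n IH].
  by rewrite (_ : (fun t => _) = (fun=> 0)); [exact: mlip0|apply/funext => t; rewrite big_ord0].
rewrite (_ : (fun t => _) = (fun t => \sum_(j < n) F j t + F n t)); first exact: mlipD.
by apply/funext => t; rewrite big_ord_recr.
Qed.
Lemma mlip_cut M c f : mlip M f -> mlip M (soft_cut c f).
Proof. by move=> [mf lf]; split; [exact: measurable_cut|exact: lip_cut]. Qed.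
Lemma mlip_powR M s : 1 <= s <= 2 -> mlip M (fun t => t `^ s).
Proof. by move=> s12; split; [exact: measurable_powR|exact: powR_lip]. Qed.
Lemma mlip_heat_fun M u : 0 < u -> mlip M (heat_fun u).
Proof. by move=> u0; split; [exact: measurable_heat_fun|exact: heat_fun_lip]. Qed.
End Kernels.

(** * Powers and heat operators as norm limits of polynomials *)

Section Identify.
Variables (R : realType) (H : completeNormedModType R[i]).
Variable dot : {dot H for @Num.conj R[i]}.
Hypothesis hilbertH : hilbert_norm dot.
Local Notation rdot := (re_dot dot).
Local Notation T := (measurableTypeR R).
Variables (G : H -> H) (M : R).
Hypotheses (lG : linear G) (M0 : 0 < M) (bG : forall v, nrm (G v) <= M * nrm v).
Hypotheses (sG : rsym dot G) (pG : forall v, 0 <= rdot (G v) v) (iG : injective G).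

Definition has_spec (A : set (H * H)) := exists E mu,
  projection_valued_measure dot E mu /\ spectral_integral dot mu id A.

Lemma no_spec_calc A f : ~ has_spec A -> functional_calculus dot A f = 0.
Proof.
move=> nA; apply: xgetPN => x [_ [E [mu [pvm spec _]]]].
by apply: nA; exists E, mu.
Qed.

(** Together with [no_spec_calc], this makes the powers of G and its heat operators
    vanish together when G has no spectral measure. *)
Lemma inverse_spec : has_spec (inverse_graph (graph G)) -> has_spec (graph G).
Proof.
move=> [E [mu [pvm spec]]].
exists (fun B => E ((fun t => t^-1) @^-1` B)), (push_measure mu (@measurable_funV R)).
split; first exact: pvm_push.
exact: (spectral_of_inverse hilbertH lG M0 bG sG pG iG pvm spec).
Qed.

Section withspec.
Variables (E : set R -> H -> H) (mu : H -> {measure set T -> \bar R}).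
Hypothesis pvm : projection_valued_measure dot E mu.
Hypothesis spec : spectral_integral dot mu id (graph G).
Let supp := graph_supp hilbertH bG pG pvm spec.
Let form := graph_form spec.
Let fin v : (mu v setT < +oo)%E := mu_fin hilbertH pvm v.

Local Notation L := (mlip M).

Lemma mlip_ebd f v : L f -> ebd (mu v) f.
Proof.
move=> [mf /(lip_bound (ltW M0))[K fK]].
exact: (ebd_on supp v mf fK).
Qed.

Lemma mlip_calc_exists f : L f -> exists x, is_calc G M f x.
Proof.
move=> [_ lf]; apply: (calc_exists hilbertH lG M0 bG sG pvm supp form).
exact: bernstein.
Qed.

(** Only ]0, M] matters, its complement being null for an injective G. *)
Lemma calc_le f g x y : L f -> L g -> is_calc G M f x -> is_calc G M g y ->
  (forall t : R, 0 < t <= M -> f t <= g t) -> forall v, rdot (x v) v <= rdot (y v) v.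
Proof.
move=> Lf Lg fx gy fg v.
rewrite (calc_form hilbertH lG M0 bG sG pvm supp form fx (mlip_ebd _ Lf)).
rewrite (calc_form hilbertH lG M0 bG sG pvm supp form gy (mlip_ebd _ Lg)).
apply: (le_Rint (fin v) (mlip_ebd _ Lf) (mlip_ebd _ Lg) (measurable_itv _)
  (graph_conull hilbertH lG M0 bG sG pG iG pvm spec v)) => t /=.
by rewrite in_itv/=; exact: fg.
Qed.

(** A symmetric operator is determined by its quadratic form. *)
Lemma form_unique x y : linear x -> linear y -> rsym dot x ->
  (forall v, dot (y v) v = (rdot (x v) v)%:C) -> x = y.
Proof.
move=> lx ly sx yx.
have sy : rsym dot y by apply: (real_rsym ly) => v; rewrite yx.
have lxy : linear (fun v => x v - y v).
  by move=> c u w; rewrite lx ly scalerBr opprD addrACA.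
have xy0 : (fun v => x v - y v) = 0.
  apply: (rsym_form0 hilbertH lxy).
    by move=> u w; rewrite rdotBl rdotBr sx sy.
  by move=> w; rewrite rdotBl (rdot_Re (yx w)) subrr.
apply/funext => v; apply/eqP; rewrite -subr_eq0; apply/eqP.
exact: (congr1 (fun h => h v) xy0).
Qed.

Lemma calc_unique f x y : L f -> is_calc G M f x -> is_calc G M f y -> x = y.
Proof.
move=> Lf fx fy; apply: form_unique; [exact: (is_calc_lin lG fx)|exact: (is_calc_lin lG fy)|exact: (is_calc_rsym hilbertH sG fx)|].
move=> v; rewrite (rsym_real (is_calc_lin lG fy)); last exact: (is_calc_rsym hilbertH sG fy).
congr (_%:C).
by rewrite !(calc_form hilbertH lG M0 bG sG pvm supp form _ (mlip_ebd _ Lf)).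
Qed.

Lemma calc_Re x v f : is_calc G M f x -> dot (x v) v = (rdot (x v) v)%:C.
Proof.
by move=> fx; rewrite (rsym_real (is_calc_lin lG fx))//; exact: (is_calc_rsym hilbertH sG fx).
Qed.

Lemma calc_bop x f : is_calc G M f x -> bounded_operators x.
Proof.
move=> fx; apply/bounded_operatorsP; split; first exact: (is_calc_lin lG fx).
exact: (is_calc_bdd M0 bG fx).
Qed.

(** The spectral measure in the definition of the calculus need not be E. But
    the norm limit f(G) has the form given by any spectral measure of G, so
    [form_unique] identifies it with the chosen operator. *)
Lemma functional_calculusE f : L f -> is_calc G M f (functional_calculus dot (graph G) f).
Proof.
move=> Lf; have [x fx] := mlip_calc_exists Lf.
rewrite /functional_calculus; case: xgetP => [y _ [by_ [E2 [mu2 [pvm2 spec2 y2]]]]|]; last first.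
  move=> /(_ x) []; split; first exact: (calc_bop fx).
  exists E, mu; split=> //; split=> [v|v w].
    split=> [_|_]; last by exists (x v).
    by apply: (ebd_Int_fin hilbertH pvm); apply: ebd_exp; exact: mlip_ebd.
  rewrite /graph/= => ->; rewrite (calc_Re _ fx).
  by rewrite (calc_form hilbertH lG M0 bG sG pvm supp form fx (mlip_ebd _ Lf)).
suff <- : x = y by [].
have [ly _] := by_; apply: form_unique => //; first exact: (is_calc_lin lG fx).
  exact: (is_calc_rsym hilbertH sG fx).
move=> v; rewrite (y2.2 v (y v))//; congr (_%:C).
have supp2 := graph_supp hilbertH bG pG pvm2 spec2.
have [mf /(lip_bound (ltW M0))[K fK]] := Lf.
by rewrite (calc_form hilbertH lG M0 bG sG pvm2 supp2 (graph_form spec2) fx (ebd_on supp2 v mf fK)).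
Qed.

Lemma op_powerE s : 1 <= s <= 2 -> is_calc G M (fun t => t `^ s) (op_power dot G s).
Proof. by move=> s12; apply: functional_calculusE; exact: mlip_powR. Qed.

(** As for [functional_calculusE], after transporting spectral measures between G and
    its inverse by t |-> 1/t. The function exp (- l^(-1) t) is unbounded on the
    negative half-line, which is null for a spectral measure of the inverse. *)
Lemma heat_opE l : 0 < l -> is_calc G M (heat_fun l^-1) (heat_op dot G l).
Proof.
move=> l0; have u0 : 0 < l^-1 by rewrite invr_gt0.
have Lh := mlip_heat_fun M u0; have [mh _] := Lh.
have [x fx] := mlip_calc_exists Lh.
pose k (t : R) := expR (- (l^-1 * t)).
have mk : measurable_fun setT (k : T -> T).
  apply: measurableT_comp => //; apply: measurableT_comp => //.
have k01 t : 0 <= t -> 0 <= k t <= 1.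
  by move=> t0; rewrite expR_ge0/= -expR0 ler_expR oppr_le0 mulr_ge0// ltW.
have kV t : 0 < t -> k t^-1 = heat_fun l^-1 t by move=> t0; rewrite heat_fun_pos.
have Vk t : 0 < t -> heat_fun l^-1 t^-1 = k t.
  by move=> t0; rewrite heat_fun_pos ?invr_gt0// invrK.
have mP : measurable (`]0, M]%classic : set T) by exact: measurable_itv.
have Pnull := graph_conull hilbertH lG M0 bG sG pG iG pvm spec.
have mkV : measurable_fun setT (fun t : T => k t^-1 : T).
  by apply: (measurableT_comp mk); exact: measurable_funV.
have ekV v : ebd (mu v) (fun t => k t^-1).
  apply: (ebdI mkV mP (Pnull v) (K := 1)) => t.
  rewrite /= in_itv/= => /andP[t0 _].
  have /andP[h1 h2] : 0 <= k t^-1 <= 1 by apply: k01; rewrite invr_ge0 ltW.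
  by rewrite ger0_norm.
rewrite /heat_op /functional_calculus -/k.
case: xgetP => [y _ [by_ [E2 [mu2 [pvm2 spec2 y2]]]]|]; last first.
  move=> /(_ x) []; split; first exact: (calc_bop fx).
  exists (fun B => E ((fun t => t^-1) @^-1` B)), (push_measure mu (@measurable_funV R)).
  split; first exact: pvm_push.
    exact: (spectral_of_graph hilbertH lG M0 bG sG pG iG pvm spec).
  split=> [v|v w].
    split=> [_|_]; last by exists (x v).
    rewrite (ge0_Int_push mu (@measurable_funV R) v (f := fun t => (k t ^+ 2)%:E)).
    - by apply: (ebd_Int_fin hilbertH pvm); exact: (ebd_exp 2 (ekV v)).
    - by apply/measurable_EFinP; exact: measurable_funX.
    - by move=> t; rewrite lee_fin sqr_ge0.
  rewrite /graph/= => ->; rewrite (calc_Re _ fx); congr (_%:C).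
  rewrite (calc_form hilbertH lG M0 bG sG pvm supp form fx (mlip_ebd _ Lh)).
  rewrite (Rint_push hilbertH pvm (@measurable_funV R) mk (ekV v)).
  apply: (Rint_ae_eq (fin v) (mlip_ebd _ Lh) (ekV v) mP (Pnull v)) => t.
  by rewrite /= in_itv/= => /andP[t0 _]; rewrite kV.
suff <- : x = y by [].
have [ly _] := by_; apply: form_unique => //; first exact: (is_calc_lin lG fx).
  exact: (is_calc_rsym hilbertH sG fx).
move=> v; rewrite (y2.2 v (y v))//; congr (_%:C).
have spec3 := spectral_of_inverse hilbertH lG M0 bG sG pG iG pvm2 spec2.
have pvm3 : projection_valued_measure dot (fun B => E2 ((fun t => t^-1) @^-1` B))
  (push_measure mu2 (@measurable_funV R)) by exact: pvm_push.
have supp3 := graph_supp hilbertH bG pG pvm3 spec3.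
have [_ /(lip_bound (ltW M0))[K fK]] := Lh.
rewrite (calc_form hilbertH lG M0 bG sG pvm3 supp3 (graph_form spec3) fx (ebd_on supp3 v mh fK)).
have mS : measurable ([set t : R | t < M^-1] : set T).
  rewrite (_ : [set t | _] = `]-oo, M^-1[%classic); first exact: measurable_itv.
  by apply/seteqP; split=> t /=; rewrite ?in_itv.
have S0 : mu2 v (~` ~` [set t : R | t < M^-1]) = 0%E.
  by rewrite setCK (inv_supp hilbertH lG M0 bG sG pG pvm2 spec2).
have Spos t : (~` [set t : R | t < M^-1]) t -> 0 < t.
  by move=> /= /negP; rewrite -leNgt; apply: lt_le_trans; rewrite invr_gt0.
have mhV : measurable_fun setT (fun t : T => heat_fun l^-1 t^-1 : T).
  by apply: (measurableT_comp mh); exact: measurable_funV.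
have ehV : ebd (mu2 v) (fun t => heat_fun l^-1 t^-1).
  apply: (ebdI mhV (measurableC mS) S0 (K := 1)) => t /Spos t0.
  by have /andP[h1 h2] := heat_fun_bound t^-1 (ltW u0); rewrite ger0_norm.
have ek : ebd (mu2 v) k.
  apply: (ebdI mk (measurableC mS) S0 (K := 1)) => t /Spos t0.
  by have /andP[h1 h2] := k01 t (ltW t0); rewrite ger0_norm.
rewrite (Rint_push hilbertH pvm2 (@measurable_funV R) mh ehV).
apply: (Rint_ae_eq (mu_fin hilbertH pvm2 v) ek ehV (measurableC mS) S0) => t /Spos t0.
by rewrite Vk.
Qed.
End withspec.
End Identify.

(** * The weight tau (a^* f(G) a) *)

Section Trace.
Variables (R : realType) (H : completeNormedModType R[i]).
Variable dot : {dot H for @Num.conj R[i]}.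
Hypothesis hilbertH : hilbert_norm dot.
Local Notation rdot := (re_dot dot).
Local Notation T := (measurableTypeR R).
Variables (N : set (H -> H)) (tau : (H -> H) -> \bar R).
Hypothesis vnN : von_neumann_algebra dot N.
Hypothesis trace_tau : faithful_normal_semifinite_trace dot N tau.
Variables (G : H -> H) (M : R).
Hypotheses (lG : linear G) (M0 : 0 < M) (bG : forall v, nrm (G v) <= M * nrm v).
Hypotheses (sG : rsym dot G) (pG : forall v, 0 <= rdot (G v) v) (iG : injective G).
Hypothesis NG : N G.

Lemma N_bicommutant x : bounded_operators x ->
  (forall y, commutant N y -> forall v, x (y v) = y (x v)) -> N x.
Proof.
move=> bx xy; case: vnN => _ _ <-; split=> // y Ny.
by apply/funext => v; exact: xy.
Qed.

Lemma N_commute x y v : N x -> commutant N y -> x (y v) = y (x v).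
Proof. by move=> Nx [_ h]; have := congr1 (fun f => f v) (h x Nx). Qed.

Lemma N_bop x : N x -> bounded_operators x.
Proof. by case: vnN => h _ _; exact: h. Qed.

Lemma N_comp x y : N x -> N y -> N (x \o y).
Proof.
move=> Nx Ny; apply: N_bicommutant.
  have /bounded_operatorsP[lx [K K0 xK]] := N_bop Nx.
  have /bounded_operatorsP[ly [K' K'0 yK]] := N_bop Ny.
  apply/bounded_operatorsP; split; first by move=> c u v /=; rewrite ly lx.
  exists (K * K'); first exact: mulr_ge0.
  by move=> v /=; rewrite (le_trans (xK _))// -mulrA ler_wpM2l.
by move=> z Nz v /=; rewrite (N_commute _ Ny)// (N_commute _ Nx).
Qed.

Lemma N_zero : N 0.
Proof.
apply: N_bicommutant.
  apply/bounded_operatorsP; split; first by move=> c u v; rewrite /= scaler0 addr0.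
  by exists 0 => // v; rewrite mul0r nrm0.
move=> y [/bounded_operatorsP[ly _] _] v.
by rewrite [RHS](lin0 ly).
Qed.

Lemma tau0 : tau 0 = 0%E.
Proof.
have p0 : pos_part dot N 0.
  split; first exact: N_zero.
  by move=> v; rewrite linear0l.
have := trace_scale trace_tau (lexx (0 : R)) p0.
rewrite mul0e => <-; congr tau; apply/funext => v.
by rewrite /= scaler0.
Qed.

(** An operator commuting with G commutes with the polynomials in G, hence with
    their norm limits; so the limit is in the bicommutant of N. *)
Lemma N_calc f x : is_calc G M f x -> N x.
Proof.
move=> fx; apply: N_bicommutant; first exact: (calc_bop lG M0 bG fx).
move=> y cy v; have [/bounded_operatorsP[ly [K K0 yK]] _] := cy.
have Gy w : G (y w) = y (G w) by rewrite (N_commute _ NG cy).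
have py p : poly_op G p (y v) = y (poly_op G p v).
  rewrite /poly_op (lin_sum ly); apply: eq_bigr => i _; rewrite (linZ ly); congr (_ *: _).
  by elim: (i : nat) => // k IH; rewrite /= IH Gy.
apply/eqP; rewrite -subr_eq0; apply/eqP/nrm_eq0/eqP; rewrite eq_le nrm_ge0 andbT.
apply: (@le0_small _ _ (nrm (y v) + K * nrm v)) => e e0.
have [p [_ px]] := fx e e0.
apply: (le_trans (nrm_dist_le _ (poly_op G p (y v)) _)); rewrite mulrDr lerD//.
  by rewrite -nrmN opprB px.
rewrite py -(linB ly); apply: (le_trans (yK _)); rewrite [leRHS]mulrCA; apply: ler_wpM2l => //; exact: px.
Qed.

Section withspec.
Variables (E : set R -> H -> H) (mu : H -> {measure set T -> \bar R}).
Hypothesis pvm : projection_valued_measure dot E mu.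
Hypothesis spec : spectral_integral dot mu id (graph G).
Let supp := graph_supp hilbertH bG pG pvm spec.
Let form := graph_form spec.
Let fin v : (mu v setT < +oo)%E := mu_fin hilbertH pvm v.

Variables (a : H -> H).
Hypotheses (Na : N a) (adj : is_adjoint dot a (adjoint dot a)).

Local Notation L := (mlip M).

(** The operator f(G). *)
Definition calc_op (f : R -> R) : H -> H := xget 0 [set x | is_calc G M f x].

Lemma calc_opP f : L f -> is_calc G M f (calc_op f).
Proof.
move=> Lf; rewrite /calc_op; case: xgetP => [y _ //|].
by have [x fx] := mlip_calc_exists hilbertH lG M0 bG sG pG pvm spec Lf => /(_ x).
Qed.

Lemma calc_opE f x : L f -> is_calc G M f x -> x = calc_op f.
Proof.
move=> Lf fx; apply: (calc_unique hilbertH lG M0 bG sG pG pvm spec Lf fx).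
exact: calc_opP.
Qed.

Definition compress (f : R -> R) : H -> H := adjoint dot a \o calc_op f \o a.

Lemma compress_form f v : L f ->
  dot (compress f v) v = (rdot (calc_op f (a v)) (a v))%:C.
Proof.
move=> Lf; rewrite /compress/=.
rewrite (hermC dot)/= expr0 mul1r -adj -(calc_Re hilbertH lG sG (a v) (calc_opP Lf)).
by rewrite [RHS](hermC dot)/= expr0 mul1r.
Qed.

Lemma calc_op_form f v : L f -> rdot (calc_op f v) v = \int[mu v]_t f t.
Proof.
move=> Lf; exact: (calc_form hilbertH lG M0 bG sG pvm supp form (calc_opP Lf) (mlip_ebd hilbertH M0 bG pG pvm spec v Lf)).
Qed.

Lemma calc_op_le f g v : L f -> L g -> (forall t : R, 0 < t <= M -> f t <= g t) ->
  rdot (calc_op f v) v <= rdot (calc_op g v) v.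
Proof.
move=> Lf Lg fg.
exact: (calc_le hilbertH lG M0 bG sG pG iG pvm spec Lf Lg (calc_opP Lf) (calc_opP Lg) fg).
Qed.

Lemma compress_pos f : L f -> (forall t : R, 0 < t <= M -> 0 <= f t) -> pos_part dot N (compress f).
Proof.
move=> Lf f0; split.
  apply: N_comp => //; apply: N_comp; last exact: (N_calc (calc_opP Lf)).
  by case: vnN => _ h _; exact: h.
move=> v; rewrite compress_form// lecR.
have z0 : rdot (calc_op (fun=> 0) (a v)) (a v) = 0.
  by rewrite calc_op_form ?Rintegral_cst ?mul0r//; exact: mlip0.
by rewrite -z0; apply: calc_op_le => //; exact: mlip0.
Qed.

Definition tau_calc f := tau (compress f).

Lemma tau_calc_ge0 f : L f -> (forall t : R, 0 < t <= M -> 0 <= f t) -> (0 <= tau_calc f)%E.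
Proof. by move=> Lf f0; apply: (trace_ge0 trace_tau); exact: compress_pos. Qed.

Let ebdL f v : L f -> ebd (mu v) f.
Proof. exact: (mlip_ebd hilbertH M0 bG pG pvm spec v). Qed.

Lemma adj_lin : linear (adjoint dot a).
Proof. by have /bounded_operatorsP[] : bounded_operators (adjoint dot a)
  by apply: N_bop; case: vnN => _ h _; exact: h. Qed.

Lemma tau_calc_add f g : L f -> L g -> (forall t : R, 0 < t <= M -> 0 <= f t) ->
  (forall t : R, 0 < t <= M -> 0 <= g t) -> tau_calc (fun t => f t + g t) = (tau_calc f + tau_calc g)%E.
Proof.
move=> Lf Lg f0 g0; rewrite /tau_calc -(trace_add trace_tau); [|exact: compress_pos|exact: compress_pos].
congr tau; apply/funext => v; rewrite /compress.
have -> : calc_op (fun t => f t + g t) = (fun v => calc_op f v + calc_op g v).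
  apply/esym; apply: (form_unique hilbertH).
  - by move=> c u w; rewrite !(is_calc_lin lG (calc_opP _))// scalerDr addrACA.
  - by apply: (is_calc_lin lG (calc_opP _)); exact: mlipD.
  - by move=> u w; rewrite rdotDl rdotDr !(is_calc_rsym hilbertH sG (calc_opP _)).
  - move=> w; rewrite (calc_Re hilbertH lG sG _ (calc_opP (mlipD Lf Lg))) calc_op_form; last exact: mlipD.
    by rewrite rdotDl !calc_op_form// RintD//; exact: ebdL.
by rewrite /compress/= (linD adj_lin).
Qed.

Lemma tau_calc_scale c f : 0 <= c -> L f -> (forall t : R, 0 < t <= M -> 0 <= f t) ->
  tau_calc (fun t => c * f t) = (c%:E * tau_calc f)%E.
Proof.
move=> c0 Lf f0; rewrite /tau_calc -(trace_scale trace_tau)//; last exact: compress_pos.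
congr tau; apply/funext => v; rewrite /compress.
have -> : calc_op (fun t => c * f t) = (fun v => c%:C *: calc_op f v).
  apply/esym; apply: (form_unique hilbertH).
  - move=> k u w; rewrite !(is_calc_lin lG (calc_opP _))// scalerDr !scalerA.
    by rewrite mulrC.
  - by apply: (is_calc_lin lG (calc_opP _)); exact: mlipZ.
  - by move=> u w; rewrite rdotZl rdotZr (is_calc_rsym hilbertH sG (calc_opP _)).
  - move=> w; rewrite (calc_Re hilbertH lG sG _ (calc_opP (mlipZ c Lf))) calc_op_form; last exact: mlipZ.
    by rewrite rdotZl !calc_op_form// RintZ//; exact: ebdL.
by rewrite /compress/= (linZ adj_lin).
Qed.

Lemma tau_calc_mono f g : L f -> L g -> (forall t : R, 0 < t <= M -> 0 <= f t <= g t) ->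
  (tau_calc f <= tau_calc g)%E.
Proof.
move=> Lf Lg fg.
have Lgf : L (fun t => g t - f t).
  rewrite (_ : (fun t => _) = (fun t => g t + (-1) * f t)); first exact/mlipD/mlipZ.
  by apply/funext => t; rewrite mulN1r.
rewrite (_ : g = (fun t => f t + (g t - f t))); last by apply/funext => t; lra.
rewrite tau_calc_add//.
- by rewrite leeDl// tau_calc_ge0// => t /fg; lra.
- by move=> t /fg /andP[].
- by move=> t /fg; lra.
Qed.

(** The operators x n = a^* ((f - 1/n)^+)(G) a increase, and f - (f - 1/n)^+ is at
    most 1/n where f >= 0. So a^* f(G) a is within |a v|^2 / n of x n as a
    form, hence their least upper bound, and normality applies. *)
Lemma tau_calc_sup f B : L f -> (forall t : R, 0 < t <= M -> 0 <= f t) ->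
  (forall n, (tau_calc (soft_cut n.+1%:R^-1 f) <= B)%E) -> (tau_calc f <= B)%E.
Proof.
move=> Lf f0 fB.
pose x n := compress (soft_cut n.+1%:R^-1 f).
have Lc n : L (soft_cut n.+1%:R^-1 f) by exact: mlip_cut.
have cut0 n t : 0 <= soft_cut n.+1%:R^-1 f t by rewrite /soft_cut le_max lexx orbT.
have px n : pos_part dot N (x n) by apply: compress_pos.
have le_opP g h : L g -> L h -> (forall t : R, 0 < t <= M -> g t <= h t) ->
    le_op dot (compress g) (compress h).
  move=> Lg Lh gh v; rewrite linearBl/= !compress_form// -rmorphB/= lecR subr_ge0.
  exact: calc_op_le.
have cut_le n m t : (n <= m)%N -> soft_cut n.+1%:R^-1 f t <= soft_cut m.+1%:R^-1 f t.
  move=> nm; rewrite /soft_cut ge_max !le_max lexx orbT andbT lerD2l lerN2.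
  by rewrite lef_pV2 ?posrE// ler_nat ltnS nm.
rewrite /tau_calc (trace_normal trace_tau (D := range x) (x := compress f)).
- by apply: ge_ereal_sup => _ [_ [n _ <-] <-]; exact: fB.
- by move=> _ [n _ <-].
- split; first by exists (x 0); exists 0%N.
  move=> _ _ [n _ <-] [m _ <-]; exists (x (maxn n m)); split; first by exists (maxn n m).
    by apply: le_opP => // t _; apply: cut_le; exact: leq_maxl.
  by apply: le_opP => // t _; apply: cut_le; exact: leq_maxr.
split; first exact: compress_pos.
  move=> _ [n _ <-]; apply: le_opP => // t tM.
  rewrite /soft_cut ge_max f0// andbT gerBl invr_ge0//.
move=> z [Nz pz] xz v; rewrite linearBl/= compress_form//.
have zv : dot (z v) v = (rdot (z v) v)%:C by rewrite /re_dot RRe_real// ger0_real.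
rewrite zv -rmorphB/= lecR subr_ge0 -subr_le0.
apply: (@le0_small _ _ (nrm (a v) ^+ 2)) => e e0.
have [n ne] : exists n, (n.+1%:R : R)^-1 <= e.
  exists (Num.truncn e^-1); rewrite -[leRHS]invrK lef_pV2 ?posrE ?invr_gt0//.
  exact: ltW (truncnS_gt _).
have h1 : rdot (calc_op (soft_cut n.+1%:R^-1 f) (a v)) (a v) <= rdot (z v) v.
  have := xz (x n) (ex_intro2 _ _ n I erefl) v.
  by rewrite linearBl/= compress_form// zv -rmorphB/= lecR subr_ge0.
have h2 : `|rdot (calc_op f (a v)) (a v) - rdot (calc_op (soft_cut n.+1%:R^-1 f) (a v)) (a v)|
    <= e * nrm (a v) ^+ 2.
  rewrite !calc_op_form// -(fine_mu_T hilbertH pvm (a v)).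
  apply: (Rint_dist (fin _) (ebdL _ Lf) (ebdL _ (Lc n)) (measurable_itv `]0, M])
    (graph_conull hilbertH lG M0 bG sG pG iG pvm spec _)) => t.
  rewrite /= in_itv/= => tM; rewrite (le_trans _ ne)//.
  have := f0 t tM; have i0 : 0 <= n.+1%:R^-1 :> R by [].
  move: i0; rewrite /soft_cut; move: (n.+1%:R^-1) (f t) => r b r0 b0.
  by rewrite maxC; case: (ltP 0 (b - r)) => ?; rewrite ler_norml; apply/andP; split; lra.
by move: h2; rewrite ler_norml => /andP[_ h2]; lra.
Qed.
End withspec.
End Trace.

(** * Powers against geometric sums of heat functions *)

Section Pointwise.
Variable R : realType.
Implicit Types (s t u x y v M : R).

Let q : R := expR (- 1).
Let q0 : 0 < q. Proof. exact: expR_gt0. Qed.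
Let q1 : q < 1. Proof. by rewrite -expR0 ltr_expR ltrN10. Qed.

(** A bounded increasing function whose increments between q y and y dominate
    y^s exp (- q y): summed over the geometric progression y, q y, q^2 y, ... these
    increments telescope. *)
Definition sat y : R := y / (1 + y).

Lemma sat_bound y : 0 <= y -> 0 <= sat y <= 1.
Proof.
by move=> y0; rewrite /sat divr_ge0 ?addr_ge0//= ler_pdivrMr ?ltr_wpDr// mul1r; lra.
Qed.

(** The cubic term of the exponential series at q (1 + y). *)
Lemma cube_exp y : 0 <= y -> (1 + y) ^+ 3 * expR (- (q * y)) <= 6 * q ^- 3 * expR q.
Proof.
move=> y0; have w0 : 0 <= q * (1 + y) by rewrite mulr_ge0 ?(ltW q0)//; lra.
have h : (q * (1 + y)) ^+ 3 / 6 <= expR (q * (1 + y)).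
  by apply: le_trans (expR_ge1Dxn 2%N w0); rewrite lerDr.
have -> : (1 + y) ^+ 3 * expR (- (q * y)) =
   6 * q ^- 3 * ((q * (1 + y)) ^+ 3 / 6 * expR (- (q * y))).
  by field; rewrite gt_eqF.
rewrite ler_wpM2l ?mulr_ge0 ?invr_ge0 ?exprn_ge0 ?(ltW q0)//.
apply: (@le_trans _ _ (expR (q * (1 + y)) * expR (- (q * y)))).
  by rewrite ler_wpM2r ?expR_ge0.
by rewrite -expRD mulrDr mulr1 addrK.
Qed.

Definition pow_exp_cst : R := 6 * q ^- 3 * expR q / (1 - q).

Lemma pow_exp_cst_gt0 : 0 < pow_exp_cst.
Proof.
by rewrite /pow_exp_cst !(mulr_gt0, invr_gt0, exprn_gt0, expR_gt0)// subr_gt0.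
Qed.

(** The increment of y / (1 + y) is at least (1 - q) y / (1 + y)^2, and
    y^s <= y (1 + y). So it remains to bound (1 + y)^3 exp (- q y). *)
Lemma pow_exp_sat s y : 1 <= s <= 2 -> 0 < y ->
  y `^ s * expR (- (q * y)) <= pow_exp_cst * (sat y - sat (q * y)).
Proof.
move=> s12 y0.
have h1 := powR_le_lin (ltW y0) (lexx y) s12.
have qy0 : 0 < q * y by rewrite mulr_gt0.
have h2 : (1 - q) * (y / (1 + y) ^+ 2) <= sat y - sat (q * y).
  have -> : sat y - sat (q * y) = (1 - q) * (y / ((1 + y) * (1 + q * y))).
    by rewrite /sat; field; rewrite !gt_eqF ?addr_gt0.
  rewrite ler_wpM2l ?subr_ge0 ?(ltW q1)// ler_pM2l// lef_pV2 ?posrE; last 2 first.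
  - by rewrite exprn_gt0// addr_gt0.
  - by rewrite mulr_gt0 ?addr_gt0.
  by rewrite expr2 ler_pM2l ?addr_gt0// lerD2l ler_piMl// ltW.
apply: (@le_trans _ _ (pow_exp_cst * ((1 - q) * (y / (1 + y) ^+ 2)))); last first.
  by rewrite ler_wpM2l// ltW// pow_exp_cst_gt0.
have -> : pow_exp_cst * ((1 - q) * (y / (1 + y) ^+ 2)) =
   6 * q ^- 3 * expR q * (y / (1 + y) ^+ 2).
  by rewrite /pow_exp_cst; field; rewrite !gt_eqF ?subr_gt0 ?addr_gt0.
apply: (@le_trans _ _ (y * (1 + y) * expR (- (q * y)))).
  by rewrite ler_wpM2r ?expR_ge0.
have -> : y * (1 + y) * expR (- (q * y)) =
    (1 + y) ^+ 3 * expR (- (q * y)) * (y / (1 + y) ^+ 2).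
  by field; rewrite gt_eqF ?addr_gt0.
apply: ler_wpM2r; last exact/cube_exp/ltW.
by rewrite divr_ge0 ?(ltW y0)// exprn_ge0// addr_ge0// ltW.
Qed.

(** With y_j = e^(-j) / x, one has e^(-j) <= e^2 e^(-js) = e^2 x^s y_j^s, because
    j (s - 1) <= 2, and the sums of y_j^s exp (- q y_j) telescope by
    [pow_exp_sat]. *)
Lemma sum_heat_fun_le n s x : 1 <= s <= 2 -> n%:R * (s - 1) <= 2 -> 0 < x ->
  \sum_(j < n) expR (- j%:R) * heat_fun (expR (- j.+1%:R)) x <= expR 2 * pow_exp_cst * x `^ s.
Proof.
move=> s12 nv x0.
pose y j := expR (- j%:R) / x.
have y0 j : 0 < y j by rewrite divr_gt0 ?expR_gt0.
have yS j : y j.+1 = q * y j.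
  by rewrite /y /q mulrA -expRD -natr1 opprD addrC.
have term (j : 'I_n) : expR (- j%:R) * heat_fun (expR (- j.+1%:R)) x <=
    expR 2 * pow_exp_cst * x `^ s * (sat (y j) - sat (y j.+1)).
  rewrite heat_fun_pos// -/(y j.+1) yS.
  have -> : expR 2 * pow_exp_cst * x `^ s * (sat (y j) - sat (q * y j)) =
     expR 2 * x `^ s * (pow_exp_cst * (sat (y j) - sat (q * y j))) by ring.
  apply: (@le_trans _ _ (expR 2 * x `^ s * (y j `^ s * expR (- (q * y j))))); last first.
    by rewrite ler_wpM2l ?pow_exp_sat// mulr_ge0 ?expR_ge0 ?powR_ge0.
  rewrite !mulrA ler_wpM2r ?expR_ge0//.
  have xy : x * y j = expR (- j%:R) by rewrite /y mulrC divfK// gt_eqF.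
  rewrite -mulrA -powRM ?(ltW x0) ?(ltW (y0 j))// xy.
  rewrite /powR gt_eqF ?expR_gt0// expRK -expRD ler_expR.
  have : j%:R * (s - 1) <= 2.
    apply: le_trans nv; rewrite ler_wpM2r ?ler_nat ?(ltnW (ltn_ord _))//.
    by move: s12 => /andP[h _]; lra.
  by move: (j%:R : R) => jj; lra.
apply: (le_trans (ler_sum _ (fun j _ => term j))).
rewrite -mulr_sumr -[leRHS]mulr1 ler_wpM2l//.
  by apply: mulr_ge0; [apply: mulr_ge0; [exact: expR_ge0|exact: ltW pow_exp_cst_gt0]|exact: powR_ge0].
have -> : \sum_(j < n) (sat (y j) - sat (y j.+1)) = sat (y 0%N) - sat (y n).
  elim: n {nv term} => [|n IH]; first by rewrite big_ord0 subrr.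
  by rewrite big_ord_recr/= IH addrA subrK.
have /andP[_ h1] := sat_bound (ltW (y0 0%N)); have /andP[h2 _] := sat_bound (ltW (y0 n)).
by lra.
Qed.

(** For x > 1 the heat function of parameter 1 suffices, and for x <= 1/(n + 1) the left
    side is 0. In between, the j with e^(-j) < x <= e^(1 - j) is at most
    n + 1, and its term alone is at least e^(-3) x^s. *)
Lemma cut_pow_le M n s x : 0 < M -> 1 <= s <= 2 -> 0 < x <= M ->
  soft_cut n.+1%:R^-1 (fun t => t `^ s) x <=
  expR 3 * \sum_(j < n.+2) expR (- (j%:R * s)) * heat_fun (expR (- j%:R)) x
  + expR 1 * (M * (1 + M)) * heat_fun 1 x.
Proof.
move=> M0 s12 /andP[x0 xM]; have /andP[s1 s2] := s12.
have hk0 u : 0 <= u -> 0 <= heat_fun u x by move=> /(heat_fun_bound x)/andP[].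
have S0 : 0 <= expR 3 * \sum_(j < n.+2) expR (- (j%:R * s)) * heat_fun (expR (- j%:R)) x.
  rewrite mulr_ge0 ?expR_ge0// sumr_ge0// => j _.
  by rewrite mulr_ge0 ?expR_ge0 ?hk0 ?expR_ge0.
have h0 : 0 <= expR 1 * (M * (1 + M)) * heat_fun 1 x.
  by rewrite !mulr_ge0 ?expR_ge0 ?hk0// ?addr_ge0// ltW.
rewrite /soft_cut ge_max addr_ge0// andbT lerBlDr.
have [x1|x1] := leP x 1; last first.
  have hx : x `^ s <= expR 1 * (M * (1 + M)) * heat_fun 1 x.
    rewrite heat_fun_pos// -mulrA mulrCA -expRD.
    apply: (le_trans (powR_le_lin (ltW x0) xM s12)).
    rewrite -[leLHS]mulr1; apply: ler_pM; rewrite ?mulr_ge0 ?(ltW x0) ?addr_ge0 ?(ltW M0)//.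
      by rewrite ler_wpM2r// addr_ge0// ltW.
    by rewrite -[X in X <= _]expR0 ler_expR subr_ge0 div1r invf_le1// ltW.
  have i0 : 0 <= n.+1%:R^-1 :> R by [].
  by move: i0 hx S0; move: (n.+1%:R^-1) (x `^ s) (expR 3 * _) (_ * heat_fun 1 x) => a b c d; lra.
have [xn|nx] := leP x n.+1%:R^-1.
  have hx : x `^ s <= n.+1%:R^-1.
    by apply: le_trans xn; apply: ge1r_powR => //; rewrite x0.
  by move: hx S0 h0; move: (n.+1%:R^-1) (x `^ s) (expR 3 * _) (_ * heat_fun 1 x) => a b c d; lra.
pose j := (Num.truncn (- ln x)).+1.
have lnx0 : 0 <= - ln x by rewrite oppr_ge0 ln_le0.
have /andP[j1 j2] : j%:R - 1 <= - ln x < j%:R.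
  by rewrite /j -natr1 addrK natr1; exact: truncn_itv.
have jn : (j < n.+2)%N.
  rewrite ltnS -(ler_nat R) -natr1.
  have : - ln x <= n%:R.
    rewrite -ler_expR expRN lnK ?posrE//.
    apply: (@le_trans _ _ n.+1%:R); first by rewrite -[leRHS]invrK lef_pV2 ?posrE ?invr_gt0// ltW.
    by rewrite -natr1 addrC expR_ge1Dx.
  by move: j1; move: (j%:R : R) (n%:R : R) => ? ?; lra.
have hj : x `^ s <= expR 3 * (expR (- (j%:R * s)) * heat_fun (expR (- j%:R)) x).
  rewrite heat_fun_pos// /powR gt_eqF// -{2}[x]lnK ?posrE// -expRN -!expRD ler_expR.
  have h1 : expR (- j%:R - ln x) <= 1 by rewrite -[X in _ <= X]expR0 ler_expR; lra.
  have h2 : s * (ln x) <= s * (1 - j%:R) by rewrite ler_wpM2l//; lra.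
  by move: h1 h2; move: (expR (_ - _)) => e; lra.
have : x `^ s <= expR 3 * \sum_(j < n.+2) expR (- (j%:R * s)) * heat_fun (expR (- j%:R)) x.
  apply: (le_trans hj); rewrite ler_wpM2l ?expR_ge0//.
  rewrite (bigD1 (Ordinal jn))//= lerDl sumr_ge0// => i _.
  by rewrite mulr_ge0 ?expR_ge0 ?hk0 ?expR_ge0.
have i0 : 0 <= n.+1%:R^-1 :> R by [].
by move: i0 h0; move: (n.+1%:R^-1) (x `^ s) (expR 3 * _) (_ * heat_fun 1 x) => a b c d; lra.
Qed.

Lemma heat_fun_le_sqr u x : 0 < u -> 0 < x -> heat_fun u x <= 2 * u ^- 2 * x `^ 2.
Proof.
move=> u0 x0; rewrite heat_fun_pos// powR_mulrn ?(ltW x0)//.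
apply: (le_trans (expRN_le2 _)); first by rewrite divr_gt0.
by rewrite le_eqVlt; apply/orP; left; apply/eqP; field; rewrite !gt_eqF.
Qed.

(** Summation by parts: the partial sums of b are compared with D (j + 1), for which
    the same identity is a geometric sum. *)
Lemma abel_sum (r D : R) (b : nat -> R) n : 0 < r < 1 -> 0 <= D ->
  (forall j, 0 <= b j) -> (forall k, \sum_(j < k) b j <= D * k.+1%:R) ->
  \sum_(j < n) r ^+ j * b j <= D + D / (1 - r).
Proof.
move=> /andP[r0 r1] D0 b0 bD.
pose B k := \sum_(j < k) b j.
have abel m : \sum_(j < m) r ^+ j * b j =
    r ^+ m * B m + (1 - r) * \sum_(j < m) r ^+ j * B j.+1.
  elim: m => [|m IH]; first by rewrite !big_ord0 /B big_ord0; ring.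
  rewrite !big_ord_recr/= IH exprS /B !big_ord_recr/=; ring.
have geo m : r ^+ m * (D * m.+1%:R) + (1 - r) * \sum_(j < m) r ^+ j * (D * j.+2%:R) =
    D + D * \sum_(j < m) r ^+ j.
  elim: m => [|m IH]; first by rewrite !big_ord0; ring.
  rewrite !big_ord_recr/= exprS -(natr1 m.+1).
  rewrite [RHS](_ : _ = D + D * (\sum_(j < m) r ^+ j) + D * r ^+ m); last by ring.
  by rewrite -IH; ring.
rewrite abel.
apply: (@le_trans _ _ (r ^+ n * (D * n.+1%:R) + (1 - r) * \sum_(j < n) r ^+ j * (D * j.+2%:R))).
  apply: lerD; first by rewrite ler_wpM2l ?bD// exprn_ge0// ltW.
  rewrite ler_wpM2l ?subr_ge0 ?(ltW r1)//; apply: ler_sum => j _.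
  by rewrite ler_wpM2l ?bD// exprn_ge0// ltW.
rewrite geo lerD2l ler_wpM2l//.
rewrite -[leRHS]mul1r ler_pdivlMr ?subr_gt0// mulrC.
have -> : (1 - r) * \sum_(j < n) r ^+ j = 1 - r ^+ n.
  by rewrite -[RHS]opprB subrX1 -mulNr opprB.
by rewrite gerBl exprn_ge0// ltW.
Qed.
End Pointwise.

(** * Cesaro means against the zeta function *)

(** W stands for the weight tau (a^* f(G) a), of which only positivity, additivity,
    homogeneity, monotonicity and continuity along truncations are kept. *)
Section Comparison.
Variables (R : realType) (M : R) (W : (R -> R) -> \bar R).
Hypothesis M0 : 0 < M.
Local Notation L := (mlip M).
Local Open Scope ereal_scope.
Hypothesis W_ge0 : forall f, L f -> (forall t : R, (0 < t <= M)%R -> (0 <= f t)%R) -> 0 <= W f.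
Hypothesis W_add : forall f g, L f -> L g -> (forall t : R, (0 < t <= M)%R -> (0 <= f t)%R) ->
  (forall t : R, (0 < t <= M)%R -> (0 <= g t)%R) -> W (fun t => f t + g t)%R = W f + W g.
Hypothesis W_scale : forall (c : R) f, (0 <= c)%R -> L f -> (forall t : R, (0 < t <= M)%R -> (0 <= f t)%R) ->
  W (fun t => c * f t)%R = c%:E * W f.
Hypothesis W_mono : forall f g, L f -> L g -> (forall t : R, (0 < t <= M)%R -> (0 <= f t <= g t)%R) ->
  W f <= W g.
Hypothesis W_sup : forall f B, L f -> (forall t : R, (0 < t <= M)%R -> (0 <= f t)%R) ->
  (forall n, W (soft_cut n.+1%:R^-1 f) <= B) -> W f <= B.

Let pw s : R -> R := fun t => (t `^ s)%R.
Let z s := W (pw s).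
Let phi u := W (heat_fun u).
Let g l := (l^-1)%:E * phi l^-1.
Let k t := g t * (t^-1)%:E.
Local Notation leb := (@lebesgue_measure R).

Lemma W_0 : W (fun=> 0)%R = 0.
Proof.
have := W_scale (lexx (0 : R)%R) (mlip0 M) (fun (t : R) _ => lexx (0 : R)%R); rewrite mul0e => <-.
by congr W; apply/funext => t; rewrite mul0r.
Qed.
Lemma W_sum (F : nat -> R -> R) n : (forall j, L (F j)) ->
  (forall j t, (0 < t <= M)%R -> (0 <= F j t)%R) ->
  W (fun t => \sum_(j < n) F j t)%R = \sum_(j < n) W (F j).
Proof.
move=> LF F0; elim: n => [|n IH].
  by rewrite big_ord0 (_ : (fun t => _) = (fun=> 0)%R) ?W_0//; apply/funext => t; rewrite big_ord0.
rewrite big_ord_recr/= -IH -W_add//.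
- by congr W; apply/funext => t; rewrite big_ord_recr.
- exact: mlip_sum.
- by move=> t tM; apply: sumr_ge0 => j _; exact: F0.
- by move=> t; exact: F0.
Qed.

Lemma heat_fun_ge0 (u t : R) : (0 < u)%R -> (0 <= heat_fun u t)%R.
Proof. by move=> u0; have /andP[] := heat_fun_bound t (ltW u0). Qed.
Lemma phi_ge0 u : (0 < u)%R -> 0 <= phi u.
Proof. by move=> u0; apply: W_ge0 => [|t _]; [exact: mlip_heat_fun|exact: heat_fun_ge0]. Qed.
Lemma phi_anti u u' : (0 < u)%R -> (u <= u')%R -> phi u' <= phi u.
Proof.
move=> u0 uu; have u'0 := lt_le_trans u0 uu.
apply: W_mono; [exact: mlip_heat_fun|exact: mlip_heat_fun|move=> t /andP[t0 _]].
by rewrite heat_fun_ge0//= !heat_fun_pos// ler_expR lerN2 ler_pM2r ?invr_gt0.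
Qed.
Lemma z_ge0 s : (1 <= s <= 2)%R -> 0 <= z s.
Proof. by move=> s12; apply: W_ge0 => [|t _]; [exact: mlip_powR|exact: powR_ge0]. Qed.

Lemma phi_le_z2 u : (0 < u)%R -> phi u <= (2 * u ^- 2)%:E * z 2.
Proof.
move=> u0; have s2 : (1 <= (2 : R) <= 2)%R by rewrite lexx ler1n.
have c0 : (0 <= 2 * u ^- 2)%R by rewrite mulr_ge0// invr_ge0 exprn_ge0// ltW.
rewrite -W_scale//; [|exact: mlip_powR|by move=> t _; exact: powR_ge0].
apply: W_mono; [exact: mlip_heat_fun|exact/mlipZ/mlip_powR|move=> t /andP[t0 _]].
by rewrite heat_fun_ge0//= heat_fun_le_sqr.
Qed.

Lemma kE t : k t = (t^-1 * t^-1)%:E * phi t^-1.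
Proof. by rewrite /k /g muleAC -EFinM. Qed.

Lemma k_ge0 t : (0 < t)%R -> 0 <= k t.
Proof.
by move=> t0; rewrite kE mule_ge0 ?phi_ge0 ?invr_gt0// lee_fin mulr_ge0// invr_ge0 ltW.
Qed.

(** The bound exp (- 1 / (t x)) <= 2 (t x)^2 cancels the factor t^(-2): this controls
    the Cesaro means near l = 1 and for l < 1, where zeta(2) suffices. *)
Lemma k_le t : (0 < t)%R -> k t <= 2%:E * z 2.
Proof.
move=> t0; rewrite kE; have ti : (0 < t^-1)%R by rewrite invr_gt0.
apply: (@le_trans _ _ ((t^-1 * t^-1)%:E * ((2 * t^-1 ^- 2)%:E * z 2))).
  by rewrite lee_wpmul2l ?phi_le_z2// lee_fin mulr_ge0// ltW.
rewrite muleA -EFinM (_ : (t^-1 * t^-1 * (2 * t^-1 ^- 2) = 2)%R)//.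
by field; rewrite gt_eqF.
Qed.

Let mpos : measurable (`]0%R, +oo[%classic : set R).
Proof. exact: measurable_itv. Qed.

(** The preimage of a half-line under a monotone function is an interval. *)
Lemma measurable_phiV : measurable_fun (`]0%R, +oo[%classic : set R) (fun t : R => phi t^-1).
Proof.
apply: (measurability _ (ErealGenOInfty.measurableE R)) => //.
move=> /= _ [_ [a ->]] <-; apply: is_interval_measurable => x y/=.
rewrite !in_itv/= !andbT => -[x0 xa] [y0 ya] w /andP[xw wy].
have w0 := lt_le_trans x0 xw; split; first by rewrite in_itv/= andbT.
rewrite in_itv/= andbT (lt_le_trans xa)//.
by apply: phi_anti; rewrite ?invr_gt0// lef_pV2.
Qed.

Lemma measurable_k : measurable_fun (`]0%R, +oo[%classic : set R) k.
Proof.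
rewrite (_ : k = (fun t => (t^-1 * t^-1)%:E * phi t^-1)); last by apply/funext => t; rewrite kE.
apply: emeasurable_funM; last exact: measurable_phiV.
apply/measurable_EFinP; apply: measurable_funTS.
by apply: measurable_funM; exact: measurable_funV.
Qed.

Lemma measurable_kS D : D `<=` `]0%R, +oo[%classic -> measurable_fun (D : set R) k.
Proof. by move=> DS; apply: (measurable_funS _ DS) => //; exact: measurable_k. Qed.

Lemma int_k_le (D : set R) (a b : R) c : measurable D -> D `<=` `[a, b]%classic -> (0 < a)%R ->
  leb D = (b - a)%:E -> 0 <= c -> (forall t, (a <= t <= b)%R -> k t <= c) ->
  \int[leb]_(t in D) k t <= c * (b - a)%:E.
Proof.
move=> mD Dab a0 Dm c0 kc.
have Dpos t : D t -> (0 < t)%R.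
  by move=> /Dab/=; rewrite in_itv/= => /andP[at_ _]; exact: lt_le_trans at_.
rewrite -Dm -integral_cst//; apply: ge0_le_integral => //.
- by move=> t /Dpos; exact: k_ge0.
- by apply: measurable_kS => t /Dpos /=; rewrite in_itv/= andbT.
- by move=> t /Dab/=; rewrite in_itv/=; exact: kc.
Qed.

Lemma int_k_ge (D : set R) (a b : R) c : measurable D -> D `<=` `[a, b]%classic -> (0 < a)%R ->
  leb D = (b - a)%:E -> 0 <= c -> (forall t, (a <= t <= b)%R -> c <= k t) ->
  c * (b - a)%:E <= \int[leb]_(t in D) k t.
Proof.
move=> mD Dab a0 Dm c0 kc.
have Dpos t : D t -> (0 < t)%R.
  by move=> /Dab/=; rewrite in_itv/= => /andP[at_ _]; exact: lt_le_trans at_.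
rewrite -Dm -integral_cst//; apply: ge0_le_integral => //.
- by apply: measurable_kS => t /Dpos /=; rewrite in_itv/= andbT.
- by move=> t /Dab/=; rewrite in_itv/=; exact: kc.
Qed.

Lemma leb_cc (a b : R) : (a <= b)%R -> leb `[a, b]%classic = (b - a)%:E.
Proof.
move=> ab; rewrite lebesgue_measure_itv/= lte_fin; case: ltP => // ba.
by rewrite (_ : b = a) ?subrr//; apply/eqP; rewrite eq_le ba ab.
Qed.
Lemma leb_oc (a b : R) : (a <= b)%R -> leb `]a, b]%classic = (b - a)%:E.
Proof.
move=> ab; rewrite lebesgue_measure_itv/= lte_fin; case: ltP => // ba.
by rewrite (_ : b = a) ?subrr//; apply/eqP; rewrite eq_le ba ab.
Qed.

Let e_ (n : nat) : R := expR n%:R.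
Let I (l : R) := \int[leb]_(t in `[1%R, l]) k t.

Lemma e_gt0 n : (0 < e_ n)%R. Proof. exact: expR_gt0. Qed.
Lemma e_ge1 n : (1 <= e_ n)%R.
Proof. by rewrite /e_ -[X in (X <= _)%R]expR0 ler_expR. Qed.
Lemma e_le n : (e_ n <= e_ n.+1)%R.
Proof. by rewrite /e_ ler_expR ler_nat. Qed.
Lemma e_V n : ((e_ n)^-1 = expR (- n%:R))%R.
Proof. by rewrite /e_ expRN. Qed.
Lemma e_S n : (e_ n.+1 = expR 1 * e_ n)%R.
Proof. by rewrite /e_ -expRD -natr1 addrC. Qed.

Lemma I_mono l l' : (l <= l')%R -> I l <= I l'.
Proof.
move=> ll; apply: ge0_subset_integral => //.
- by apply: measurable_kS => t /=; rewrite !in_itv/= => /andP[t1 _]; rewrite andbT; lra.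
- by move=> t /=; rewrite in_itv/= => /andP[t1 _]; apply: k_ge0; lra.
- by move=> t /=; rewrite !in_itv/= => /andP[-> h]/=; exact: le_trans ll.
Qed.

Lemma I_split n : I (e_ n.+1) = I (e_ n) + \int[leb]_(t in `]e_ n, e_ n.+1]) k t.
Proof.
rewrite /I -ge0_integral_setU//.
- by congr (integral leb _ k); rewrite -itv_bndbnd_setU// bnd_simp; [exact: e_ge1|exact: e_le].
- apply: measurable_kS => t /= []; rewrite !in_itv/= => /andP[t1 _]; rewrite andbT.
    by apply: lt_le_trans t1.
  by apply: lt_trans t1; exact: e_gt0.
- move=> t /= []; rewrite !in_itv/= => /andP[t1 _]; apply: k_ge0.
    by apply: lt_le_trans t1.
  by apply: lt_trans t1; exact: e_gt0.
- apply/disj_setPS => t /= []; rewrite !in_itv/= => /andP[_ h] /andP[h' _].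
  by move: (lt_le_trans h' h); rewrite ltxx.
Qed.

Let c1 : R := (expR 1 - 1)%R.
Lemma c1_gt0 : (0 < c1)%R.
Proof. by rewrite subr_gt0 expR_gt1. Qed.

Lemma k_bounds a b t : (0 < a)%R -> (a <= t <= b)%R ->
  (b^-1 * b^-1)%:E * phi a^-1 <= k t <= (a^-1 * a^-1)%:E * phi b^-1.
Proof.
move=> a0 /andP[at_ tb]; have t0 := lt_le_trans a0 at_; have b0 := lt_le_trans t0 tb.
have iv (x y : R) : (0 < x)%R -> (x <= y)%R -> (y^-1 <= x^-1)%R.
  by move=> x0 xy; rewrite lef_pV2 ?posrE//; exact: lt_le_trans xy.
have ip (x : R) : (0 < x)%R -> (0 <= x^-1)%R by move=> x0; rewrite invr_ge0 ltW.
rewrite kE; apply/andP; split.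
  apply: lee_pmul; rewrite ?lee_fin ?mulr_ge0 ?ip ?phi_ge0 ?invr_gt0//.
    by apply: ler_pM; rewrite ?ip ?iv.
  by apply: phi_anti; rewrite ?invr_gt0 ?iv.
apply: lee_pmul; rewrite ?lee_fin ?mulr_ge0 ?ip ?phi_ge0 ?invr_gt0//.
  by apply: ler_pM; rewrite ?ip ?iv.
by apply: phi_anti; rewrite ?invr_gt0 ?iv.
Qed.

(** The integrand is monotone up to its factor t^(-2), so on ]e^n, e^(n + 1)] it is
    bounded by its values at the ends. *)
Lemma I_upper n : I (e_ n) <= c1%:E * \sum_(j < n) (expR (- j%:R))%:E * phi (expR (- j.+1%:R)).
Proof.
elim: n => [|n IH].
  rewrite big_ord0 mule0 /I /e_ expR0.
  have : \int[leb]_(t in `[1%R, 1%R]) k t <= 2%:E * z 2 * (1 - 1)%:E.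
    apply: int_k_le => //; first by rewrite leb_cc.
      by rewrite mule_ge0 ?lee_fin// z_ge0// lexx ler1n.
    by move=> t /andP[t1 _]; apply: k_le; lra.
  by rewrite subrr mule0.
rewrite I_split big_ord_recr/= ge0_muleDr; first last.
- by rewrite mule_ge0 ?phi_ge0 ?expR_gt0// lee_fin expR_ge0.
- by apply: sume_ge0 => j _; rewrite mule_ge0 ?phi_ge0 ?expR_gt0// lee_fin expR_ge0.
apply: leeD => //.
apply: (@le_trans _ _ (((e_ n)^-1 * (e_ n)^-1)%:E * phi (e_ n.+1)^-1 * (e_ n.+1 - e_ n)%:E)).
  apply: int_k_le => //.
  - by apply: subset_itvr; rewrite bnd_simp.
  - exact: e_gt0.
  - by rewrite leb_oc// e_le.
  - by rewrite mule_ge0 ?phi_ge0 ?invr_gt0 ?e_gt0// lee_fin mulr_ge0// invr_ge0 ltW// e_gt0.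
  - by move=> t tt; have /andP[_ h] := k_bounds (e_gt0 n) tt; exact: h.
rewrite muleAC -EFinM muleA -EFinM -!e_V e_S.
rewrite (_ : ((e_ n)^-1 / e_ n * (expR 1 * e_ n - e_ n) = c1 / e_ n)%R)//.
by rewrite /c1; field; rewrite gt_eqF// e_gt0.
Qed.

Lemma I_lower n : (c1 / expR 1 ^+ 2)%:E * \sum_(j < n) (expR (- j%:R))%:E * phi (expR (- j%:R)) <= I (e_ n).
Proof.
have C0 : (0 <= c1 / expR 1 ^+ 2)%R by rewrite divr_ge0 ?exprn_ge0 ?expR_ge0// ltW// c1_gt0.
elim: n => [|n IH].
  rewrite big_ord0 mule0; apply: integral_ge0 => t /=; rewrite in_itv/= => /andP[t1 _].
  by apply: k_ge0; lra.
rewrite I_split big_ord_recr/= ge0_muleDr; first last.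
- by rewrite mule_ge0 ?phi_ge0 ?expR_gt0// lee_fin expR_ge0.
- by apply: sume_ge0 => j _; rewrite mule_ge0 ?phi_ge0 ?expR_gt0// lee_fin expR_ge0.
apply: leeD => //.
apply: (@le_trans _ _ (((e_ n.+1)^-1 * (e_ n.+1)^-1)%:E * phi (e_ n)^-1 * (e_ n.+1 - e_ n)%:E)); last first.
  apply: int_k_ge => //.
  - by apply: subset_itvr; rewrite bnd_simp.
  - exact: e_gt0.
  - by rewrite leb_oc// e_le.
  - by rewrite mule_ge0 ?phi_ge0 ?invr_gt0 ?e_gt0// lee_fin mulr_ge0// invr_ge0 ltW// e_gt0.
  - by move=> t tt; have /andP[h _] := k_bounds (e_gt0 n) tt; exact: h.
rewrite muleAC -EFinM muleA -EFinM -!e_V e_S.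
rewrite (_ : ((expR 1 * e_ n)^-1 / (expR 1 * e_ n) * (expR 1 * e_ n - e_ n) = c1 / expR 1 ^+ 2 / e_ n)%R)//.
by rewrite /c1; field; rewrite !gt_eqF ?expR_gt0// e_gt0.
Qed.

Definition cesaro_cst : R := (2 * expR 1 + (expR 1 - 1) * (expR 2 * pow_exp_cst R))%R.

Lemma cesaro_cst_gt0 : (0 < cesaro_cst)%R.
Proof.
apply: addr_gt0; first by rewrite mulr_gt0// expR_gt0.
by rewrite mulr_gt0 ?c1_gt0// mulr_gt0 ?expR_gt0// pow_exp_cst_gt0.
Qed.

Lemma cesaro_ge1 l : (1 <= l)%R -> cesaro_mean g l = ((ln l)^-1)%:E * I l.
Proof. by move=> l1; rewrite /cesaro_mean l1. Qed.

Lemma sum_phi_le n s : (1 <= s <= 2)%R -> (n%:R * (s - 1) <= 2)%R ->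
  \sum_(j < n) (expR (- j%:R))%:E * phi (expR (- j.+1%:R)) <= (expR 2 * pow_exp_cst R)%:E * z s.
Proof.
move=> s12 nv; have C0 : (0 <= expR 2 * pow_exp_cst R)%R by rewrite mulr_ge0 ?expR_ge0// ltW// pow_exp_cst_gt0.
have pos j (t : R) : (0 <= expR (- j%:R) * heat_fun (expR (- j.+1%:R)) t)%R.
  by apply: mulr_ge0; [exact: expR_ge0|apply: heat_fun_ge0; exact: expR_gt0].
have LF j : L (fun t => expR (- j%:R) * heat_fun (expR (- j.+1%:R)) t)%R.
  by apply/mlipZ/mlip_heat_fun; exact: expR_gt0.
rewrite -W_scale//; [|exact: mlip_powR|by move=> t _; exact: powR_ge0].
rewrite (eq_bigr (fun j : 'I_n => W (fun t => expR (- j%:R) * heat_fun (expR (- j.+1%:R)) t)%R)); last first.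
  move=> j _; rewrite W_scale ?expR_ge0//; [exact/mlip_heat_fun/expR_gt0|].
  by move=> t _; rewrite heat_fun_ge0// expR_gt0.
rewrite -(W_sum (F := fun j t => expR (- j%:R) * heat_fun (expR (- j.+1%:R)) t)%R)//.
apply: W_mono; [exact: (mlip_sum (F := fun j t => expR (- j%:R) * heat_fun (expR (- j.+1%:R)) t)%R)|exact/mlipZ/mlip_powR|].
move=> t /andP[t0 _]; rewrite sumr_ge0//=; exact: sum_heat_fun_le.
Qed.

(** For ln l >= 1, take s = 1 + 1 / ln l. Near l = 1 and for l < 1 the integrand
    is bounded, and the length of the interval is at most a multiple of |ln l|. *)
Lemma cesaro_le (Z l : R) : (forall s : R, (1 <= s <= 2)%R -> (s - 1)%:E * z s <= Z%:E) ->
  (0 < l)%R -> `|cesaro_mean g l| <= (cesaro_cst * Z)%:E.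
Proof.
move=> zZ l0.
have s22 : (1 <= (2 : R) <= 2)%R by rewrite lexx ler1n.
have z2 : z 2 <= Z%:E.
  by have := zZ 2%R s22; rewrite (_ : (2 - 1 = 1 :> R)%R) ?mul1e//; lra.
have Z0 : (0 <= Z)%R by rewrite -lee_fin (le_trans (z_ge0 s22)).
have e1 : (1 <= expR 1 :> R)%R by rewrite -[X in (X <= _)%R]expR0 ler_expR.
have k2 t : (0 < t)%R -> k t <= (2 * Z)%:E.
  by move=> t0; apply: (le_trans (k_le t0)); rewrite EFinM lee_pmul2l.
have CA2 : (2 * expR 1 * Z <= cesaro_cst * Z)%R.
  rewrite ler_wpM2r// lerDl mulr_ge0 ?(ltW c1_gt0)// mulr_ge0 ?expR_ge0//.
  exact/ltW/pow_exp_cst_gt0.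
have Z2 : (0 <= 2 * Z)%R by rewrite mulr_ge0.
have [l1|l1|->] := ltgtP l 1%R; last first.
- by rewrite /cesaro_mean ln1 invr0 mul0e abse0 lee_fin mulr_ge0// ltW// cesaro_cst_gt0.
- have lnl : (0 < ln l)%R by rewrite ln_gt0.
  have I0 : 0 <= I l.
    by apply: integral_ge0 => t /=; rewrite in_itv/= => /andP[t1 _]; apply: k_ge0; lra.
  rewrite (cesaro_ge1 (ltW l1)) gee0_abs; last by rewrite mule_ge0// lee_fin invr_ge0 ltW.
  suff Il : I l <= (cesaro_cst * Z * ln l)%:E.
    apply: (@le_trans _ _ (((ln l)^-1)%:E * (cesaro_cst * Z * ln l)%:E)).
      by rewrite lee_pmul2l// lte_fin invr_gt0.
    by rewrite -EFinM lee_fin mulrC mulfK// gt_eqF.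
  have [le1|le1] := leP (ln l) 1%R.
    have le : (l <= expR 1)%R by rewrite -[X in (X <= _)%R]lnK ?posrE// ler_expR.
    apply: (@le_trans _ _ ((2 * Z)%:E * (l - 1)%:E)).
      apply: int_k_le => //; first by rewrite leb_cc// ltW.
      by move=> t /andP[t1 _]; apply: k2; lra.
    rewrite -EFinM lee_fin.
    have h : (l - 1 <= expR 1 * ln l)%R.
      apply: (@le_trans _ _ (l * ln l)%R); last by rewrite ler_wpM2r// ltW.
      have : (ln (1 + (l^-1 - 1)) <= l^-1 - 1)%R.
        by apply: le_ln1Dx; rewrite ltrBrDl addrN invr_gt0.
      rewrite addrC subrK lnV ?posrE// -(ler_pM2l l0) mulrBr mulfV ?gt_eqF// mulrN mulr1; lra.
    apply: (@le_trans _ _ (2 * expR 1 * Z * ln l)%R); last by rewrite ler_wpM2r// ltW.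
    by rewrite (_ : (2 * expR 1 * Z * ln l = 2 * Z * (expR 1 * ln l))%R) ?ler_wpM2l//; ring.
  pose N := (Num.truncn (ln l)).+1.
  have /andP[N1 N2] : (N%:R - 1 <= ln l < N%:R)%R.
    by rewrite /N -natr1 addrK natr1; apply: truncn_itv; exact: ltW.
  pose v := ((ln l)^-1)%R.
  have v0 : (0 < v)%R by rewrite invr_gt0.
  have v1 : (v <= 1)%R by rewrite invf_le1// ltW.
  have vl : (ln l * v = 1)%R by rewrite mulfV// gt_eqF.
  have s12 : (1 <= 1 + v <= 2)%R by apply/andP; split; lra.
  have Nv : (N%:R * (1 + v - 1) <= 2)%R.
    rewrite (addrC 1%R) addrK.
    have : (N%:R * v <= (ln l + 1) * v)%R by rewrite ler_pM2r// -lerBlDr.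
    by rewrite mulrDl vl mul1r; move: (N%:R * v)%R => ?; lra.
  have zs : z (1 + v)%R <= (Z * ln l)%:E.
    have := zZ _ s12; rewrite (addrC 1%R) addrK addrC => h.
    by rewrite mulrC EFinM -lee_pdivrMl.
  apply: (@le_trans _ _ (I (e_ N))).
    by apply: I_mono; rewrite -[X in (X <= _)%R]lnK ?posrE// ler_expR ltW.
  apply: (le_trans (I_upper N)).
  apply: (@le_trans _ _ (c1%:E * ((expR 2 * pow_exp_cst R)%:E * (Z * ln l)%:E))).
    apply: lee_wpmul2l; first by rewrite lee_fin ltW// c1_gt0.
    apply: (le_trans (sum_phi_le s12 Nv)).
    by apply: lee_wpmul2l; rewrite // lee_fin mulr_ge0 ?expR_ge0// ltW// pow_exp_cst_gt0.
  rewrite -!EFinM lee_fin (_ : (c1 * (expR 2 * pow_exp_cst R * (Z * ln l)) = (cesaro_cst - 2 * expR 1) * Z * ln l)%R); last first.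
    by rewrite /cesaro_cst /c1; ring.
  rewrite ler_wpM2r ?(ltW lnl)// ler_wpM2r// gerBl.
  by rewrite mulr_ge0// expR_ge0.
- have lnl : (ln l < 0)%R by rewrite ln_lt0// l0.
  rewrite /cesaro_mean (leNgt 1%R l) l1/= muleN abseN.
  have I0 : 0 <= \int[leb]_(t in `[l, 1%R]) k t.
    by apply: integral_ge0 => t /=; rewrite in_itv/= => /andP[t1 _]; apply: k_ge0; lra.
  rewrite abseM (gee0_abs I0) abse_EFin ltr0_norm ?invr_lt0// -invrN.
  have nl : (0 < - ln l)%R by rewrite oppr_gt0.
  apply: (@le_trans _ _ (((- ln l)^-1)%:E * ((2 * Z)%:E * (1 - l)%:E))).
    rewrite lee_pmul2l// ?lte_fin ?invr_gt0//.
    apply: int_k_le => //; first by rewrite leb_cc// ltW.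
    by move=> t /andP[t1 _]; apply: k2; lra.
  rewrite -!EFinM lee_fin mulrC ler_pdivrMr//.
  have h : (1 - l <= - ln l)%R.
    have : (ln (1 + (l - 1)) <= l - 1)%R by apply: le_ln1Dx; lra.
    by rewrite addrC subrK; lra.
  apply: (@le_trans _ _ (2 * Z * - ln l)%R); first by rewrite ler_wpM2l.
  rewrite ler_wpM2r ?(ltW nl)//; apply: le_trans CA2.
  by rewrite ler_wpM2r// ler_peMr.
Qed.

Local Notation lebpos := (mrestr leb (measurable_itv `]0%R, +oo[)).

Lemma lebpos_gt0 : 0 < lebpos setT.
Proof. by rewrite /mrestr setTI lebesgue_measure_itv/= ltry sube0. Qed.

Lemma sup_norm_ess f : sup_norm f = ess_sup lebpos (abse \o f).
Proof. by rewrite /sup_norm unlock /Lnorm lebpos_gt0. Qed.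

Lemma sup_norm_le (Z : \bar R) : (forall s : R, (1 <= s <= 2)%R -> (s - 1)%:E * z s <= Z) ->
  sup_norm (cesaro_mean g) <= cesaro_cst%:E * Z.
Proof.
move=> zZ; have Z0 : 0 <= Z.
  by have := zZ 1%R; rewrite lexx ler1n subrr mul0e; apply.
case: Z Z0 zZ => [Z Z0 zZ|_ _|//]; last by rewrite gt0_muley ?lte_fin ?cesaro_cst_gt0// leey.
rewrite sup_norm_ess; apply/ess_supP.
exists (~` `]0%R, +oo[%classic); split.
- by apply: measurableC; exact: measurable_itv.
- by change (leb (~` `]0%R, +oo[%classic `&` `]0%R, +oo[%classic) = 0); rewrite setIC setICr measure0.
- move=> l /= h l0; apply: h; rewrite -EFinM; apply: cesaro_le => //.
  by move: l0; rewrite in_itv/= andbT.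
Qed.

Let c2 : R := (c1 / expR 1 ^+ 2)%R.
Let c2_gt0 : (0 < c2)%R.
Proof. by rewrite divr_gt0 ?c1_gt0// exprn_gt0// expR_gt0. Qed.

Definition zeta_cst : R :=
  ((expR 3 * (1 + expR 1) + 4 * (expR 1 * (M * (1 + M)))) / ((expR 1 - 1) / expR 1 ^+ 2))%R.

Lemma zeta_cst_gt0 : (0 < zeta_cst)%R.
Proof.
apply: divr_gt0; last exact: c2_gt0.
apply: addr_gt0; first by rewrite mulr_gt0 ?expR_gt0// addr_gt0// expR_gt0.
by rewrite mulr_gt0// mulr_gt0 ?expR_gt0// mulr_gt0// addr_gt0.
Qed.

(** An essential supremum bounds some value of the mean in each interval
    ]e^n, e^(n + 1)[, of positive measure; the integral up to e^n is smaller than at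
    that point, where ln l <= n + 1. *)
Lemma I_le_sup (S : R) n : sup_norm (cesaro_mean g) <= S%:E -> I (e_ n) <= (S * n.+1%:R)%:E.
Proof.
rewrite sup_norm_ess => /ess_supP[A [mA A0 hA]].
have [l [l0 l1 Sl]] : exists l, [/\ (e_ n < l)%R, (l < e_ n.+1)%R & `|cesaro_mean g l| <= S%:E].
  apply: contrapT => nl.
  have sub : `]e_ n, e_ n.+1[%classic `<=` A.
    move=> l; rewrite /= in_itv/= => /andP[h1 h2]; apply: hA => /= Sl.
    by apply: nl; exists l.
  have : leb (`]e_ n, e_ n.+1[%classic : set R) = 0.
    apply: (@subset_measure0 _ _ _ leb _ (A `&` `]0%R, +oo[%classic)) => //.
    - exact: measurableI.
    - move=> l il; split; first exact: sub.
      by move: il; rewrite /= !in_itv/= andbT => /andP[h _]; apply: lt_trans h; exact: e_gt0.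
  rewrite lebesgue_measure_itv/= lte_fin /e_ ltr_expR ltr_nat ltnSn -EFinB => -[/eqP].
  by rewrite subr_eq0 => /eqP/expR_inj/eqP; rewrite eqr_nat -[X in _ == X]addn0 -addn1 eqn_add2l.
have l1' : (1 <= l)%R by apply: le_trans (ltW l0); exact: e_ge1.
have I0 : 0 <= I l.
  by apply: integral_ge0 => t /=; rewrite in_itv/= => /andP[t1 _]; apply: k_ge0; lra.
have lp : (0 < l)%R by lra.
have lnl : (0 < ln l)%R.
  by rewrite ln_gt0//; apply: le_lt_trans l0; exact: e_ge1.
move: Sl; rewrite cesaro_ge1// gee0_abs; last by rewrite mule_ge0// lee_fin invr_ge0 ltW.
rewrite lee_pdivrMl// => Il.
apply: (@le_trans _ _ (I l)); first exact/I_mono/ltW.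
apply: (le_trans Il); rewrite -EFinM lee_fin mulrC.
have S0 : (0 <= S)%R.
  by rewrite -(pmulr_rge0 _ lnl) -lee_fin EFinM (le_trans I0).
rewrite ler_wpM2l// -ler_expR lnK ?posrE//; exact: ltW.
Qed.

(** By [W_sup] and [cut_pow_le], zeta(s) is bounded by sums of r^j b_j, with
    r = e^(1 - s) and b_j = e^(-j) W(h_(e^(-j))). The Cesaro bound is
    a linear bound on the partial sums of b, so [abel_sum] gives a bound of order
    1 / (1 - r), that is 1 / (s - 1). *)
Lemma zeta_le_fin (S s : R) : sup_norm (cesaro_mean g) <= S%:E -> (1 < s <= 2)%R ->
  (s - 1)%:E * z s <= (zeta_cst * S)%:E.
Proof.
move=> hS /andP[s1 s2]; have s12 : (1 <= s <= 2)%R by rewrite (ltW s1).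
pose v := (s - 1)%R; have v0 : (0 < v)%R by rewrite subr_gt0.
have v1 : (v <= 1)%R by rewrite /v; lra.
pose b j := (expR (- j%:R))%:E * phi (expR (- j%:R)).
have b0 j : 0 <= b j by rewrite mule_ge0 ?phi_ge0 ?expR_gt0// lee_fin expR_ge0.
have bS n : \sum_(j < n) b j <= ((S / c2) * n.+1%:R)%:E.
  have := le_trans (I_lower n) (I_le_sup n hS).
  rewrite -/c2 -lee_pdivlMl// -EFinM => /le_trans; apply.
  by rewrite lee_fin mulrA (mulrC _ S).
have bfin j : b j \is a fin_num.
  rewrite ge0_fin_numE//; apply: (@le_lt_trans _ _ (\sum_(i < j.+1) b i)); last first.
    by apply: (le_lt_trans (bS j.+1)); exact: ltry.
  by rewrite big_ord_recr/= leeDr// sume_ge0.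
pose be j := fine (b j).
have beE j : b j = (be j)%:E by rewrite fineK.
have be0 j : (0 <= be j)%R by exact: fine_ge0.
pose D := (S / c2)%R.
have beS n : (\sum_(j < n) be j <= D * n.+1%:R)%R.
  rewrite -lee_fin -sumEFin (eq_bigr (fun j : 'I_n => b j)); first exact: bS.
  by move=> j _; rewrite beE.
have D0 : (0 <= D)%R by have := beS 0%N; rewrite big_ord0 mulr1.
pose r := expR (- v).
have r01 : (0 < r < 1)%R by rewrite expR_gt0/= -[X in (_ < X)%R]expR0 ltr_expR oppr_lt0.
have r1 : (expR (- 1) * v <= 1 - r)%R.
  have h1 : (expR (- 1) <= r)%R by rewrite /r ler_expR lerN2.
  have h2 : (1 + v <= expR v)%R by exact: expR_ge1Dx.
  have h3 : (r * expR v = 1)%R by rewrite /r -expRD addNr expR0.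
  have r0 : (0 < r)%R by exact: expR_gt0.
  have h4 : (r * (1 + v) <= 1)%R by rewrite -[X in (_ <= X)%R]h3 ler_pM2l.
  have h5 : (expR (- 1) * v <= r * v)%R by rewrite ler_pM2r.
  by move: h4 h5; rewrite mulrDr mulr1; lra.
pose B := (expR 3 * (D + D / (1 - r)) + expR 1 * (M * (1 + M)) * (2 * D))%R.
have zB : z s <= B%:E.
  apply: W_sup; [exact: mlip_powR|by move=> t _; exact: powR_ge0|move=> n].
  pose F j t := (expR (- (j%:R * s)) * heat_fun (expR (- j%:R)) t)%R.
  have F0 j t : (0 <= F j t)%R.
    by apply: mulr_ge0; [exact: expR_ge0|apply: heat_fun_ge0; exact: expR_gt0].
  have LF j : L (F j) by apply/mlipZ/mlip_heat_fun; exact: expR_gt0.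
  have S0 t : (0 <= \sum_(j < n.+2) F j t)%R by apply: sumr_ge0 => j _.
  have L1 : L (fun t => expR 3 * \sum_(j < n.+2) F j t)%R by apply/mlipZ/mlip_sum.
  have L2 : L (fun t => expR 1 * (M * (1 + M)) * heat_fun 1 t)%R by apply/mlipZ/mlip_heat_fun.
  have C0 : (0 <= expR 1 * (M * (1 + M)))%R.
    by rewrite !mulr_ge0 ?expR_ge0// ?addr_ge0// ltW.
  have WF j : W (F j) = (r ^+ j * be j)%:E.
    rewrite W_scale ?expR_ge0//; first last.
    - by move=> t _; apply: heat_fun_ge0; exact: expR_gt0.
    - exact/mlip_heat_fun/expR_gt0.
    rewrite EFinM -beE /b muleA -EFinM; congr (_%:E * _).
    rewrite /r -expRM_natl -expRD; congr expR; rewrite /v; ring.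
  have W1 : phi 1 = (be 0%N)%:E by rewrite -beE /b oppr0 expR0 mul1e.
  apply: (@le_trans _ _ (W (fun t => expR 3 * (\sum_(j < n.+2) F j t) + expR 1 * (M * (1 + M)) * heat_fun 1 t)%R)).
    apply: W_mono; [|exact: mlipD|].
      by exact/mlip_cut/mlip_powR.
    move=> t tM; apply/andP; split; first by rewrite /soft_cut le_max lexx orbT.
    exact: cut_pow_le.
  rewrite W_add//; first last.
  - by move=> t _; rewrite mulr_ge0// heat_fun_ge0.
  - by move=> t _; rewrite mulr_ge0 ?expR_ge0.
  rewrite W_scale ?expR_ge0//; last exact: mlip_sum.
  rewrite W_scale//; [|exact: mlip_heat_fun|by move=> t _; rewrite heat_fun_ge0].
  rewrite (W_sum n.+2 LF (fun j t _ => F0 j t)) -/(phi 1) W1.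
  rewrite (eq_bigr (fun j : 'I_n.+2 => (r ^+ j * be j)%:E)); last by move=> j _; exact: WF.
  rewrite sumEFin -!EFinM -EFinD lee_fin; apply: lerD.
    by rewrite ler_wpM2l ?expR_ge0//; exact: abel_sum.
  rewrite ler_wpM2l//; have := beS 1%N; rewrite big_ord1.
  by rewrite mulrC.
apply: (@le_trans _ _ (v%:E * B%:E)); first by rewrite lee_pmul2l.
rewrite -EFinM lee_fin.
have vD : (v * (D / (1 - r)) <= D * expR 1)%R.
  have r1' : (0 < 1 - r)%R by rewrite subr_gt0; case/andP: r01.
  rewrite mulrCA ler_wpM2l// ler_pdivrMr//.
  have : (expR 1 * (expR (- 1) * v) <= expR 1 * (1 - r))%R by rewrite ler_pM2l// expR_gt0.
  by rewrite mulrA -expRD addrN expR0 mul1r.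
have C'0 : (0 <= expR 1 * (M * (1 + M)))%R.
  by rewrite !mulr_ge0 ?expR_ge0// ?addr_ge0// ltW.
have -> : (zeta_cst * S = (expR 3 * (1 + expR 1) + 4 * (expR 1 * (M * (1 + M)))) * D)%R.
  by rewrite /zeta_cst /D /c2 /c1 -!mulrA; congr (_ * _)%R; rewrite mulrC.
rewrite /B; move: (D / (1 - r))%R vD => X vD.
have h1 : (expR 3 * (v * D + v * X) <= expR 3 * (D + D * expR 1))%R.
  by rewrite ler_wpM2l ?expR_ge0// lerD// ler_piMl.
have h2 : (v * (expR 1 * (M * (1 + M)) * (2 * D)) <= 4 * (expR 1 * (M * (1 + M))) * D)%R.
  move: C'0; move: (expR 1 * (M * (1 + M)))%R => C C0.
  have CD : (0 <= C * D)%R by rewrite mulr_ge0.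
  have : (v * (C * D) <= C * D)%R by rewrite ler_piMl.
  have -> : (v * (C * (2 * D)) = 2 * (v * (C * D)))%R by ring.
  have -> : (4 * C * D = 4 * (C * D))%R by ring.
  by move: CD; move: (v * (C * D))%R (C * D)%R => ? ?; lra.
have e1 : (v * (expR 3 * (D + X) + expR 1 * (M * (1 + M)) * (2 * D)) =
  expR 3 * (v * D + v * X) + v * (expR 1 * (M * (1 + M)) * (2 * D)))%R by ring.
have e2 : ((expR 3 * (1 + expR 1) + 4 * (expR 1 * (M * (1 + M)))) * D =
  expR 3 * (D + D * expR 1) + 4 * (expR 1 * (M * (1 + M))) * D)%R by ring.
by rewrite e1 e2 lerD.
Qed.

Lemma zeta_le s : (1 <= s <= 2)%R -> (s - 1)%:E * z s <= zeta_cst%:E * sup_norm (cesaro_mean g).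
Proof.
move=> /andP[s1 s2].
have sup0 : 0 <= sup_norm (cesaro_mean g).
  rewrite sup_norm_ess; apply: ess_sup_gee; first exact: lebpos_gt0.
  by apply: aeW => x; exact: abse_ge0.
move: s1; rewrite le_eqVlt => /predU1P[<-|s1].
  by rewrite subrr mul0e mule_ge0// lee_fin ltW// zeta_cst_gt0.
case E : (sup_norm (cesaro_mean g)) sup0 => [S||]// S0.
  by rewrite -EFinM; apply: zeta_le_fin; [rewrite E|rewrite s1].
by rewrite gt0_muley ?lte_fin ?zeta_cst_gt0// leey.
Qed.
End Comparison.

(** * Equivalence of the norms *)

Section Norms.
Variable R : realType.
Local Open Scope ereal_scope.

Lemma poweR_half_sqr (x : \bar R) : 0 <= x -> poweR x 2^-1 * poweR x 2^-1 = x.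
Proof.
case: x => [r||//] x0; last by rewrite poweRyr ?invr_eq0 ?pnatr_eq0// mulyy.
by rewrite !poweR_EFin -EFinM powR12_sqrt// -expr2 sqr_sqrtr.
Qed.

Lemma poweR_half_scale (c : R) (y : \bar R) : (0 < c)%R -> 0 <= y ->
  poweR (c%:E * (y * y)) 2^-1 = (Num.sqrt c)%:E * y.
Proof.
move=> c0; case: y => [r||//] y0.
  rewrite -!EFinM poweR_EFin powR12_sqrt; last by rewrite mulr_ge0 ?(ltW c0)// -expr2 sqr_ge0.
  by rewrite sqrtrM ?(ltW c0)// -expr2 sqrtr_sqr ger0_norm.
rewrite mulyy !gt0_muley ?lte_fin ?sqrtr_gt0//.
by rewrite poweRyr ?invr_eq0 ?pnatr_eq0.
Qed.

(** At a point l > 0 the mean only involves values of the function on ]0, +oo[. *)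
Lemma sup_norm_cesaro_eq (f h : R -> \bar R) : (forall l, (0 < l)%R -> f l = h l) ->
  sup_norm (cesaro_mean f) = sup_norm (cesaro_mean h).
Proof.
move=> fh; rewrite !sup_norm_ess; apply: eq_ess_sup.
exists (~` `]0%R, +oo[%classic); split.
- by apply: measurableC; exact: measurable_itv.
- by change (@lebesgue_measure R (~` `]0%R, +oo[%classic `&` `]0%R, +oo[%classic) = 0); rewrite setIC setICr measure0.
move=> l /= nl; rewrite in_itv/= andbT => l0; apply: nl.
rewrite /cesaro_mean; congr (abse (_ * _)).
case: ifPn => l1; [|congr (- _)]; apply: eq_integral => t /[!inE]/=; rewrite in_itv/= => /andP[h1 h2]; rewrite fh//; lra.
Qed.
End Norms.

(** Both norms are square roots of the quantities compared above; the weight W is the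
    only link to the operators. *)
Section Equivalence.
Variables (R : realType) (H : completeNormedModType R[i]).
Variable dot : {dot H for @Num.conj R[i]}.
Variables (tau : (H -> H) -> \bar R) (G a : H -> H) (M : R) (W : (R -> R) -> \bar R).
Hypothesis M0 : 0 < M.
Local Open Scope ereal_scope.
Hypothesis W_ge0 : forall f, mlip M f -> (forall t : R, (0 < t <= M)%R -> (0 <= f t)%R) -> 0 <= W f.
Hypothesis W_add : forall f g, mlip M f -> mlip M g -> (forall t : R, (0 < t <= M)%R -> (0 <= f t)%R) ->
  (forall t : R, (0 < t <= M)%R -> (0 <= g t)%R) -> W (fun t => f t + g t)%R = W f + W g.
Hypothesis W_scale : forall (c : R) f, (0 <= c)%R -> mlip M f -> (forall t : R, (0 < t <= M)%R -> (0 <= f t)%R) ->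
  W (fun t => c * f t)%R = c%:E * W f.
Hypothesis W_mono : forall f g, mlip M f -> mlip M g -> (forall t : R, (0 < t <= M)%R -> (0 <= f t <= g t)%R) ->
  W f <= W g.
Hypothesis W_sup : forall f B, mlip M f -> (forall t : R, (0 < t <= M)%R -> (0 <= f t)%R) ->
  (forall n, W (soft_cut n.+1%:R^-1 f) <= B) -> W f <= B.
Hypothesis zetaW : forall s : R, (1 <= s <= 2)%R ->
  zeta dot tau G (adjoint dot a) a s = W (fun t => t `^ s)%R.
Hypothesis heatW : forall l : R, (0 < l)%R ->
  tau (adjoint dot a \o heat_op dot G l \o a) = W (heat_fun l^-1).

Let X : \bar R := sup_norm (cesaro_mean (heat_trace dot tau G (adjoint dot a) a)).
Let zn := zeta_norm dot tau G a.

Let XE : X = sup_norm (cesaro_mean (fun l => (l^-1)%:E * W (heat_fun l^-1))).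
Proof. by apply: sup_norm_cesaro_eq => l l0; rewrite /heat_trace heatW. Qed.

Let term s := (Num.sqrt (s - 1))%:E * poweR (zeta dot tau G (adjoint dot a) a s) 2^-1.

Let zge0 s : (1 <= s <= 2)%R -> 0 <= W (fun t => t `^ s)%R.
Proof. exact: (z_ge0 W_ge0). Qed.

Let term_sqr s : (1 <= s <= 2)%R -> term s * term s = (s - 1)%:E * W (fun t => t `^ s)%R.
Proof.
move=> s12; rewrite /term zetaW// muleACA poweR_half_sqr ?zge0//.
rewrite -EFinM -expr2 sqr_sqrtr// subr_ge0; by case/andP: s12.
Qed.

Let term_ge0 s : 0 <= term s.
Proof. by rewrite mule_ge0 ?lee_fin ?sqrtr_ge0// poweR_ge0. Qed.

Let term_le s : (1 <= s <= 2)%R -> term s <= zn.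
Proof. by move=> s12; apply: ereal_sup_ubound; exists s => //=; rewrite in_itv. Qed.

Let zn_ge0 : 0 <= zn.
Proof. by apply: (le_trans (term_ge0 1)); apply: term_le; rewrite lexx ler1n. Qed.

Let X_ge0 : 0 <= X.
Proof.
rewrite /X sup_norm_ess; apply: ess_sup_gee; first exact: lebpos_gt0.
by apply: aeW => x; exact: abse_ge0.
Qed.

Lemma HK_le_zeta : ((Num.sqrt (cesaro_cst R))^-1)%:E * HK_norm dot tau G a <= zn.
Proof.
have s0 : (0 < Num.sqrt (cesaro_cst R))%R by rewrite sqrtr_gt0 cesaro_cst_gt0.
rewrite lee_pdivrMl// -poweR_half_scale ?cesaro_cst_gt0//.
apply: gt0_ler_poweR; rewrite ?in_itv/= ?leey ?andbT//.
  by rewrite mule_ge0 ?mule_ge0// lee_fin ltW// cesaro_cst_gt0.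
rewrite -/X XE; apply: (sup_norm_le W_ge0 W_add W_scale W_mono) => s s12.
by rewrite -term_sqr// lee_pmul// term_le.
Qed.

Lemma zeta_le_HK : zn <= (Num.sqrt (zeta_cst M))%:E * HK_norm dot tau G a.
Proof.
apply: ge_ereal_sup => y [s s12 <-]; rewrite -/(term s).
move: s12; rewrite /= in_itv/= => s12.
have c0 := zeta_cst_gt0 M0.
rewrite /HK_norm -/X -poweR_half_scale//; last exact: poweR_ge0.
rewrite poweR_half_sqr//.
have -> : term s = poweR (term s * term s) 2^-1.
  by have := poweR_half_scale ltr01 (term_ge0 s); rewrite sqrtr1 !mul1e => ->.
apply: gt0_ler_poweR; rewrite ?in_itv/= ?leey ?andbT//.
- by rewrite mule_ge0.
- by rewrite mule_ge0// lee_fin ltW.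
rewrite term_sqr// XE.
exact: (zeta_le M0 W_ge0 W_add W_scale W_mono W_sup).
Qed.
End Equivalence.

Theorem theorem4p4 (R : realType) (H : completeNormedModType R[i])
  (dot : {dot H for @Num.conj R[i]})
  (hilbertH : hilbert_norm dot) (separableH : separable_space H)
  (N : set (H -> H)) (vnN : von_neumann_algebra dot N)
  (tau : (H -> H) -> \bar R)
  (trace_tau : faithful_normal_semifinite_trace dot N tau)
  (G : H -> H) (NG : N G) (posG : positive_op dot G) (injG : injective G) :
  exists c C : R, [/\ 0 < c, c <= C &
    forall a : H -> H, N a ->
      (c%:E * HK_norm dot tau G a <= zeta_norm dot tau G a)%E /\
      (zeta_norm dot tau G a <= C%:E * HK_norm dot tau G a)%E].
Proof.
have /bounded_operatorsP[lG [K K0 GK]] := N_bop vnN NG.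
pose M := K + 1; have M0 : 0 < M by rewrite ltr_wpDl.
have bG v : nrm (G v) <= M * nrm v.
  by rewrite (le_trans (GK v))// ler_wpM2r ?nrm_ge0// lerDl.
have sG : rsym dot G.
  apply: real_rsym => // v; have := posG v.
  by case: (dot _ _) => x y; rewrite lecE/= => /andP[/eqP].
have pG v : 0 <= re_dot dot (G v) v.
  by have := posG v; rewrite /re_dot; case: (dot _ _) => x y; rewrite lecE/= => /andP[].
have sA : 0 < Num.sqrt (cesaro_cst R) by rewrite sqrtr_gt0 cesaro_cst_gt0.
exists (Num.sqrt (cesaro_cst R))^-1, (Num.max (Num.sqrt (cesaro_cst R))^-1 (Num.sqrt (zeta_cst M))).
split; [by rewrite invr_gt0|by rewrite le_max lexx|move=> a Na].
have HK0 : (0 <= HK_norm dot tau G a)%E by exact: poweR_ge0.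
suff [W [W1 W2 W3 W4] [W5 zW hW]] : exists2 W : (R -> R) -> \bar R,
  [/\ forall f, mlip M f -> (forall t : R, 0 < t <= M -> 0 <= f t) -> (0 <= W f)%E,
    forall f g, mlip M f -> mlip M g -> (forall t : R, 0 < t <= M -> 0 <= f t) ->
      (forall t : R, 0 < t <= M -> 0 <= g t) -> W (fun t => f t + g t) = (W f + W g)%E,
    forall (c : R) f, 0 <= c -> mlip M f -> (forall t : R, 0 < t <= M -> 0 <= f t) ->
      W (fun t => c * f t) = (c%:E * W f)%E &
    forall f g, mlip M f -> mlip M g -> (forall t : R, 0 < t <= M -> 0 <= f t <= g t) ->
      (W f <= W g)%E] &
  [/\ forall f B, mlip M f -> (forall t : R, 0 < t <= M -> 0 <= f t) ->
        (forall n, W (soft_cut n.+1%:R^-1 f) <= B)%E -> (W f <= B)%E,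
    forall s : R, 1 <= s <= 2 -> zeta dot tau G (adjoint dot a) a s = W (fun t => t `^ s) &
    forall l : R, 0 < l -> tau (adjoint dot a \o heat_op dot G l \o a) = W (heat_fun l^-1)].
  split; first exact: (HK_le_zeta W1 W2 W3 W4 zW hW).
  apply: (le_trans (zeta_le_HK M0 W1 W2 W3 W4 W5 zW hW)).
  by rewrite lee_wpmul2r// lee_fin le_max lexx orbT.
(* If G has no spectral measure, or a has no bounded adjoint, every operator a^* x a
   below is 0 and the weight W = 0 will do. *)
have [[[E [mu [pvm spec]]] aj]|degenerate] :=
    pselect (has_spec dot (graph G) /\ is_adjoint dot a (adjoint dot a)).
  exists (tau_calc dot tau G M a); split.
  - exact: (tau_calc_ge0 hilbertH vnN trace_tau lG M0 bG sG pG injG NG pvm spec Na aj).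
  - exact: (tau_calc_add hilbertH vnN trace_tau lG M0 bG sG pG injG NG pvm spec Na aj).
  - exact: (tau_calc_scale hilbertH vnN trace_tau lG M0 bG sG pG injG NG pvm spec Na aj).
  - exact: (tau_calc_mono hilbertH vnN trace_tau lG M0 bG sG pG injG NG pvm spec Na aj).
  - exact: (tau_calc_sup hilbertH vnN trace_tau lG M0 bG sG pG injG NG pvm spec Na aj).
  - move=> s s12; rewrite /zeta /tau_calc /compress; congr (tau (_ \o _ \o _)).
    apply: (calc_opE hilbertH lG M0 bG sG pG pvm spec (mlip_powR M s12)).
    exact: (op_powerE hilbertH lG M0 bG sG pG pvm spec).
  - move=> l l0; have u0 : 0 < l^-1 by rewrite invr_gt0.
    rewrite /tau_calc /compress; congr (tau (_ \o _ \o _)).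
    apply: (calc_opE hilbertH lG M0 bG sG pG pvm spec (mlip_heat_fun M u0)).
    exact: (heat_opE hilbertH lG M0 bG sG pG injG pvm spec).
have comp0 x : (~ has_spec dot (graph G) -> x = 0) -> tau (adjoint dot a \o x \o a) = 0%E.
  move=> x0; rewrite (_ : _ \o _ = 0); first exact: (tau0 vnN trace_tau).
  apply/funext => v /=; case: (pselect (has_spec dot (graph G))) => [sp|/x0 ->]; last first.
    exact: (lin0 (adj_lin vnN Na)).
  have -> // : adjoint dot a = 0.
  apply: xgetPN => y [by_ ay]; apply: degenerate; split=> //.
  by rewrite /adjoint; case: xgetP => [? _ []//|/(_ y)[]].
exists (fun=> 0%E); split=> //.
- by move=> *; rewrite adde0.
- by move=> *; rewrite mule0.
- by move=> f B _ _ /(_ 0%N).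
- by move=> s _; apply: comp0 => nsp; exact: no_spec_calc.
- move=> l _; apply: comp0 => nsp; apply: no_spec_calc => sp; apply: nsp.
  exact: (inverse_spec hilbertH lG M0 bG sG pG injG sp).
Qed.
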